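(* It is undecidable whether a given one-clock universal alternating timed automaton $\mathcal{A}$ with a weak parity acceptance condition of index $(1,2)$ accepts some non-Zeno timed word, even when the only clock constraints used by $\mathcal{A}$ are $x\le 1$ and $x>1$ (in particular, $\mathcal{A}$ uses no equality tests). The same holds with ''some non-Zeno timed word'' replaced by ''some timed word''.
   Context: A one-clock alternating timed automaton (ATA) $\langle Q,\Sigma,q_0,\delta,\Omega\rangle$ has finite state set $Q$, $\Omega:Q\to\mathbb{N}$ and transition function $\delta:Q\times\Sigma\times\Phi\rightharpoonup\mathcal{B}^+(Q\times\{\mathrm{nop},\mathrm{reset}\})$ (positive boolean formulas over atoms $\top,\bot,(q,f)$), $\Phi$ being clock constraints on the single clock $x$, satisfying the partition condition (for each $q,a,v$ at most one $\theta$ with $\delta(q,a,\theta)$ defined and $v\models\theta$). It is universal if all formulas in the range of $\delta$ use no disjunction. Acceptance of a timed word $(a_1,t_1)(a_2,t_2)\dots$ (with $t_i$ strictly increasing; non-Zeno means unbounded) is via the standard game: from $(q_k,v_k)$ the clock becomes $v'=v_k+t_{k+1}-t_k$, the unique enabled formula $\delta(q_k,a_{k+1},\theta)$ is resolved (Adam chooses conjuncts, Eve disjuncts; atom $(q,f)$ leads to $(q,f(v'))$ with reset meaning clock $0$; $\top$ wins for Eve, $\bot$ and absence of an enabled transition lose for Eve); an infinite play is won by Eve iff its state sequence satisfies the acceptance condition; $\mathcal{A}$ accepts iff Eve has a winning strategy. Weak parity condition: $\min\{\Omega(q_i)\}$ over all visited states is even; index $(1,2)$ means ranks in $\{1,2\}$.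 *)

(* Defs.v *)
From Stdlib Require Import Reals List Arith.
Import ListNotations.
Open Scope R_scope.

Inductive recf : Type :=
| RZero : recf
| RSucc : recf
| RProj : nat -> recf
| RComp : recf -> list recf -> recf
| RPrim : recf -> recf -> recf
| RMu   : recf -> recf.

Inductive reval : recf -> list nat -> nat -> Prop :=
| ev_zero : forall v, reval RZero v 0
| ev_succ : forall x v, reval RSucc (x :: v) (S x)
| ev_proj : forall i v, (i < length v)%nat -> reval (RProj i) v (nth i v 0%nat)
| ev_comp : forall f gs v ys y,
    revals gs v ys -> reval f ys y -> reval (RComp f gs) v y
| ev_prim0 : forall f g v y, reval f v y -> reval (RPrim f g) (0%nat :: v) y
| ev_primS : forall f g n v z y,
    reval (RPrim f g) (n :: v) z -> reval g (n :: z :: v) y ->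
    reval (RPrim f g) (S n :: v) y
| ev_mu : forall f v n,
    reval f (n :: v) 0%nat ->
    (forall m, (m < n)%nat -> exists k, reval f (m :: v) (S k)) ->
    reval (RMu f) v n
with revals : list recf -> list nat -> list nat -> Prop :=
| evs_nil : forall v, revals [] v []
| evs_cons : forall g gs v y ys,
    reval g v y -> revals gs v ys -> revals (g :: gs) v (y :: ys).

Inductive cmp : Type := CLt | CLe | CEq | CGe | CGt.

Inductive guard : Type :=
| GTrue : guard
| GCmp  : cmp -> nat -> guard
| GAnd  : guard -> guard -> guard.

Definition sat_cmp (o : cmp) (c : nat) (v : R) : bool :=
  match o with
  | CLt => if Rlt_dec v (INR c) then true else false
  | CLe => if Rle_dec v (INR c) then true else false
  | CEq => if Rle_dec v (INR c) then (if Rle_dec (INR c) v then true else false) else false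
  | CGe => if Rle_dec (INR c) v then true else false
  | CGt => if Rlt_dec (INR c) v then true else false
  end.

Fixpoint sat (g : guard) (v : R) : bool :=
  match g with
  | GTrue => true
  | GCmp o c => sat_cmp o c v
  | GAnd g1 g2 => andb (sat g1 v) (sat g2 v)
  end.

(* positive boolean formulas over atoms (q, f), f = false: nop, f = true: reset *)
Inductive form : Type :=
| FTrue : form
| FFalse : form
| FAtom : nat -> bool -> form
| FAnd : form -> form -> form
| FOr : form -> form -> form.

(* States are 0 .. nstates-1, letters 0 .. nletters-1.
   delta is given by its graph: entries (q, a, theta, phi) meaning
   delta(q, a, theta) = phi.  rank = Omega as a list (Omega q = nth q rank 0). *)
Record ATA : Type := mkATA {
  nstates : nat;
  nletters : nat;
  init : nat;
  trans : list (nat * nat * guard * form);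
  rank : list nat
}.

Fixpoint form_states_ok (n : nat) (f : form) : Prop :=
  match f with
  | FTrue | FFalse => True
  | FAtom q _ => (q < n)%nat
  | FAnd f1 f2 | FOr f1 f2 => form_states_ok n f1 /\ form_states_ok n f2
  end.

Definition trans_key (e : nat * nat * guard * form) : nat * nat * guard :=
  let '(q, a, th, _) := e in (q, a, th).

Definition ata_wf (A : ATA) : Prop :=
  (init A < nstates A)%nat /\
  length (rank A) = nstates A /\
  (forall q a th phi, In (q, a, th, phi) (trans A) ->
     (q < nstates A)%nat /\ (a < nletters A)%nat /\ form_states_ok (nstates A) phi) /\
  NoDup (map trans_key (trans A)) /\
  (forall q a v th1 phi1 th2 phi2,
     In (q, a, th1, phi1) (trans A) -> In (q, a, th2, phi2) (trans A) ->
     sat th1 v = true -> sat th2 v = true -> th1 = th2).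

Fixpoint no_disj (f : form) : Prop :=
  match f with
  | FOr _ _ => False
  | FAnd f1 f2 => no_disj f1 /\ no_disj f2
  | _ => True
  end.

Definition universal (A : ATA) : Prop :=
  forall q a th phi, In (q, a, th, phi) (trans A) -> no_disj phi.

Definition index_1_2 (A : ATA) : Prop :=
  forall r, In r (rank A) -> r = 1%nat \/ r = 2%nat.

Definition guards_le1_gt1 (A : ATA) : Prop :=
  forall q a th phi, In (q, a, th, phi) (trans A) ->
    th = GCmp CLe 1 \/ th = GCmp CGt 1.

(* A timed word (a_1,t_1)(a_2,t_2)... is given by  a i = a_{i+1},  t i = t_{i+1}
   (0-based indexing); timestamps are non-negative and strictly increasing. *)
Definition timed_word (A : ATA) (a : nat -> nat) (t : nat -> R) : Prop :=
  (forall i, (a i < nletters A)%nat) /\ 0 <= t 0%nat /\ (forall i, t i < t (S i)).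

Definition non_zeno (t : nat -> R) : Prop := forall M : R, exists i, M < t i.

(* PConf k q v : configuration (q, v) after reading k letters
   PForm k v f  : resolving formula f during step k, current clock v' = v
   PWin / PLose : Eve has won / lost (reached top, resp. bottom or no transition) *)
Inductive pos : Type :=
| PConf : nat -> nat -> R -> pos
| PForm : nat -> R -> form -> pos
| PWin : pos
| PLose : pos.

Definition enabled (A : ATA) (q a : nat) (v : R) : option form :=
  match find (fun e => let '(q', a', th, _) := e in
                 andb (Nat.eqb q q') (andb (Nat.eqb a a') (sat th v))) (trans A) with
  | Some (_, _, _, phi) => Some phi
  | None => None
  end.

(* strategies see the whole history; for a fixed automaton and word the history
   is determined by the list of binary choices made so far *)
Definition strategy := list bool -> bool.

Definition gstep (A : ATA) (a : nat -> nat) (t : nat -> R)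
  (eve adam : strategy) (st : pos * list bool) : pos * list bool :=
  let '(p, h) := st in
  match p with
  | PConf k q v =>
      let tprev := match k with O => 0 | S k' => t k' end in
      let v' := v + (t k - tprev) in
      match enabled A q (a k) v' with
      | Some phi => (PForm k v' phi, h)
      | None => (PLose, h)
      end
  | PForm k v' phi =>
      match phi with
      | FTrue => (PWin, h)
      | FFalse => (PLose, h)
      | FAtom q r => (PConf (S k) q (if r then 0 else v'), h)
      | FAnd f1 f2 => let c := adam h in (PForm k v' (if c then f1 else f2), h ++ [c])
      | FOr f1 f2 => let c := eve h in (PForm k v' (if c then f1 else f2), h ++ [c])
      end
  | PWin => (PWin, h)
  | PLose => (PLose, h)
  end.

Fixpoint play (A : ATA) (a : nat -> nat) (t : nat -> R)
  (eve adam : strategy) (n : nat) : pos * list bool :=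
  match n with
  | O => (PConf 0 (init A) 0, [])
  | S n' => gstep A a t eve adam (play A a t eve adam n')
  end.

Definition visited (A : ATA) a t eve adam (q : nat) : Prop :=
  exists n k v, fst (play A a t eve adam n) = PConf k q v.

Definition weak_parity_ok (A : ATA) a t eve adam : Prop :=
  exists m, Nat.Even m /\
    (exists q, visited A a t eve adam q /\ nth q (rank A) 0%nat = m) /\
    (forall q, visited A a t eve adam q -> (m <= nth q (rank A) 0%nat)%nat).

Definition eve_wins (A : ATA) a t eve adam : Prop :=
  (exists n, fst (play A a t eve adam n) = PWin) \/
  ((forall n, fst (play A a t eve adam n) <> PLose) /\ weak_parity_ok A a t eve adam).

Definition accepts (A : ATA) (a : nat -> nat) (t : nat -> R) : Prop :=
  exists eve : strategy, forall adam : strategy, eve_wins A a t eve adam.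

Definition accepts_some (A : ATA) : Prop :=
  exists a t, timed_word A a t /\ accepts A a t.

Definition accepts_some_nonzeno (A : ATA) : Prop :=
  exists a t, timed_word A a t /\ non_zeno t /\ accepts A a t.

Definition cpair (x y : nat) : nat := (Nat.div ((x + y) * (x + y + 1)) 2 + y)%nat.

Fixpoint enc_list {X} (e : X -> nat) (l : list X) : nat :=
  match l with
  | [] => 0%nat
  | x :: l' => S (cpair (e x) (enc_list e l'))
  end.

Definition enc_cmp (o : cmp) : nat :=
  match o with CLt => 0 | CLe => 1 | CEq => 2 | CGe => 3 | CGt => 4 end%nat.

Fixpoint enc_guard (g : guard) : nat :=
  match g with
  | GTrue => cpair 0 0
  | GCmp o c => cpair 1 (cpair (enc_cmp o) c)
  | GAnd g1 g2 => cpair 2 (cpair (enc_guard g1) (enc_guard g2))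
  end.

Fixpoint enc_form (f : form) : nat :=
  match f with
  | FTrue => cpair 0 0
  | FFalse => cpair 1 0
  | FAtom q r => cpair 2 (cpair q (if r then 1 else 0))
  | FAnd f1 f2 => cpair 3 (cpair (enc_form f1) (enc_form f2))
  | FOr f1 f2 => cpair 4 (cpair (enc_form f1) (enc_form f2))
  end%nat.

Definition enc_trans (e : nat * nat * guard * form) : nat :=
  let '(q, a, th, phi) := e in
  cpair q (cpair a (cpair (enc_guard th) (enc_form phi))).

Definition enc_ATA (A : ATA) : nat :=
  cpair (nstates A) (cpair (nletters A) (cpair (init A)
    (cpair (enc_list enc_trans (trans A)) (enc_list (fun r => r) (rank A))))).

Definition decidable_on (C P : ATA -> Prop) : Prop :=
  exists f : recf, forall A, C A ->
    (P A -> reval f [enc_ATA A] 1%nat) /\ (~ P A -> reval f [enc_ATA A] 0%nat).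

Definition thm_class (A : ATA) : Prop :=
  ata_wf A /\ universal A /\ index_1_2 A /\ guards_le1_gt1 A.

(* Main.v *)
(** A timed word is read as a sequence of blocks: a control letter followed by coloured tokens, with
    separators in between.  A rank-1 thread started at each event [e] forces the last event at distance
    at most 1 from [e] to be a copy of [e]; since separators alternate with the other letters, distinct
    events have distinct copies, so each block embeds into the next one, up to inserted tokens.  The
    threads cannot forbid insertions.  Rank-1 threads have to reach [FTrue], which also excludes Zeno
    words and forces a given letter to occur infinitely often.

    Consecutive blocks describe, backwards in time, runs of a machine that recolours a fixed number of
    tokens.  A round is a run with [N] alive tokens, from all tokens free to a goal label; at its end one
    token dies.  A phase ends when no token is alive; then all tokens are revived and one more is added.
    If no run exists for some [N], then the number of alive tokens, once at least [N], can never drop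
    below [N]: insertions compensate at best the death of a token.  Hence infinitely many phases end in
    some word if and only if the machine has a run for every [N >= 1].

    The machine is a counter program that may jump to the goal as soon as no token is free: a
    program that halts has no run for large [N], a program that grows for ever has runs for all [N].
    Given a decider [f], the program evaluates [f] on the code of its own automaton and halts or
    grows so as to refute the answer.  Its input [c], loaded by a chain of [c] increments, is the
    code of the part of the automaton that does not depend on [c], whence the code of the whole
    automaton is a simple recursive function of [c]. *)

(* No undecidable problem is given in advance: [decidable_on] quantifies over [recf], and a
   reduction from a halting problem would first need a universal function. The diagonal argument
   avoids it, since the program only runs the one decider that is assumed. It settles both claims at
   once, for any property that follows from [accepts_some_nonzeno] and implies [accepts_some]: runs
   for all [N] give a non-Zeno word, and any accepted word gives such runs. The obstacle to
   self-reference is that a code stored inside the program would change the program. The chain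
   therefore lies outside it: it adds states and transitions but no letters, and one fixed pair of
   letters serves all its links. The guards [x <= 1] and [x > 1] only single out the last event
   within time 1 of a given event. Copies need not lie at distance exactly 1, so it is their order,
   and not their exact position, that carries the argument. *)
From Stdlib Require Import Reals List FinFun Arith Lia Lra Bool Classical ClassicalEpsilon FunctionalExtensionality.
Require Import Defs.
Import ListNotations.
Open Scope R_scope.


(** * Universal games *)

(* In a universal automaton a play is determined by the stream of Adam's choices;
   [rstep] consumes one bit of the stream at every conjunction. *)
Definition rstep (A : ATA) (a : nat -> nat) (t : nat -> R)
  (st : pos * (nat -> bool)) : pos * (nat -> bool) :=
  let '(p, b) := st in
  match p with
  | PConf k q v =>
      let v' := v + (t k - match k with O => 0 | S k' => t k' end) in
      match enabled A q (a k) v' with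
      | Some phi => (PForm k v' phi, b)
      | None => (PLose, b)
      end
  | PForm k v' phi =>
      match phi with
      | FTrue => (PWin, b)
      | FFalse => (PLose, b)
      | FAtom q r => (PConf (S k) q (if r then 0 else v'), b)
      | FAnd f1 f2 | FOr f1 f2 =>
          (PForm k v' (if b 0%nat then f1 else f2), fun i => b (S i))
      end
  | PWin => (PWin, b)
  | PLose => (PLose, b)
  end.

Fixpoint run A a t (n : nat) (st : pos * (nat -> bool)) : pos * (nat -> bool) :=
  match n with
  | O => st
  | S n' => run A a t n' (rstep A a t st)
  end.

Lemma run_S_r A a t n st : run A a t (S n) st = rstep A a t (run A a t n st).
Proof. revert st; induction n; intros st; simpl; auto. rewrite <- IHn. reflexivity. Qed.

Definition pos_no_disj (p : pos) : Prop :=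
  match p with PForm _ _ f => no_disj f | _ => True end.

Lemma enabled_In A q l v phi :
  enabled A q l v = Some phi ->
  exists th, In (q, l, th, phi) (trans A) /\ sat th v = true.
Proof.
  unfold enabled. destruct (find _ _) as [[[[q' l'] th] phi']|] eqn:E; [|discriminate].
  intros [= <-]. apply find_some in E as [H1 H2].
  apply andb_prop in H2 as [H2 H3]. apply andb_prop in H3 as [H3 H4].
  apply Nat.eqb_eq in H2, H3. subst. eauto.
Qed.

Lemma NoDup_map_inj_on (X Y : Type) (f : X -> Y) l x y :
  NoDup (map f l) -> In x l -> In y l -> f x = f y -> x = y.
Proof.
  induction l as [|z l IH]; simpl; [tauto|].
  intros H Hx Hy E. inversion H; subst.
  destruct Hx as [<-|Hx], Hy as [<-|Hy]; auto.
  - exfalso; apply H2; rewrite E; now apply in_map.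
  - exfalso; apply H2; rewrite <- E; now apply in_map.
Qed.

Lemma In_enabled A q l th v phi :
  ata_wf A -> In (q, l, th, phi) (trans A) -> sat th v = true ->
  enabled A q l v = Some phi.
Proof.
  intros (_ & _ & _ & ND & PC) HI HS.
  unfold enabled. destruct (find _ _) as [[[[q' l'] th'] phi']|] eqn:E.
  - apply find_some in E as [H1 H2].
    apply andb_prop in H2 as [H2 H3]. apply andb_prop in H3 as [H3 H4].
    apply Nat.eqb_eq in H2, H3. subst q' l'.
    assert (th = th') by (eapply PC; eauto). subst th'.
    assert (X : (q, l, th, phi) = (q, l, th, phi')).
    { eapply NoDup_map_inj_on; eauto. }
    congruence.
  - exfalso. eapply find_none in E; [|exact HI]. cbn in E.
    rewrite !Nat.eqb_refl, HS in E. discriminate.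
Qed.

Section Game.
Variables (A : ATA) (a : nat -> nat) (t : nat -> R).
Hypothesis wf : ata_wf A.
Hypothesis univ : universal A.
Hypothesis idx : index_1_2 A.

Lemma rstep_no_disj p b : pos_no_disj p -> pos_no_disj (fst (rstep A a t (p, b))).
Proof using univ.
  destruct p as [k q v|k v f| |]; simpl; auto.
  - intros _. destruct (enabled _ _ _ _) eqn:E; simpl; auto.
    apply enabled_In in E as (th & H & _). eapply univ; eauto.
  - destruct f; simpl; try tauto. destruct (b 0%nat); tauto.
Qed.

Lemma run_no_disj n b :
  pos_no_disj (fst (run A a t n (PConf 0 (init A) 0, b))).
Proof using univ.
  induction n; [exact I|]. rewrite run_S_r.
  destruct (run A a t n _) as [p b']. now apply rstep_no_disj.
Qed.

(** Adam realises any stream by playing the bit whose index is the length of the history: without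
    disjunctions every recorded bit is his own, so that length counts the bits consumed. *)
Lemma play_run_of_stream eve (b : nat -> bool) n :
  let st := play A a t eve (fun h => b (length h)) n in
  run A a t n (PConf 0 (init A) 0, b) = (fst st, fun i => b (length (snd st) + i)%nat).
Proof using univ.
  induction n; [reflexivity|].
  rewrite run_S_r. pose proof (run_no_disj n b) as ND.
  simpl in *. rewrite IHn in ND |- *. destruct (play _ _ _ _ _ n) as [p h]. simpl in *.
  destruct p as [k q v|k v f| |]; simpl; auto.
  - destruct (enabled _ _ _ _); reflexivity.
  - destruct f; simpl in *; try reflexivity; try tauto.
    rewrite length_app, Nat.add_0_r. simpl. f_equal.
    apply functional_extensionality; intros i. f_equal; lia.
Qed.

Fixpoint adam_hist (adam : strategy) (n : nat) : list bool :=
  match n with O => [] | S n' => adam_hist adam n' ++ [adam (adam_hist adam n')] end.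

(** Conversely, as Eve never chooses, the history is determined by its length, so a strategy of Adam
    amounts to a stream. *)
Lemma play_run_of_adam eve adam n :
  let st := play A a t eve adam n in
  snd st = adam_hist adam (length (snd st)) /\
  run A a t n (PConf 0 (init A) 0, fun i => adam (adam_hist adam i)) =
    (fst st, fun i => adam (adam_hist adam (length (snd st) + i)%nat)).
Proof using univ.
  induction n; [split; reflexivity|].
  rewrite run_S_r. pose proof (run_no_disj n (fun i => adam (adam_hist adam i))) as ND.
  simpl in *. destruct IHn as [IH1 IH2]. rewrite IH2 in ND |- *.
  destruct (play _ _ _ _ _ n) as [p h]. simpl in *.
  destruct p as [k q v|k v f| |]; simpl; auto.
  - destruct (enabled _ _ _ _); auto.
  - destruct f; simpl in *; auto; try tauto.
    rewrite length_app, Nat.add_0_r. simpl. rewrite Nat.add_1_r. simpl. rewrite <- IH1.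
    split; auto. f_equal.
    apply functional_extensionality; intros i.
    now rewrite Nat.add_succ_r.
Qed.

(** With ranks 1 and 2 an infinite play is won only if rank 1 is never visited. After such a visit
    Eve must reach [PWin], which is the game [wins1]; [wins2] is the game as long as no rank-1 state
    has been met. *)
Definition wins1 (p : pos) : Prop :=
  forall b, exists n, fst (run A a t n (p, b)) = PWin.

Definition wins2 (p : pos) : Prop :=
  forall b, (exists n, fst (run A a t n (p, b)) = PWin) \/
   ((forall n, fst (run A a t n (p, b)) <> PLose) /\
    (forall n k q v, fst (run A a t n (p, b)) = PConf k q v -> nth q (rank A) 0%nat = 2%nat)).

Definition pos_ok (p : pos) : Prop :=
  match p with
  | PConf _ q _ => (q < nstates A)%nat
  | PForm _ _ f => form_states_ok (nstates A) f
  | _ => True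
  end.

Lemma run_pos_ok n b : pos_ok (fst (run A a t n (PConf 0 (init A) 0, b))).
Proof using wf.
  destruct wf as (H1 & _ & H3 & _).
  induction n; [exact H1|]. rewrite run_S_r.
  destruct (run A a t n _) as [p b']. simpl in IHn.
  destruct p as [k q v|k v f| |]; simpl; auto.
  - destruct (enabled _ _ _ _) eqn:E; simpl; auto.
    apply enabled_In in E as (th & H & _). eapply H3; eauto.
  - destruct f; simpl in *; auto; destruct (b' 0%nat); tauto.
Qed.

(** The least visited rank is 1 or 2, so it is even exactly if every visited rank is 2. [run_pos_ok]
    keeps the states in range, away from the default rank 0 of [nth], which would be even. *)
Lemma eve_wins_iff eve adam b :
  (forall n, fst (play A a t eve adam n) = fst (run A a t n (PConf 0 (init A) 0, b))) ->
  (eve_wins A a t eve adam <->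
   ((exists n, fst (run A a t n (PConf 0 (init A) 0, b)) = PWin) \/
   ((forall n, fst (run A a t n (PConf 0 (init A) 0, b)) <> PLose) /\
    (forall n k q v, fst (run A a t n (PConf 0 (init A) 0, b)) = PConf k q v ->
       nth q (rank A) 0%nat = 2%nat)))).
Proof using wf idx.
  intros E.
  assert (RK : forall n k q v, fst (run A a t n (PConf 0 (init A) 0, b)) = PConf k q v ->
     nth q (rank A) 0%nat = 1%nat \/ nth q (rank A) 0%nat = 2%nat).
  { intros n k q v H. pose proof (run_pos_ok n b) as Hok. rewrite H in Hok. simpl in Hok.
    apply idx. apply nth_In. destruct wf as (_ & -> & _). exact Hok. }
  unfold eve_wins. split.
  - intros [[n H]|[H1 H2]].
    + left; exists n; now rewrite <- E.
    + right; split; [intros n; rewrite <- E; auto|].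
      destruct H2 as (m & Hm & (q0 & (n0 & k0 & v0 & V) & R0) & H2).
      rewrite E in V. apply RK in V.
      assert (Em : m = 2%nat).
      { destruct V as [V|V]; rewrite R0 in V; auto. subst. destruct Hm; lia. }
      rewrite Em in H2. intros n k q v H. specialize (H2 q).
      pose proof (RK _ _ _ _ H) as Rq. rewrite <- E in H.
      assert (2 <= nth q (rank A) 0)%nat by (apply H2; now exists n, k, v). lia.
  - intros [[n H]|[H1 H2]].
    + left; exists n; now rewrite E.
    + right; split; [intros n; rewrite E; auto|].
      exists 2%nat; split; [now exists 1%nat|]. split.
      * exists (init A). split; [now exists 0%nat, 0%nat, 0|].
        now apply (H2 0%nat 0%nat (init A) 0).
      * intros q (n & k & v & V). rewrite E in V. rewrite (H2 _ _ _ _ V). auto.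
Qed.

Lemma accepts_iff_wins2 : accepts A a t <-> wins2 (PConf 0 (init A) 0).
Proof using wf univ idx.
  split.
  - intros [eve H] b.
    apply (eve_wins_iff eve (fun h => b (length h))); [|apply H].
    intros n. now rewrite play_run_of_stream with (eve := eve).
  - intros H. exists (fun _ => true). intros adam.
    apply eve_wins_iff with (b := fun i => adam (adam_hist adam i)); [|apply H].
    intros n. destruct (play_run_of_adam (fun _ => true) adam n) as [_ X]. now rewrite X.
Qed.

Definition elapsed (k : nat) : R := t k - match k with O => 0 | S k' => t k' end.

Lemma wins1_conf k q v :
  wins1 (PConf k q v) <->
  exists phi, enabled A q (a k) (v + elapsed k) = Some phi /\
    wins1 (PForm k (v + elapsed k) phi).
Proof.
  unfold elapsed. split.
  - intros H. destruct (enabled A q (a k) _) as [phi|] eqn:E.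
    + exists phi; split; auto. intros b. destruct (H b) as [[|n] Hn]; [discriminate|].
      exists n. simpl in Hn. now rewrite E in Hn.
    + exfalso. destruct (H (fun _ => true)) as [[|n] Hn]; [discriminate|].
      simpl in Hn. rewrite E in Hn. clear - Hn.
      induction n; simpl in Hn; [discriminate|auto].
  - intros (phi & E & H) b. destruct (H b) as [n Hn]. exists (S n). simpl. now rewrite E.
Qed.

Lemma wins1_true k v : wins1 (PForm k v FTrue).
Proof. intros b; now exists 1%nat. Qed.

Lemma wins1_atom k v q (r : bool) :
  wins1 (PConf (S k) q (if r then 0 else v)) -> wins1 (PForm k v (FAtom q r)).
Proof. intros H b. destruct (H b) as [n Hn]. now exists (S n). Qed.

Lemma run_lose n b : fst (run A a t n (PLose, b)) = PLose.
Proof. induction n; simpl; auto. Qed.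

Lemma wins2_conf k q v :
  wins2 (PConf k q v) ->
  exists phi, enabled A q (a k) (v + elapsed k) = Some phi /\
    wins2 (PForm k (v + elapsed k) phi).
Proof.
  unfold elapsed. intros H. destruct (enabled A q (a k) _) as [phi|] eqn:E.
  - exists phi; split; auto. intros b.
    assert (X : forall n, run A a t (S n) (PConf k q v, b) =
       run A a t n (PForm k (v + (t k - match k with O => 0 | S k' => t k' end)) phi, b)).
    { intros n. simpl. now rewrite E. }
    destruct (H b) as [[[|n] Hn]|[H1 H2]]; [discriminate| |].
    + left; exists n. now rewrite <- X.
    + right; split; [intros n; rewrite <- X; apply H1|].
      intros n; rewrite <- X; apply H2.
  - exfalso. destruct (H (fun _ => true)) as [[[|n] Hn]|[H1 H2]]; [discriminate| |].
    + simpl in Hn. rewrite E, run_lose in Hn. discriminate.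
    + apply (H1 1%nat). simpl. now rewrite E.
Qed.

Lemma wins2_rank1 k q v :
  wins2 (PConf k q v) -> nth q (rank A) 0%nat <> 2%nat -> wins1 (PConf k q v).
Proof.
  intros H R b. destruct (H b) as [X|[_ X]]; auto.
  exfalso. apply R. exact (X 0%nat k q v eq_refl).
Qed.

Lemma wins2_step p b :
  wins2 p -> (match p with PConf _ _ _ => False | _ => True end) ->
  (exists n, fst (run A a t n (rstep A a t (p, b))) = PWin) \/
   ((forall n, fst (run A a t n (rstep A a t (p, b))) <> PLose) /\
    (forall n k q v, fst (run A a t n (rstep A a t (p, b))) = PConf k q v -> nth q (rank A) 0%nat = 2%nat)).
Proof.
  intros H NC. destruct (H b) as [[n Hn]|[H1 H2]].
  - left. exists n. change (fst (run A a t (S n) (p, b)) = PWin).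
    rewrite run_S_r. destruct (run A a t n (p, b)) as [p' b']. simpl in Hn. now subst p'.
  - right. split; [intros n; apply (H1 (S n))|intros n; apply (H2 (S n))].
Qed.

Lemma wins2_atom k v q (r : bool) :
  wins2 (PForm k v (FAtom q r)) -> wins2 (PConf (S k) q (if r then 0 else v)).
Proof. intros H b. exact (wins2_step _ b H I). Qed.

Lemma wins2_and k v f g :
  wins2 (PForm k v (FAnd f g)) -> wins2 (PForm k v f) /\ wins2 (PForm k v g).
Proof.
  intros H. split; intros b.
  - exact (wins2_step _ (fun i => match i with O => true | S i => b i end) H I).
  - exact (wins2_step _ (fun i => match i with O => false | S i => b i end) H I).
Qed.

(* Conjuncts of the rank-2 part either stay in [I] or hand over to a rank-1 obligation. *)
Fixpoint form_inv (I : nat -> nat -> Prop) (k : nat) (v : R) (f : form) : Prop :=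
  match f with
  | FTrue => True
  | FAtom q r => (r = true /\ I (S k) q) \/ wins1 (PConf (S k) q (if r then 0 else v))
  | FAnd f1 f2 => form_inv I k v f1 /\ form_inv I k v f2
  | _ => False
  end.

(** Coinduction: a run either meets a position won by reachability, or it satisfies the invariant
    for ever. All atoms inside the invariant reset, so the clock is 0 there and [Inv] needs only the
    step number and the state. *)
Lemma wins2_of_invariant (Inv : nat -> nat -> Prop) :
  (forall k q, Inv k q -> nth q (rank A) 0%nat = 2%nat /\
     exists phi, enabled A q (a k) (0 + elapsed k) = Some phi /\
       form_inv Inv k (0 + elapsed k) phi) ->
  forall k q, Inv k q -> wins2 (PConf k q 0).
Proof.
  intros HI k0 q0 H0 b0.
  set (J := fun p => match p with
    | PConf k q v => v = 0 /\ Inv k q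
    | PForm k v f => form_inv Inv k v f
    | _ => False end).
  destruct (classic (exists n, wins1 (fst (run A a t n (PConf k0 q0 0, b0))))) as [[n Hn]|NW].
  { left. destruct (run A a t n _) as [p b] eqn:E. destruct (Hn b) as [m Hm].
    exists (n + m)%nat. assert (X : forall n st m, run A a t (n + m) st = run A a t m (run A a t n st)).
    { clear. induction n; simpl; auto. }
    rewrite X, E. exact Hm. }
  right.
  assert (HJ : forall n, J (fst (run A a t n (PConf k0 q0 0, b0)))).
  { induction n; [split; auto|].
    assert (NS : ~ wins1 (fst (run A a t (S n) (PConf k0 q0 0, b0)))) by eauto.
    rewrite run_S_r in NS |- *. destruct (run A a t n _) as [p b]. simpl fst in IHn.
    destruct p as [k q v|k v f| |]; try contradiction.
    - destruct IHn as [-> Hq]. destruct (HI _ _ Hq) as (_ & phi & E & F).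
      simpl. unfold elapsed in *. now rewrite E.
    - destruct f; simpl in IHn |- *; try contradiction.
      + exfalso. apply NS. intros b'. now exists 0%nat.
      + destruct IHn as [[-> X]|X]; [split; auto|]. exfalso; apply NS; exact X.
      + destruct (b 0%nat); tauto. }
  split.
  - intros n E. specialize (HJ n). now rewrite E in HJ.
  - intros n k q v E. specialize (HJ n). rewrite E in HJ. destruct HJ as [_ X].
    now apply HI in X.
Qed.

End Game.

(** * The automaton of a counter program *)

Local Open Scope nat_scope.

(* [DEC r q q'] decrements [r] and goes to [q], or goes to [q'] if [r] is zero. *)
Inductive instr : Type :=
| INC : nat -> nat -> instr
| DEC : nat -> nat -> nat -> instr.

Definition instr_reg (I : instr) : nat := match I with INC r _ => r | DEC r _ _ => r end.

(* [Tok a b] is a token of colour [a] whose copy one time unit later has colour [b]. *)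
Inductive letter : Type :=
| Sep : letter
| Tok : nat -> nat -> letter
| Ctl : nat -> letter.

Definition is_sep (l : letter) : bool := match l with Sep => true | _ => false end.
Definition is_ctl (l : letter) : bool := match l with Ctl _ => true | _ => false end.

(** A letter [l'] counts as a copy of [l] if [class_in l' = class_out l]. The control letters form a
    single class, because the next operation is constrained by the label and not by copying. *)
Definition class_in (l : letter) : nat :=
  match l with Ctl _ => 0 | Sep => 1 | Tok a _ => a + 2 end.
Definition class_out (l : letter) : nat :=
  match l with Ctl _ => 0 | Sep => 1 | Tok _ b => b + 2 end.

(* Blocks of the word describe a run of the machine backwards in time:
   [OMove x y] recolours one token from [x] to [y] in machine time,
   hence is witnessed by a single letter [Tok y x]. *)
Inductive op : Type :=
| ORestart : op
| OEnd : op
| OMove : nat -> nat -> op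
| OZero : nat -> op.

(** [SCopy x ok] measures the time since one event and looks for class [x]; [ok] tells whether the
    latest letter had it. [SAlt s] expects a separator exactly if [s], [SSeg i s] checks the block
    of control letter [i], where [s] says that no special token is due any more, and [SLab] stands
    for the labels. Only [SCopy] and [SWait] have rank 1. *)
Inductive state : Type :=
| SCopy : nat -> bool -> state
| SWait : state
| SInit : state
| SAlt : bool -> state
| SSeg : nat -> bool -> state
| SLab : state.

Definition lentry (q l q' : nat) : nat * nat * guard * form :=
  (q, l, GCmp CLe 1, FAtom q' true).

Definition gof (g : bool) : guard := if g then GCmp CGt 1 else GCmp CLe 1.

(** Entries are prepended one by one, so that the code of the result comes from the code of [acc] by
    primitive recursion. *)
Fixpoint self_trans (s n : nat) (acc : list (nat * nat * guard * form)) :=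
  match n with
  | O => acc
  | S n' => lentry s n' s :: self_trans s n' acc
  end.

Lemma NoDup_list_prod (X Y : Type) (l : list X) (l' : list Y) :
  NoDup l -> NoDup l' -> NoDup (list_prod l l').
Proof.
  intros H H'. induction H as [|x l Hx H IH]; simpl; [constructor|].
  apply NoDup_app; auto.
  - apply FinFun.Injective_map_NoDup; auto. intros y y'; congruence.
  - intros [x' y] H1 H2. apply in_map_iff in H1 as (y' & [= <- _] & _).
    apply in_prod_iff in H2. tauto.
Qed.

Lemma NoDup_map_flat_map (X Y Z : Type) (f : X -> list Y) (key : Y -> Z) (h : X -> Z) l :
  (forall x x', h x = h x' -> x = x') ->
  (forall x, f x = [] \/ exists y, f x = [y] /\ key y = h x) ->
  NoDup l -> NoDup (map key (flat_map f l)).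
Proof.
  intros inj Hf H. induction H as [|x l Hx H IH]; simpl; [constructor|].
  destruct (Hf x) as [->|(y & -> & E)]; simpl; auto.
  constructor; auto. rewrite E. intros HI. apply in_map_iff in HI as (y' & E' & HI).
  apply in_flat_map in HI as (x' & H1 & H2).
  destruct (Hf x') as [F|(y2 & F & E2)]; rewrite F in H2; simpl in H2; [tauto|].
  destruct H2 as [->|[]]. assert (x = x') by (apply inj; congruence). congruence.
Qed.

Definition gt1 (v : R) : bool := if Rle_dec v 1 then false else true.

Lemma sat_gof g v : sat (gof g) v = true <-> g = gt1 v.
Proof.
  unfold gt1. destruct g; simpl.
  - destruct (Rlt_dec 1 v), (Rle_dec v 1); split; intros; try discriminate; auto; lra.
  - destruct (Rle_dec v 1); split; intros; try discriminate; auto.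
Qed.

Lemma gt1_le v : (v <= 1)%R -> gt1 v = false.
Proof. unfold gt1. destruct (Rle_dec v 1); auto; lra. Qed.

Lemma gt1_gt v : (1 < v)%R -> gt1 v = true.
Proof. unfold gt1. destruct (Rle_dec v 1); auto; lra. Qed.

Lemma gt1_false v : gt1 v = false -> (v <= 1)%R.
Proof. unfold gt1. destruct (Rle_dec v 1); auto; discriminate. Qed.

Lemma class_ctl l : (class_in l =? 0) = is_ctl l /\ (class_out l =? 0) = is_ctl l.
Proof. destruct l; simpl; auto. split; apply Nat.eqb_neq; lia. Qed.

Section Automaton.
(* Colours [0 .. K] are alive ([0]: free, [S r]: unit of register [r]);
   [K + 1] is a dead token, [K + 2] a freshly inserted one. *)
Variables (P : list instr) (K U : nat).

Definition ncol : nat := K + 3.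
Definition alive (a : nat) : bool := a <=? K.
Definition nctl : nat := 4 + 3 * length P.

Definition goal : nat := U + 3.
(** Counted downwards, so that label 0 is [2 * U - 1], right below the chain states [2 * U + i]; the
    link from [2 * U + i] then leads to its predecessor also for [i = 0]. *)
Definition lab (p : nat) : nat := 2 * U - 1 - p.
Definition copy_st (x : nat) (ok : bool) : nat := 2 * x + Nat.b2n ok.
Definition wait_st : nat := 2 * (ncol + 2).
Definition alt_st (s : bool) : nat := if s then U + 1 else U + 2.
Definition seg_st (i : nat) (s : bool) : nat := U + 4 + (2 * i + Nat.b2n s).

Definition dec_letter (l : nat) : letter :=
  if l =? 0 then Sep
  else if l <? U then Tok ((l - 1) / ncol) ((l - 1) mod ncol)
  else Ctl (l - U).

Definition enc_letter (l : letter) : nat :=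
  match l with Sep => 0 | Tok a b => 1 + (a * ncol + b) | Ctl i => U + i end.

Definition dec_state (q : nat) : state :=
  if q <? U then (if q <? wait_st then SCopy (q / 2) (Nat.odd q) else SWait)
  else if q =? U then SInit
  else if q =? U + 1 then SAlt true
  else if q =? U + 2 then SAlt false
  else if (U + 4 <=? q) && (q <? U + 4 + 2 * nctl)
    then SSeg ((q - (U + 4)) / 2) (Nat.odd (q - (U + 4)))
  else SLab.

(** Instruction [p] owns the control letters [4 + (3 * p + k)]: [k = 0] is its increment or
    decrement, [k = 1] the zero branch, [k = 2] the jump to the goal, where [OZero 0] says that no
    token is free. Letters 2 and 3 belong to the chain: increment register 0, or pass on unchanged
    if no token is free. *)
Definition opof (i : nat) : op :=
  match i with
  | 0 => ORestart
  | 1 => OEnd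
  | 2 => OMove 0 1
  | 3 => OZero 0
  | S (S (S (S j))) =>
      match nth_error P (j / 3), j mod 3 with
      | Some (INC r _), 0 => OMove 0 (S r)
      | Some (DEC r _ _), 0 => OMove (S r) 0
      | Some (DEC r _ _), 1 => OZero (S r)
      | _, _ => OZero 0
      end
  end.

(** Every block, except that of a zero test, contains exactly one special token: the one that dies,
    is freshly inserted or changes its colour. This makes the bookkeeping of the token numbers
    exact. *)
Definition tok_special (o : op) (a b : nat) : bool :=
  match o with
  | ORestart => (a =? 0) && (b =? K + 1)
  | OEnd => (a =? K + 2) && alive b
  | OMove x y => (a =? y) && (b =? x)
  | OZero _ => false
  end.

(** The alive outputs of [ORestart] and [OEnd] are arbitrary: runs are read backwards, so the final
    configuration of the next run is guessed there. *)
Definition tok_plain (o : op) (a b : nat) : bool :=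
  match o with
  | ORestart => ((a =? 0) && alive b) || ((a =? K + 1) && (b =? K + 1))
  | OEnd => (a =? K + 1) && alive b
  | OMove _ _ => (a =? b) && (a <=? K + 1)
  | OZero x => (a =? b) && (a <=? K + 1) && negb (a =? x)
  end.

Definition seg_start (o : op) : bool := match o with OZero _ => true | _ => false end.

Definition seg_step (o : op) (s : option bool) (l : letter) : option bool :=
  match s with
  | None => None
  | Some s =>
      match l with
      | Sep => Some s
      | Tok a b =>
          if tok_special o a b then (if s then None else Some true)
          else if tok_plain o a b then Some s else None
      | Ctl _ => None
      end
  end.

(* [lab_prog q i] is the label before the step [i] that leads to label [q]. *)
Definition lab_prog (q i : nat) : option nat :=
  match i with
  | 1 => if q =? goal then Some goal else None
  | S (S (S (S j))) =>
      match nth_error P (j / 3), j mod 3 with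
      | Some (INC _ q1), 0 | Some (DEC _ q1 _), 0 | Some (DEC _ _ q1), 1 =>
          if q =? lab q1 then Some (lab (j / 3)) else None
      | Some _, 2 => if q =? goal then Some (lab (j / 3)) else None
      | _, _ => None
      end
  | _ => None
  end.

(** The alternation thread is present at every event from 1 on, hence it launches the threads
    attached to events; for event 0 the initial state does this. *)
Definition alt_form (l : letter) : form :=
  FAnd (FAtom (alt_st (negb (is_sep l))) true)
    (FAnd (FAtom (copy_st (class_out l) false) true)
      match l with
      | Ctl i => FAnd (FAtom (seg_st i (seg_start (opof i))) true)
                   (if i =? 1 then FAtom wait_st true else FTrue)
      | _ => FTrue
      end).

(** All threads but the copy threads reset at every letter, so [x > 1] would mean a gap longer than
    1, and they lose. A copy thread never resets: at the first letter beyond distance 1 its flag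
    tells whether the letter before, the last one within reach, was a copy. In class 0 it also loses
    if a letter within reach follows a control letter, so the copy of a control letter is the next
    control letter. [nl] is a parameter because the fixed part and the whole automaton differ only
    in the label steps. *)
Definition delta (nl : nat -> nat -> option nat) (q l : nat) (gt : bool) : option form :=
  match dec_state q with
  | SCopy x ok =>
      if gt then (if ok then Some FTrue else None)
      else if (x =? 0) && ok then None
      else Some (FAtom (copy_st x (class_in (dec_letter l) =? x)) false)
  | SWait =>
      if gt then None else if l =? U + 1 then Some FTrue else Some (FAtom wait_st true)
  | SInit =>
      if gt then None
      else if l =? U + 1 then Some (FAnd (FAtom goal true) (alt_form (Ctl 1))) else None
  | SAlt s =>
      if gt then None
      else if eqb s (is_sep (dec_letter l)) then
        match dec_letter l with
        | Ctl i => if i <? nctl then Some (alt_form (Ctl i)) else None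
        | l' => Some (alt_form l')
        end
      else None
  | SSeg i s =>
      if gt then None
      else match dec_letter l with
        | Ctl _ => if s then Some FTrue else None
        | l' => option_map (fun s' => FAtom (seg_st i s') true) (seg_step (opof i) (Some s) l')
        end
  | SLab =>
      if gt then None
      else if l <? U then Some (FAtom q true)
      else option_map (fun p => FAtom p true) (nl q (l - U))
  end.

Definition fixed_trans : list (nat * nat * guard * form) :=
  flat_map (fun k : nat * nat * bool => let '(q, l, g) := k in
      match delta lab_prog q l g with Some phi => [(q, l, gof g, phi)] | None => [] end)
    (list_prod (list_prod (seq 0 (2 * U)) (seq 0 (2 * U))) [false; true]).

(* The input [c] of the program is built in as a chain of [c] increments of register 0 leading to label 0. *)
Fixpoint chain_trans (c : nat) : list (nat * nat * guard * form) :=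
  match c with
  | O => fixed_trans
  | S i => lentry (Nat.pred (2 * U + i)) (U + 2) (2 * U + i) ::
           lentry (Nat.pred (2 * U + i)) (U + 3) (2 * U + i) ::
           self_trans (2 * U + i) U (chain_trans i)
  end.

Definition start_lab (c : nat) : nat := Nat.pred (2 * U + c).

(* States below [U] have rank 1, the others rank 2.  Not all numbers below [2 * U] are used as states
   or letters; this slack makes the code of the automaton computable from [U], [c] and the code of
   [fixed_trans] alone. *)
Definition prog_ata (c : nat) : ATA :=
  mkATA (2 * U + c) (2 * U) U
    (lentry (start_lab c) U goal :: chain_trans c)
    (repeat 1 U ++ repeat 2 (U + c)).

Definition lab_prev (c q i : nat) : option nat :=
  match i with
  | 0 => if q =? start_lab c then Some goal else None
  | 2 | 3 => if (2 * U - 1 <=? q) && (q <? start_lab c) then Some (S q) else None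
  | _ => lab_prog q i
  end.

Hypothesis Kpos : 1 <= K.
(** [HU1] makes room between [U] and [2 * U] for the control letters and, among the states, for the
    block checks below the labels. [HU2] fits the token letters and the rank-1 states below [U]. *)
Hypothesis HU1 : 20 + 7 * length P <= U.
Hypothesis HU2 : (K + 5) * (K + 5) <= U.

Lemma dec_enc_letter l :
  match l with Sep => True | Tok a b => a < ncol /\ b < ncol | Ctl _ => True end ->
  dec_letter (enc_letter l) = l.
Proof.
  unfold dec_letter, ncol. destruct l as [|a b|i]; cbn [enc_letter]; intros H.
  - reflexivity.
  - unfold ncol. replace (1 + (a * (K + 3) + b) =? 0) with false by (symmetry; apply Nat.eqb_neq; lia).
    replace (1 + (a * (K + 3) + b) <? U) with true
      by (symmetry; apply Nat.ltb_lt; unfold ncol in H; nia).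
    replace (1 + (a * (K + 3) + b) - 1) with (b + a * (K + 3)) by lia.
    rewrite Nat.div_add, Nat.Div0.mod_add by lia.
    unfold ncol in H. rewrite Nat.div_small, Nat.mod_small by lia. reflexivity.
  - replace (U + i =? 0) with false by (symmetry; apply Nat.eqb_neq; lia).
    replace (U + i <? U) with false by (symmetry; apply Nat.ltb_ge; lia).
    f_equal. lia.
Qed.

Lemma enc_letter_lt l :
  match l with Sep => True | Tok a b => a < ncol /\ b < ncol | Ctl i => i < U end ->
  enc_letter l < 2 * U.
Proof. unfold ncol. destruct l; simpl; unfold ncol; nia. Qed.

Lemma dec_letter_ctl l i : dec_letter l = Ctl i <-> l = U + i.
Proof.
  unfold dec_letter. destruct (Nat.eqb_spec l 0); [|destruct (Nat.ltb_spec l U)].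
  - split; [discriminate|lia].
  - split; [discriminate|lia].
  - split; [intros [= <-]; lia|intros ->; f_equal; lia].
Qed.

Lemma dec_letter_not_ctl l : is_ctl (dec_letter l) = (U <=? l).
Proof.
  unfold dec_letter. destruct (Nat.eqb_spec l 0); [|destruct (Nat.ltb_spec l U)]; simpl;
  symmetry; try (apply Nat.leb_gt; lia). apply Nat.leb_le; lia.
Qed.

Lemma class_out_le l : class_out (dec_letter l) <= ncol + 1.
Proof.
  unfold dec_letter. destruct (_ =? _); [|destruct (_ <? _)]; simpl; try lia.
  assert ((l - 1) mod ncol < ncol) by (apply Nat.mod_upper_bound; unfold ncol; lia). lia.
Qed.

Lemma half_double x b : (2 * x + Nat.b2n b) / 2 = x /\ Nat.odd (2 * x + Nat.b2n b) = b.
Proof.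
  split.
  - rewrite Nat.mul_comm, Nat.div_add_l by lia. rewrite Nat.div_small; [lia|].
    destruct b; simpl; lia.
  - rewrite Nat.odd_add, Nat.odd_mul. now destruct b.
Qed.

Ltac kill_tests :=
  repeat match goal with
  | |- context [?x <? ?y] => destruct (Nat.ltb_spec x y); try lia
  | |- context [?x =? ?y] => destruct (Nat.eqb_spec x y); try lia
  | |- context [?x <=? ?y] => destruct (Nat.leb_spec x y); try lia
  end; cbn [andb orb negb].

Lemma dec_copy x ok : x <= ncol + 1 -> dec_state (copy_st x ok) = SCopy x ok.
Proof.
  intros H. unfold dec_state, wait_st, ncol in *.
  destruct (half_double x ok) as [E1 E2].
  assert (copy_st x ok < 2 * (K + 3 + 2)) by (unfold copy_st; destruct ok; simpl; lia).
  assert (2 * (K + 3 + 2) < U) by nia.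
  unfold copy_st in *. kill_tests. now rewrite E1, E2.
Qed.

Lemma dec_wait : dec_state wait_st = SWait.
Proof.
  unfold dec_state, wait_st, ncol. assert (2 * (K + 3 + 2) < U) by nia. now kill_tests.
Qed.

Lemma dec_init : dec_state U = SInit.
Proof. unfold dec_state. now kill_tests. Qed.

Lemma dec_alt s : dec_state (alt_st s) = SAlt s.
Proof. unfold dec_state, alt_st. destruct s; now kill_tests. Qed.

Lemma dec_seg i s : i < nctl -> dec_state (seg_st i s) = SSeg i s.
Proof.
  intros H. unfold dec_state, seg_st, nctl in *.
  assert (Nat.b2n s <= 1) by (destruct s; simpl; lia).
  kill_tests. replace (U + 4 + (2 * i + Nat.b2n s) - (U + 4)) with (2 * i + Nat.b2n s) by lia.
  destruct (half_double i s) as [-> ->]. reflexivity.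
Qed.

Lemma dec_lab q : q = goal \/ U + 4 + 2 * nctl <= q -> dec_state q = SLab.
Proof. unfold dec_state, goal, nctl. intros [->|H]; kill_tests; auto. Qed.

(** * The transition list as the graph of [delta], and membership in the class *)

Lemma In_fixed q l th phi :
  In (q, l, th, phi) fixed_trans <->
  q < 2 * U /\ l < 2 * U /\ exists g, th = gof g /\ delta lab_prog q l g = Some phi.
Proof.
  unfold fixed_trans. rewrite in_flat_map. split.
  - intros ([[q' l'] g] & H1 & H2). apply in_prod_iff in H1 as [H1 _].
    apply in_prod_iff in H1 as [H1 H3]. apply in_seq in H1, H3.
    destruct (delta _ _ _ _) eqn:E; simpl in H2; [|tauto].
    destruct H2 as [[= <- <- <- <-]|[]]. repeat split; try lia. eauto.
  - intros (H1 & H2 & g & -> & E). exists (q, l, g). rewrite E. split; [|left; reflexivity].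
    apply in_prod_iff. split; [apply in_prod_iff; split; apply in_seq; lia|].
    destruct g; simpl; auto.
Qed.

Lemma In_self e s n acc :
  In e (self_trans s n acc) <-> In e acc \/ exists l, l < n /\ e = lentry s l s.
Proof.
  induction n; simpl.
  - split; [tauto|]. intros [H|(l & H & _)]; [auto|lia].
  - rewrite IHn. split.
    + intros [<-|[H|(l & H & ->)]]; eauto. right; exists l; split; auto.
    + intros [H|(l & H & ->)]; auto.
      destruct (Nat.eq_dec l n) as [->|N]; auto. right; right; exists l; split; auto; lia.
Qed.

Lemma In_chain e c :
  In e (chain_trans c) <-> In e fixed_trans \/ exists j, j < c /\
    ((exists l, l < U /\ e = lentry (2 * U + j) l (2 * U + j)) \/
     e = lentry (Nat.pred (2 * U + j)) (U + 2) (2 * U + j) \/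
     e = lentry (Nat.pred (2 * U + j)) (U + 3) (2 * U + j)).
Proof.
  induction c; cbn [chain_trans].
  - split; [auto|]. intros [H|(j & H & _)]; [auto|lia].
  - cbn [In]. rewrite In_self, IHc. split.
    + intros [<-|[<-|[[H|(j & H & H')]|H]]]; auto.
      * right; exists c; auto.
      * right; exists c; auto.
      * right; exists j; split; auto.
      * right; exists c; auto.
    + intros [H|(j & H & H')]; auto.
      destruct (Nat.eq_dec j c) as [->|N].
      * destruct H' as [H'|[-> | ->]]; auto.
      * right; right; left; right. exists j; split; auto; lia.
Qed.

Lemma In_trans c q l th phi :
  In (q, l, th, phi) (trans (prog_ata c)) <->
  q < 2 * U + c /\ l < 2 * U /\ exists g, th = gof g /\ delta (lab_prev c) q l g = Some phi.
Proof.
  cbn [trans prog_ata In]. rewrite In_chain, In_fixed.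
  assert (DL : forall q nl, U + 4 + 2 * nctl <= q -> delta nl q l false =
     if l <? U then Some (FAtom q true) else option_map (fun p => FAtom p true) (nl q (l - U))).
  { intros q' nl H. unfold delta. rewrite dec_lab; auto. }
  assert (DG : forall q nl, U + 4 + 2 * nctl <= q -> delta nl q l true = None).
  { intros q' nl H. unfold delta. rewrite dec_lab; auto. }
  (* All states from [2 * U - 1] on are labels, so [DL] and [DG] apply to the chain. *)
  assert (B : U + 4 + 2 * nctl <= 2 * U - 1) by (unfold nctl; lia).
  split.
  - intros [H|[(H1 & H2 & g & -> & H)|(j & Hj & [(l' & Hl & H)|[H|H]])]];
      unfold lentry in H; try (injection H as <- <- <- <-); try (injection H as -> -> -> ->).
    + unfold start_lab. repeat split; try lia. exists false. split; auto.
      rewrite DL by lia. kill_tests. rewrite Nat.sub_diag. simpl.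
      unfold start_lab. now rewrite Nat.eqb_refl.
    + repeat split; try lia. exists g; split; auto.
      unfold delta in *. destruct (dec_state q); auto.
      destruct g; auto. destruct (l <? U); auto.
      destruct (l - U) as [|[|[|[|i]]]]; simpl in *; auto; discriminate.
    + repeat split; try lia. exists false. split; auto. rewrite DL by lia. kill_tests; auto.
    + repeat split; try lia. exists false. split; auto. rewrite DL by lia. kill_tests.
      replace (U + 2 - U) with 2 by lia. unfold lab_prev, start_lab. kill_tests.
      simpl. do 3 f_equal. lia.
    + repeat split; try lia. exists false. split; auto. rewrite DL by lia. kill_tests.
      replace (U + 3 - U) with 3 by lia. unfold lab_prev, start_lab. kill_tests.
      simpl. do 3 f_equal. lia.
  - intros (H1 & H2 & g & -> & H).
    (* Below [2 * U - 1] the chain adds nothing: [lab_prev c] and [lab_prog] agree there. *)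
    destruct (Nat.lt_ge_cases q (2 * U - 1)) as [Hq|Hq].
    + destruct (delta lab_prog q l g) eqn:E.
      * right; left. repeat split; try lia. exists g. split; auto. rewrite E, <- H, <- E.
        clear - Hq E. unfold delta in *. destruct (dec_state q); auto.
        destruct g; auto. destruct (l <? U); auto.
        unfold lab_prev, start_lab in *. destruct (l - U) as [|[|[|[|i]]]]; simpl in *; auto; discriminate.
      * exfalso. clear B DL DG. unfold delta in *. destruct (dec_state q); try congruence.
        destruct g; try congruence. destruct (l <? U); try congruence.
        unfold lab_prev, start_lab in *. destruct (l - U) as [|[|[|[|i]]]]; simpl in *; try congruence;
        revert H; kill_tests; try discriminate.
    + destruct g; [rewrite DG in H by lia; discriminate|].
      rewrite DL in H by lia. destruct (Nat.ltb_spec l U) as [Hl|Hl].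
      * injection H as <-. destruct (Nat.lt_ge_cases q (2 * U)).
        -- right; left. repeat split; try lia. exists false. split; auto. rewrite DL by lia.
           now kill_tests.
        -- right; right. exists (q - 2 * U). split; [lia|]. left. exists l; split; auto.
           unfold lentry, gof. replace (2 * U + (q - 2 * U)) with q by lia. reflexivity.
      * remember (l - U) as i eqn:Ei. assert (l = U + i) as -> by lia. clear Ei Hl.
        assert (CH : forall m, lab_prev c q m = (if (2 * U - 1 <=? q) && (q <? start_lab c) then Some (S q) else None) ->
            option_map (fun p => FAtom p true) (lab_prev c q m) = Some phi ->
            q < start_lab c /\ phi = FAtom (S q) true).
        { intros m -> HH. destruct (Nat.leb_spec (2 * U - 1) q); destruct (Nat.ltb_spec q (start_lab c)); simpl in HH; try discriminate.
          split; [auto|congruence]. }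
        destruct i as [|[|[|[|i]]]].
        -- simpl in H. destruct (Nat.eqb_spec q (start_lab c)); [|discriminate].
           injection H as <-. left. subst. unfold lentry. rewrite Nat.add_0_r. reflexivity.
        -- simpl in H. unfold goal in H. revert H; kill_tests; discriminate.
        -- apply CH in H as [H ->]; auto. right; right. unfold start_lab in H. exists (S q - 2 * U). split; [lia|].
           right; left. unfold lentry. simpl gof. repeat f_equal; lia.
        -- apply CH in H as [H ->]; auto. right; right. unfold start_lab in H. exists (S q - 2 * U). split; [lia|].
           right; right. unfold lentry. simpl gof. repeat f_equal; lia.
        -- destruct (Nat.lt_ge_cases q (2 * U)) as [Hq2|Hq2].
           ++ right; left. repeat split; try lia. exists false; split; auto. rewrite DL by lia. exact H.
           ++ exfalso. cbn [lab_prev] in H. unfold lab_prog in H.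
              assert (X : forall p, (q =? lab p) = false) by (intros p; apply Nat.eqb_neq; unfold lab; lia).
              assert (Y : (q =? goal) = false) by (apply Nat.eqb_neq; unfold goal; lia).
              destruct (nth_error P (i / 3)) as [[r q1|r q1 q2]|]; [| |discriminate];
              destruct (i mod 3) as [|[|[|?]]]; rewrite ?X, ?Y in H; discriminate.
Qed.


Lemma dec_state_copy_inv q x ok : dec_state q = SCopy x ok -> x <= ncol + 1.
Proof.
  unfold dec_state, wait_st. destruct (Nat.ltb_spec q U).
  - destruct (Nat.ltb_spec q (2 * (ncol + 2))); [|discriminate].
    intros E. assert (x = q / 2) as -> by congruence. enough (q / 2 < ncol + 2) by lia.
    apply Nat.Div0.div_lt_upper_bound; lia.
  - repeat match goal with |- context [if ?b then _ else _] => destruct b end; discriminate.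
Qed.

Lemma dec_state_seg_inv q i s : dec_state q = SSeg i s -> i < nctl.
Proof.
  unfold dec_state. destruct (q <? U); [destruct (q <? wait_st); discriminate|].
  destruct (q =? U); [discriminate|]. destruct (q =? U + 1); [discriminate|].
  destruct (q =? U + 2); [discriminate|].
  destruct (Nat.leb_spec (U + 4) q); [|discriminate].
  destruct (Nat.ltb_spec q (U + 4 + 2 * nctl)); [|discriminate].
  cbn [andb]. intros E. assert (i = (q - (U + 4)) / 2) as -> by congruence.
  apply Nat.Div0.div_lt_upper_bound. lia.
Qed.

Lemma lab_prev_lt c q i p : q < 2 * U + c -> lab_prev c q i = Some p -> p < 2 * U + c.
Proof.
  intros Hq H. assert (G : goal < 2 * U) by (unfold goal; lia).
  assert (L : forall p, lab p < 2 * U) by (intros; unfold lab; lia).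
  destruct i as [|[|[|[|i]]]]; cbn [lab_prev] in H.
  - destruct (_ =? _); inversion H; lia.
  - simpl in H. destruct (_ =? _); inversion H; lia.
  - unfold start_lab in H. destruct (Nat.leb_spec (2 * U - 1) q); [|discriminate].
    destruct (Nat.ltb_spec q (Nat.pred (2 * U + c))); inversion H; lia.
  - unfold start_lab in H. destruct (Nat.leb_spec (2 * U - 1) q); [|discriminate].
    destruct (Nat.ltb_spec q (Nat.pred (2 * U + c))); inversion H; lia.
  - unfold lab_prog in H. specialize (L (i / 3)).
    destruct (nth_error P (i / 3)) as [[r q1|r q1 q2]|]; [| |discriminate];
    destruct (i mod 3) as [|[|[|?]]]; try discriminate;
    destruct (_ =? _); try discriminate;
    ((assert (p = goal) by congruence) || (assert (p = lab (i / 3)) by congruence)); lia.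
Qed.

Lemma alt_form_ok c l :
  match l with Ctl i => i < nctl | _ => True end -> class_out l <= ncol + 1 ->
  form_states_ok (2 * U + c) (alt_form l).
Proof.
  intros Hl Hc. unfold alt_form. cbn [form_states_ok].
  assert (2 * (ncol + 2) < U) by (unfold ncol; nia).
  split; [|split].
  - unfold alt_st. destruct (negb _); lia.
  - unfold copy_st. simpl Nat.b2n. lia.
  - destruct l as [|a b|i]; simpl; auto. split.
    + unfold seg_st, nctl in *. destruct (seg_start _); simpl Nat.b2n; lia.
    + unfold wait_st. destruct (i =? 1); simpl; auto. lia.
Qed.

Lemma delta_form_ok c q l g phi :
  q < 2 * U + c -> delta (lab_prev c) q l g = Some phi -> form_states_ok (2 * U + c) phi.
Proof.
  intros Hq. assert (HW : 2 * (ncol + 2) < U) by (unfold ncol; nia).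
  unfold delta. destruct (dec_state q) as [x ok| | |s|i s|] eqn:E.
  - apply dec_state_copy_inv in E. destruct g; [destruct ok; intros [= <-]; exact I|].
    destruct (_ && _); intros [= <-]. simpl. unfold copy_st. destruct (_ =? _); simpl; lia.
  - destruct g; [discriminate|]. unfold wait_st. destruct (_ =? _); intros [= <-]; simpl; auto; lia.
  - destruct g; [discriminate|]. destruct (_ =? _); intros [= <-]. split.
    + unfold goal. simpl; lia.
    + apply alt_form_ok; simpl; unfold nctl; lia.
  - destruct g; [discriminate|]. destruct (eqb _ _); [|discriminate].
    pose proof (class_out_le l) as CO.
    destruct (dec_letter l) as [|a b|i]; try (intros [= <-]; now apply alt_form_ok).
    destruct (Nat.ltb_spec i nctl); intros [= <-]. now apply alt_form_ok.
  - apply dec_state_seg_inv in E. destruct g; [discriminate|].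
    assert (X : forall o : option bool, option_map (fun s' => FAtom (seg_st i s') true) o = Some phi ->
       form_states_ok (2 * U + c) phi).
    { intros [s'|]; intros [= <-]. simpl. unfold seg_st, nctl in *. destruct s'; simpl Nat.b2n; lia. }
    destruct (dec_letter l); try apply X. destruct s; intros [= <-]; exact I.
  - destruct g; [discriminate|]. destruct (l <? U); [intros [= <-]; exact Hq|].
    destruct (lab_prev c q (l - U)) eqn:EL; intros [= <-].
    simpl. eapply lab_prev_lt; eauto.
Qed.

Lemma delta_no_disj nl q l g phi : delta nl q l g = Some phi -> no_disj phi.
Proof.
  assert (X : forall l, no_disj (alt_form l)).
  { intros [|a b|i]; simpl; auto. destruct (i =? 1); simpl; auto. }
  unfold delta. destruct (dec_state q) as [x ok| | |s|i s|].
  - destruct g; [destruct ok; intros [= <-]; exact I|].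
    destruct (_ && _); intros [= <-]; exact I.
  - destruct g; [discriminate|]. destruct (_ =? _); intros [= <-]; exact I.
  - destruct g; [discriminate|]. destruct (_ =? _); intros [= <-]. split; [exact I|apply X].
  - destruct g; [discriminate|]. destruct (eqb _ _); [|discriminate].
    destruct (dec_letter l) as [|a b|i]; try (intros [= <-]; apply X).
    destruct (i <? nctl); intros [= <-]. apply X.
  - destruct g; [discriminate|].
    assert (Y : forall o : option bool, option_map (fun s' => FAtom (seg_st i s') true) o = Some phi ->
       no_disj phi).
    { intros [s'|]; intros [= <-]; exact I. }
    destruct (dec_letter l); try apply Y. destruct s; intros [= <-]; exact I.
  - destruct g; [discriminate|]. destruct (l <? U); [intros [= <-]; exact I|].
    destruct (nl q (l - U)); intros [= <-]; exact I.
Qed.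

Lemma NoDup_fixed_keys : NoDup (map trans_key fixed_trans).
Proof.
  apply NoDup_map_flat_map with (h := fun k : nat * nat * bool => let '(q, l, g) := k in (q, l, gof g)).
  - intros [[q l] g] [[q' l'] g'] [= -> -> E]. repeat f_equal.
    destruct g, g'; simpl in E; congruence.
  - intros [[q l] g]. destruct (delta lab_prog q l g); auto. right. eexists; split; reflexivity.
  - apply NoDup_list_prod; [apply NoDup_list_prod; apply seq_NoDup|].
    constructor; [simpl; intuition discriminate|]. constructor; [auto|constructor].
Qed.

Lemma NoDup_self_keys s n acc :
  (forall k, In k (map trans_key acc) -> fst (fst k) <> s) ->
  NoDup (map trans_key acc) -> NoDup (map trans_key (self_trans s n acc)).
Proof.
  intros H1 H2. induction n; simpl; auto. constructor; auto.
  intros H. apply in_map_iff in H as (e & E & H). apply In_self in H as [H|(l & Hl & ->)].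
  - apply (in_map trans_key) in H. rewrite E in H. now apply H1 in H.
  - unfold lentry in E. injection E. lia.
Qed.

Lemma fixed_label_keys q l th phi : In (q, l, th, phi) fixed_trans ->
  q < 2 * U /\ (2 * U - 1 <= q -> l <> U /\ l <> U + 2 /\ l <> U + 3).
Proof.
  intros H. apply In_fixed in H as (Hq & _ & g & _ & H). split; auto. intros Hq2.
  unfold delta in H. rewrite dec_lab in H by (unfold nctl; lia).
  destruct g; [discriminate|].
  repeat split; intros ->; revert H;
    [rewrite Nat.sub_diag
    |replace (U + 2 - U) with 2 by lia|replace (U + 3 - U) with 3 by lia];
    kill_tests; discriminate.
Qed.

(** The second conjunct strengthens the induction: the topmost label has no entry yet for the
    letters [U], [U + 2] and [U + 3], which the restart entry and the next link are going to use. *)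
Lemma NoDup_chain_keys c :
  NoDup (map trans_key (chain_trans c)) /\
  forall q l th phi, In (q, l, th, phi) (chain_trans c) ->
    q < 2 * U + c /\ (2 * U + c - 1 <= q -> l <> U /\ l <> U + 2 /\ l <> U + 3).
Proof.
  induction c as [|c [IH1 IH2]].
  - split; [apply NoDup_fixed_keys|]. intros q l th phi H.
    apply fixed_label_keys in H. rewrite Nat.add_0_r. exact H.
  - split.
    + assert (HS : forall m phi, In (m, phi) (self_trans (2 * U + c) U (chain_trans c)) ->
         fst (fst m) = Nat.pred (2 * U + c) -> snd (fst m) <> U + 2 /\ snd (fst m) <> U + 3).
      { intros [[q l] th] phi H E. simpl in *. apply In_self in H as [H|(l' & Hl & H)].
        - apply IH2 in H. destruct H as [_ H]. apply H. lia.
        - injection H as -> -> -> ->. lia. }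
      cbn [chain_trans map]. constructor; [|constructor].
      * cbn [In]. intros [H|H].
        -- unfold lentry in H. injection H. lia.
        -- apply in_map_iff in H as ([[[q l] th] phi] & E & H). apply HS in H; unfold lentry in E;
           simpl in E; injection E as -> -> _; simpl in *; lia.
      * intros H.
        apply in_map_iff in H as ([[[q l] th] phi] & E & H). apply HS in H; unfold lentry in E;
           simpl in E; injection E as -> -> _; simpl in *; lia.
      * apply NoDup_self_keys; auto. intros k H.
        apply in_map_iff in H as ([[[q l] th] phi] & <- & H). apply IH2 in H. simpl. lia.
    + intros q l th phi H. cbn [chain_trans In] in H.
      destruct H as [H|[H|H]]; [unfold lentry in H; injection H; lia..|].
      apply In_self in H as [H|(l' & Hl & H)].
      * apply IH2 in H. lia.
      * injection H. lia.
Qed.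

Lemma prog_ata_class c : thm_class (prog_ata c).
Proof.
  split; [|split; [|split]].
  - split; [simpl; lia|]. split; [simpl; rewrite length_app, !repeat_length; lia|].
    split; [|split].
    + intros q l th phi H. apply In_trans in H as (H1 & H2 & g & -> & H).
      repeat split; auto. eapply delta_form_ok; eauto.
    + cbn [trans prog_ata map]. destruct (NoDup_chain_keys c) as [H1 H2].
      constructor; auto. intros H. apply in_map_iff in H as ([[[q l] th] phi] & E & H).
      apply H2 in H. unfold lentry, start_lab in E. simpl in E. injection E. lia.
    + intros q l v th1 phi1 th2 phi2 H1 H2 S1 S2.
      apply In_trans in H1 as (_ & _ & g1 & -> & _).
      apply In_trans in H2 as (_ & _ & g2 & -> & _).
      apply sat_gof in S1, S2. congruence.
  - intros q l th phi H. apply In_trans in H as (_ & _ & g & _ & H).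
    eapply delta_no_disj; eauto.
  - intros r H. cbn [rank prog_ata] in H. apply in_app_or in H as [H|H]; apply repeat_spec in H; auto.
  - intros q l th phi H. apply In_trans in H as (_ & _ & g & -> & _). destruct g; auto.
Qed.

Lemma enabled_delta c q l v :
  q < 2 * U + c -> l < 2 * U ->
  enabled (prog_ata c) q l v = delta (lab_prev c) q l (gt1 v).
Proof.
  intros Hq Hl. destruct (delta _ _ _ _) as [phi|] eqn:E.
  - eapply In_enabled; [apply prog_ata_class| |apply sat_gof; reflexivity].
    apply In_trans. eauto.
  - destruct (enabled _ _ _ _) as [phi|] eqn:E'; auto.
    apply enabled_In in E' as (th & H & S). apply In_trans in H as (_ & _ & g & -> & H).
    apply sat_gof in S. congruence.
Qed.

Lemma rank1 c q : q < U -> nth q (rank (prog_ata c)) 0 = 1.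
Proof.
  intros H. cbn [rank prog_ata]. rewrite app_nth1 by (rewrite repeat_length; lia).
  now apply nth_repeat_lt.
Qed.

Lemma rank2 c q : U <= q < 2 * U + c -> nth q (rank (prog_ata c)) 0 = 2.
Proof.
  intros H. cbn [rank prog_ata]. rewrite app_nth2 by (rewrite repeat_length; lia).
  rewrite repeat_length. apply nth_repeat_lt. lia.
Qed.

(** * What the automaton says about a word *)

Section Word.
Variables (c : nat) (a : nat -> nat) (t : nat -> R).
Let w (k : nat) : letter := dec_letter (a k).

Definition no_ctl_between (k m : nat) : Prop :=
  forall j, k < j < m -> is_ctl (w j) = false.

Definition seg_run (i k m : nat) : option bool :=
  fold_left (seg_step (opof i)) (map w (seq (S k) (m - S k))) (Some (seg_start (opof i))).

Definition lab_next (q l : nat) : option nat :=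
  if l <? U then Some q else lab_prev c q (l - U).

(** Acceptance without games. [ws_copy] and [ws_end] are what the rank-1 threads enforce, the other
    fields come from the threads of rank 2. That all gaps are at most 1 follows from [ws_copy]. *)
Record word_spec : Prop := {
  ws_first : a 0 = U + 1;
  ws_time0 : (t 0%nat <= 1)%R;
  ws_alt : forall k, is_sep (w k) = Nat.odd k;
  ws_ctl : forall k i, w k = Ctl i -> i < nctl;
  ws_copy : forall k, exists m, k < m /\ (t m <= t k + 1 < t (S m))%R /\
     class_in (w m) = class_out (w k) /\ (is_ctl (w k) = true -> no_ctl_between k m);
  ws_lab : exists lb : nat -> nat, lb 1 = goal /\
     forall k, 1 <= k -> lab_next (lb k) (a k) = Some (lb (S k));
  ws_seg : forall k m i, w k = Ctl i -> k < m -> no_ctl_between k m -> is_ctl (w m) = true ->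
     seg_run i k m = Some true;
  ws_end : forall k, exists m, k < m /\ a m = U + 1
}.

Hypothesis letters_lt : forall k, a k < 2 * U.
Hypothesis t_incr : forall k, (t k < t (S k))%R.

Let A := prog_ata c.
Notation W1 := (wins1 A a t).
Notation W2 := (wins2 A a t).

Definition is_lab (q : nat) : Prop :=
  (q = goal \/ U + 4 + 2 * nctl <= q) /\ q < 2 * U + c.

Lemma lab_next_is_lab q l p : is_lab q -> lab_next q l = Some p -> is_lab p.
Proof.
  unfold lab_next. intros H. destruct (l <? U); [intros [= <-]; auto|].
  generalize (l - U) as i. intros i E.
  split; [|destruct H; eapply lab_prev_lt; eauto].
  unfold lab_prev, lab_prog, start_lab, nctl in *.
  assert (L : forall j I, nth_error P j = Some I -> U + 4 + 2 * (4 + 3 * length P) <= lab j).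
  { intros j I HI. assert (j < length P) by (apply nth_error_Some; congruence). unfold lab. lia. }
  destruct i as [|[|[|[|i]]]].
  - destruct (_ =? _); inversion E; auto.
  - destruct (_ =? _); inversion E; auto.
  - destruct (Nat.leb_spec (2 * U - 1) q); [|discriminate].
    destruct (_ <? _); inversion E; lia.
  - destruct (Nat.leb_spec (2 * U - 1) q); [|discriminate].
    destruct (_ <? _); inversion E; lia.
  - right. specialize (L (i / 3)).
    destruct (nth_error P (i / 3)) as [I|]; [|discriminate]. specialize (L I eq_refl).
    destruct I as [r q1|r q1 q2];
    destruct (i mod 3) as [|[|[|?]]]; try discriminate;
    destruct (_ =? _); try discriminate;
    assert (p = lab (i / 3)) by congruence; lia.
Qed.

Lemma t_mono i j : i < j -> (t i < t j)%R.
Proof.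
  intros H. induction H as [|j H IH]; [apply t_incr|].
  eapply Rlt_trans; [exact IH|apply t_incr].
Qed.

Lemma t_mono_le i j : i <= j -> (t i <= t j)%R.
Proof.
  intros H. destruct (Nat.eq_dec i j) as [->|N]; [lra|]. apply Rlt_le, t_mono. lia.
Qed.

Lemma delta_gt nl q l phi x :
  match dec_state q with SCopy _ _ => False | _ => True end ->
  delta nl q l x = Some phi -> x = false.
Proof. unfold delta. destruct x; auto. destruct (dec_state q); easy. Qed.

Lemma W2_reset_step k q :
  q < 2 * U + c -> match dec_state q with SCopy _ _ => False | _ => True end ->
  W2 (PConf k q 0) ->
  exists v phi, delta (lab_prev c) q (a k) false = Some phi /\ (elapsed t k <= 1)%R /\
    W2 (PForm k v phi).
Proof.
  intros Hq Hs H. apply wins2_conf in H as (phi & E & H).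
  unfold A in E. rewrite enabled_delta in E by auto.
  destruct (gt1 _) eqn:G; [apply delta_gt in E; easy|].
  exists (0 + elapsed t k)%R, phi. repeat split; auto. apply gt1_false in G. lra.
Qed.

Lemma copy_st_lt x ok : x <= ncol + 1 -> copy_st x ok < U.
Proof. unfold copy_st, ncol. intros H. destruct ok; simpl Nat.b2n; nia. Qed.

Lemma wait_st_lt : wait_st < U.
Proof. unfold wait_st, ncol. nia. Qed.

(** Induction on the length of the winning run, two positions per letter. The event [m] is the last
    one within time 1 of [k0]; for [m = k] the verdict is the flag itself and not the class of
    letter [k], because the flag is false at the start [k0], whatever that letter is. *)
Lemma copy_run_inv k0 x b : x <= ncol + 1 -> forall n k ok,
  fst (run A a t n (PConf (S k) (copy_st x ok) (t k - t k0)%R, b)) = PWin ->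
  exists m, k <= m /\ (k < m -> (t m <= t k0 + 1)%R) /\ (t k0 + 1 < t (S m))%R /\
    (if m =? k then ok = true else class_in (w m) = x) /\
    (x = 0 -> (ok = true -> m = k) /\ no_ctl_between k m).
Proof.
  intros Hx n. induction n as [n IH] using lt_wf_ind. intros k ok H.
  destruct n as [|n]; [discriminate|]. simpl in H.
  pose proof (copy_st_lt x ok Hx) as HL.
  unfold A in H. rewrite enabled_delta in H by (auto; lia).
  unfold delta in H. rewrite dec_copy in H by auto.
  replace (t k - t k0 + (t (S k) - t k))%R with (t (S k) - t k0)%R in H by ring.
  destruct (gt1 (t (S k) - t k0)) eqn:G.
  - destruct ok; [|rewrite run_lose in H; discriminate].
    exists k. rewrite Nat.eqb_refl. repeat split; auto; try lia.
    + unfold gt1 in G. destruct (Rle_dec _ _); [discriminate|]. lra.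
    + intros j Hj; lia.
  - apply gt1_false in G. destruct ((x =? 0) && ok) eqn:B; [rewrite run_lose in H; discriminate|].
    destruct n as [|n]; [discriminate|]. simpl in H.
    apply IH in H; [|lia]. destruct H as (m & H1 & H2 & H3 & H4 & H5).
    exists m. repeat split; auto; try lia.
    + intros _. destruct (Nat.eq_dec m (S k)) as [->|]; [lra|]. apply H2; lia.
    + destruct (Nat.eqb_spec m k); [lia|]. destruct (Nat.eqb_spec m (S k)); auto.
      subst. now apply Nat.eqb_eq.
    + intros ->. subst x. discriminate.
    + intros j Hj. subst x. destruct (H5 eq_refl) as [H6 H7].
      destruct (Nat.eq_dec j (S k)) as [->|]; [|apply H7; lia].
      destruct (is_ctl (w (S k))) eqn:C; auto. exfalso.
      enough (m = S k) by lia. apply H6. fold (w (S k)).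
      destruct (class_ctl (w (S k))) as [-> _]. exact C.
Qed.

Lemma wait_run_inv b : forall n k,
  fst (run A a t n (PConf (S k) wait_st 0%R, b)) = PWin -> exists m, k < m /\ a m = U + 1.
Proof.
  intros n. induction n as [n IH] using lt_wf_ind. intros k H.
  destruct n as [|n]; [discriminate|]. simpl in H.
  pose proof wait_st_lt as HL.
  unfold A in H. rewrite enabled_delta in H by (auto; lia).
  unfold delta in H. rewrite dec_wait in H.
  destruct (gt1 _); [rewrite run_lose in H; discriminate|].
  destruct (Nat.eqb_spec (a (S k)) (U + 1)); [exists (S k); auto|].
  destruct n as [|n]; [discriminate|]. simpl in H.
  apply IH in H; [|lia]. destruct H as (m & H1 & H2). exists m; split; auto; lia.
Qed.

Lemma seg_run_S i k m : k < m ->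
  seg_run i k (S m) = seg_step (opof i) (seg_run i k m) (w m).
Proof.
  intros H. unfold seg_run. replace (S m - S k) with (S (m - S k)) by lia.
  rewrite seq_S, map_app, fold_left_app. simpl. repeat f_equal. lia.
Qed.

Lemma seg_run_start i k : seg_run i k (S k) = Some (seg_start (opof i)).
Proof. unfold seg_run. now rewrite Nat.sub_diag. Qed.

Lemma seg_st_range i s : i < nctl -> U <= seg_st i s < 2 * U.
Proof. unfold seg_st, nctl. intros H. destruct s; simpl Nat.b2n; lia. Qed.

Lemma delta_alt nl s l :
  delta nl (alt_st s) l false =
  (if eqb s (is_sep (dec_letter l)) then
        match dec_letter l with
        | Ctl i => if i <? nctl then Some (alt_form (Ctl i)) else None
        | l' => Some (alt_form l')
        end
      else None).
Proof. unfold delta. now rewrite dec_alt. Qed.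

Lemma delta_seg nl i s l : i < nctl ->
  delta nl (seg_st i s) l false =
  match dec_letter l with
  | Ctl _ => if s then Some FTrue else None
  | l' => option_map (fun s' => FAtom (seg_st i s') true) (seg_step (opof i) (Some s) l')
  end.
Proof. intros H. unfold delta. now rewrite dec_seg. Qed.

Lemma delta_lab q l : is_lab q ->
  delta (lab_prev c) q l false = option_map (fun p => FAtom p true) (lab_next q l).
Proof.
  intros [H _]. unfold delta, lab_next. rewrite dec_lab by auto. now destruct (l <? U).
Qed.

Lemma alt_st_range s : U < alt_st s < 2 * U.
Proof. unfold alt_st. destruct s; lia. Qed.

Theorem word_spec_of_wins : W2 (PConf 0 U 0%R) -> word_spec.
Proof.
  intros H0.
  apply W2_reset_step in H0 as (v0 & phi & E & G0 & H0); [|lia|now rewrite dec_init].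
  unfold delta in E. rewrite dec_init in E.
  destruct (Nat.eqb_spec (a 0) (U + 1)) as [F0|]; [|discriminate].
  injection E as <-. apply wins2_and in H0 as [HL HA]. apply wins2_atom in HL.
  assert (w0 : w 0 = Ctl 1) by (apply dec_letter_ctl; auto).
  (* The alternation thread never ends, so [alt_form] is won at every event; all launched threads
     are obtained from this. *)
  assert (ALT : forall k, is_sep (w k) = Nat.odd k /\ (forall i, w k = Ctl i -> i < nctl) /\
     exists v, W2 (PForm k v (alt_form (w k)))).
  { induction k as [|k (IH1 & IH2 & v & IH3)].
    - rewrite w0. repeat split; eauto. intros i [= <-]. unfold nctl; lia.
    - unfold alt_form in IH3. apply wins2_and in IH3 as [IH3 _]. apply wins2_atom in IH3.
      rewrite IH1 in IH3. set (s := negb (Nat.odd k)) in *.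
      apply W2_reset_step in IH3 as (v' & phi & E & G & H);
        [|pose proof (alt_st_range s); lia|now rewrite dec_alt].
      rewrite delta_alt in E. fold (w (S k)) in E.
      destruct (eqb s (is_sep (w (S k)))) eqn:ES; [|discriminate].
      apply eqb_prop in ES. subst s. rewrite <- ES, Nat.odd_succ, <- Nat.negb_odd.
      split; auto. destruct (w (S k)) as [|x y|i] eqn:EW.
      + split; [discriminate|]. injection E as <-. eauto.
      + split; [discriminate|]. injection E as <-. eauto.
      + destruct (Nat.ltb_spec i nctl); [|discriminate]. injection E as <-.
        split; eauto. now intros j [= <-]. }
  assert (CP : forall k, W2 (PConf (S k) (copy_st (class_out (w k)) false) 0%R) /\
      match w k with
      | Ctl i => W2 (PConf (S k) (seg_st i (seg_start (opof i))) 0%R) /\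
         (i = 1 -> W2 (PConf (S k) wait_st 0%R))
      | _ => True end).
  { intros k. destruct (ALT k) as (_ & _ & v & H). unfold alt_form in H.
    apply wins2_and in H as [_ H]. apply wins2_and in H as [H1 H2].
    apply wins2_atom in H1. split; [exact H1|].
    destruct (w k) as [|x y|i]; auto. apply wins2_and in H2 as [H2 H3].
    apply wins2_atom in H2. split; auto. intros ->. now apply wins2_atom in H3. }
  assert (COPY : forall k, exists m, k < m /\ (t m <= t k + 1 < t (S m))%R /\
     class_in (w m) = class_out (w k) /\ (is_ctl (w k) = true -> no_ctl_between k m)).
  { intros k. destruct (CP k) as [H _].
    assert (Hx : class_out (w k) <= ncol + 1) by apply class_out_le.
    apply wins2_rank1 in H;
      [|unfold A; rewrite rank1 by (apply copy_st_lt; auto); discriminate].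
    destruct (H (fun _ => true)) as [n Hn].
    replace 0%R with (t k - t k)%R in Hn by ring.
    apply copy_run_inv in Hn as (m & H1 & H2 & H3 & H4 & H5); auto.
    destruct (Nat.eqb_spec m k) as [|N]; [discriminate|].
    exists m. repeat split; auto; try lia.
    + apply H2; lia.
    + intros C. apply H5. destruct (class_ctl (w k)) as [_ X]. rewrite C in X.
      now apply Nat.eqb_eq. }
  split; auto.
  - unfold elapsed in G0. lra.
  - intros k. apply ALT.
  - intros k. apply ALT.
  (* The label thread starts after event 0, so [lb 0] is arbitrary; the default [goal] for a missing
     successor never occurs, since the thread would lose. *)
  - pose (lb := fix lb k := match k with
       | S (S _ as k') => match lab_next (lb k') (a k') with Some p => p | None => goal end
       | _ => goal end).
    exists lb. split; [reflexivity|].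
    assert (X : forall k, is_lab (lb (S k)) /\ W2 (PConf (S k) (lb (S k)) 0%R)).
    { induction k as [|k [IH1 IH2]].
      - split; [|exact HL]. split; [now left|unfold lb, goal; lia].
      - apply W2_reset_step in IH2 as (v & phi & E & _ & IH2);
          [|apply IH1|destruct IH1 as [IH1 _]; now rewrite dec_lab].
        rewrite delta_lab in E by auto.
        destruct (lab_next (lb (S k)) (a (S k))) as [p|] eqn:EN; [|discriminate].
        injection E as <-. apply wins2_atom in IH2.
        replace (lb (S (S k))) with p.
        + split; auto. eapply lab_next_is_lab; eauto.
        + change (lb (S (S k))) with
            (match lab_next (lb (S k)) (a (S k)) with Some p => p | None => goal end).
          now rewrite EN. }
    intros [|k] Hk; [lia|]. destruct (X k) as [IH1 IH2].
    apply W2_reset_step in IH2 as (v & phi & E & _ & IH2);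
      [|apply IH1|destruct IH1 as [IH1 _]; now rewrite dec_lab].
    rewrite delta_lab in E by auto.
    change (lb (S (S k))) with
      (match lab_next (lb (S k)) (a (S k)) with Some p => p | None => goal end).
    destruct (lab_next (lb (S k)) (a (S k))) as [p|]; [auto|discriminate].
  - intros k m i EW Hm NC Cm. destruct (CP k) as [_ H]. rewrite EW in H. destruct H as [H _].
    assert (Hi : i < nctl) by (now apply ALT in EW).
    assert (X : forall m, k < m -> no_ctl_between k m ->
       exists s, seg_run i k m = Some s /\ W2 (PConf m (seg_st i s) 0%R)).
    { clear m Hm NC Cm. intros m Hm. induction Hm as [|m Hm IH]; intros NC.
      - rewrite seg_run_start. eauto.
      - destruct IH as (s & E & IH); [intros j Hj; apply NC; lia|].
        apply W2_reset_step in IH as (v & phi & E' & _ & IH);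
          [|pose proof (seg_st_range i s Hi); lia|now rewrite dec_seg].
        rewrite delta_seg in E' by auto. fold (w m) in E'.
        rewrite seg_run_S by lia. rewrite E.
        assert (Cm : is_ctl (w m) = false) by (apply NC; lia).
        destruct (w m) as [|x y|j]; [| |discriminate];
        (destruct (seg_step _ _ _) as [s'|]; [|discriminate]);
        injection E' as <-; apply wins2_atom in IH; eauto. }
    destruct (X m Hm NC) as (s & E & IH). rewrite E.
    apply W2_reset_step in IH as (v & phi & E' & _ & IH);
          [|pose proof (seg_st_range i s Hi); lia|now rewrite dec_seg].
    rewrite delta_seg in E' by auto. fold (w m) in E'.
    destruct (w m); [discriminate..|]. destruct s; [auto|discriminate].
  (* Each occurrence of [U + 1] launches a waiting thread that must find another one. *)
  - assert (Y : forall k, a k = U + 1 -> exists m, k < m /\ a m = U + 1).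
    { intros k E. destruct (CP k) as [_ H].
      assert (EW : w k = Ctl 1) by (apply dec_letter_ctl; auto).
      rewrite EW in H. destruct H as [_ H]. specialize (H eq_refl).
      apply wins2_rank1 in H;
        [|unfold A; rewrite rank1 by apply wait_st_lt; discriminate].
      destruct (H (fun _ => true)) as [n Hn]. now apply wait_run_inv in Hn. }
    induction k as [|k (m & H1 & H2)]; [now apply Y|].
    destruct (Nat.eq_dec m (S k)) as [->|]; [now apply Y|]. exists m; split; auto; lia.
Qed.

(** The next event comes no later than the copy of the present one. *)
Lemma elapsed_le : word_spec -> forall k, (elapsed t k <= 1)%R.
Proof.
  intros WS [|k]; unfold elapsed; [pose proof (ws_time0 WS); lra|].
  destruct (ws_copy WS k) as (m & H1 & H2 & _).
  assert (t (S k) <= t m)%R by (apply t_mono_le; lia). lra.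
Qed.

(** Induction on the distance [d] to the copy [m]. The factor [k0 <? k] keeps the flag false at
    [k0], where the thread has not read any letter yet. *)
Lemma copy_wins k0 m x : k0 < m -> (t m <= t k0 + 1 < t (S m))%R ->
  class_in (w m) = x -> x <= ncol + 1 -> (x = 0 -> no_ctl_between k0 m) ->
  forall d k ok, m = k + d -> k0 <= k -> ok = (k0 <? k) && (class_in (w k) =? x) ->
  W1 (PConf (S k) (copy_st x ok) (t k - t k0)%R).
Proof.
  intros Hm Ht Hx Hxn Hc d. pose proof (fun ok => copy_st_lt x ok Hxn) as HL.
  induction d as [|d IH]; intros k ok Ed Hk Hok; apply wins1_conf;
    unfold A; rewrite enabled_delta by (auto; specialize (HL ok); lia);
    unfold delta; rewrite dec_copy by auto; unfold elapsed;
    replace (t k - t k0 + (t (S k) - t k))%R with (t (S k) - t k0)%R by ring.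
  - assert (k = m) by lia. subst k. rewrite gt1_gt by lra.
    exists FTrue. rewrite Hx, Nat.eqb_refl in Hok.
    destruct (Nat.ltb_spec k0 m); [|lia]. subst ok. split; auto. apply wins1_true.
  - assert (t (S k) <= t m)%R by (apply t_mono_le; lia).
    rewrite gt1_le by lra.
    assert (B : (x =? 0) && ok = false).
    { destruct (Nat.eqb_spec x 0) as [E0|]; auto. destruct ok; auto. exfalso.
      symmetry in Hok. apply andb_prop in Hok as [O1 O2].
      apply Nat.ltb_lt in O1. apply Nat.eqb_eq in O2.
      assert (F : is_ctl (w k) = false) by (apply Hc; auto; lia).
      destruct (class_ctl (w k)) as [X _]. rewrite F in X. apply Nat.eqb_neq in X. lia. }
    rewrite B. eexists; split; [reflexivity|]. apply wins1_atom.
    apply IH; try lia. destruct (Nat.ltb_spec k0 (S k)); [|lia]. reflexivity.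
Qed.

Lemma wait_wins m : word_spec -> a m = U + 1 ->
  forall d k, m = k + d -> W1 (PConf k wait_st 0%R).
Proof.
  intros WS Hm d. pose proof wait_st_lt as HL.
  induction d as [|d IH]; intros k Ed; apply wins1_conf;
    unfold A; rewrite enabled_delta by (auto; lia);
    unfold delta; rewrite dec_wait; pose proof (elapsed_le WS k); rewrite gt1_le by lra.
  - assert (k = m) by lia. subst k. rewrite Hm, Nat.eqb_refl.
    eexists; split; [reflexivity|]. apply wins1_true.
  - destruct (a k =? U + 1); eexists; (split; [reflexivity|]).
    + apply wins1_true.
    + apply wins1_atom. apply IH. lia.
Qed.

Lemma seg_run_prefix i k j m : k < j -> j <= m -> seg_run i k m <> None -> seg_run i k j <> None.
Proof.
  intros Hk Hj. induction Hj as [|m Hj IH]; auto.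
  intros H. apply IH. intros E. apply H. rewrite seg_run_S, E by lia. reflexivity.
Qed.

Lemma alt_form_inv (I : nat -> nat -> Prop) k v : word_spec ->
  I (S k) (alt_st (Nat.odd (S k))) ->
  (forall i, w k = Ctl i -> I (S k) (seg_st i (seg_start (opof i)))) ->
  form_inv A a t I k v (alt_form (w k)).
Proof.
  intros WS H1 H2. unfold alt_form. cbn [form_inv].
  rewrite (ws_alt WS k). split; [left; split; auto|].
  { rewrite Nat.negb_odd, <- Nat.odd_succ. exact H1. }
  split.
  - right. destruct (ws_copy WS k) as (m & Hm & Ht & Hc & Hn).
    replace 0%R with (t k - t k)%R by ring.
    apply copy_wins with (m := m) (d := m - k); auto; try lia.
    + apply class_out_le.
    + intros E. apply Hn. destruct (class_ctl (w k)) as [_ <-]. now apply Nat.eqb_eq.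
    + now rewrite Nat.ltb_irrefl.
  - destruct (w k) as [|x y|i] eqn:E; simpl; auto. split; [left; auto|].
    destruct (i =? 1); simpl; auto. right.
    destruct (ws_end WS k) as (m & Hm & Em).
    apply wait_wins with (m := m) (d := m - S k); auto. lia.
Qed.

Theorem wins_of_word_spec : word_spec -> W2 (PConf 0 U 0%R).
Proof.
  intros WS. destruct (ws_lab WS) as (lb & L1 & L2).
  set (Inv := fun k q => (k = 0 /\ q = U) \/ (1 <= k /\ q = alt_st (Nat.odd k)) \/
     (1 <= k /\ q = lb k) \/
     exists k0 i s, k0 < k /\ w k0 = Ctl i /\ no_ctl_between k0 k /\
       seg_run i k0 k = Some s /\ q = seg_st i s).
  apply wins2_of_invariant with (Inv := Inv); [|now left].
  assert (LB : forall k, 1 <= k -> is_lab (lb k)).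
  { intros k Hk. induction Hk as [|k Hk IH].
    - rewrite L1. split; [now left|unfold goal; lia].
    - eapply lab_next_is_lab; [exact IH|]. auto. }
  assert (ALT : forall k v, form_inv A a t Inv k v (alt_form (w k))).
  { intros k v. apply alt_form_inv; auto.
    - right; left; split; auto; lia.
    - intros i E. right; right; right. exists k, i, (seg_start (opof i)).
      repeat split; auto. + intros j Hj; lia. + apply seg_run_start. }
  assert (B : forall k, (0 + elapsed t k <= 1)%R).
  { intros k. pose proof (elapsed_le WS k). lra. }
  intros k q [[-> ->]|[[Hk ->]|[[Hk ->]|(k0 & i & s & Hk & EW & NC & ER & ->)]]].
  - unfold A. rewrite rank2, enabled_delta by (auto; lia). split; auto.
    rewrite gt1_le by auto. unfold delta. rewrite dec_init, (ws_first WS), Nat.eqb_refl.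
    eexists; split; [reflexivity|]. split.
    + left. split; auto. right; right; left. split; auto.
    + assert (E : w 0 = Ctl 1) by (apply dec_letter_ctl, (ws_first WS)).
      rewrite <- E. apply ALT.
  - pose proof (alt_st_range (Nat.odd k)).
    unfold A. rewrite rank2, enabled_delta by (auto; lia). split; auto.
    rewrite gt1_le by auto. rewrite delta_alt. fold (w k). rewrite (ws_alt WS), eqb_reflx.
    exists (alt_form (w k)). split; [|apply ALT].
    destruct (w k) as [|x y|i] eqn:E; auto.
    apply (ws_ctl WS) in E. apply Nat.ltb_lt in E. now rewrite E.
  - pose proof (LB k Hk) as HL. pose proof HL as [HL1 HL2].
    assert (U <= lb k) by (unfold goal in HL1; lia).
    unfold A. rewrite rank2, enabled_delta by (auto; lia). split; auto.
    rewrite gt1_le by auto. rewrite delta_lab, L2 by auto.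
    eexists; split; [reflexivity|]. left; split; auto. right; right; left. split; auto; lia.
  - assert (Hi : i < nctl) by (now apply (ws_ctl WS) in EW).
    pose proof (seg_st_range i s Hi).
    unfold A. rewrite rank2, enabled_delta by (auto; lia). split; auto.
    rewrite gt1_le by auto. rewrite delta_seg by auto. fold (w k).
    destruct (is_ctl (w k)) eqn:C.
    + assert (s = true) as ->.
      { pose proof (ws_seg WS k0 k i EW Hk NC C). congruence. }
      destruct (w k); try discriminate. exists FTrue. split; [reflexivity|exact I].
    (* The copy [m] of the control letter closes the block. The check succeeds up to [m], so it
       cannot have failed at the earlier letter [k]. *)
    + destruct (ws_copy WS k0) as (m & H1 & _ & H3 & H4).
      destruct (class_ctl (w k0)) as [_ X]. rewrite EW in X.
      rewrite EW in H3, H4. simpl in X, H3, H4. specialize (H4 eq_refl).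
      destruct (class_ctl (w m)) as [Y _]. rewrite H3 in Y. simpl in Y.
      assert (Hkm : k < m).
      { destruct (Nat.lt_trichotomy k m) as [|[->|Hgt]]; auto; [congruence|].
        rewrite NC in Y by lia. discriminate. }
      assert (NE : seg_run i k0 (S k) <> None).
      { apply seg_run_prefix with m; try lia. rewrite (ws_seg WS k0 m i EW H1 H4) by auto. discriminate. }
      rewrite seg_run_S, ER in NE by lia.
      destruct (seg_step (opof i) (Some s) (w k)) as [s'|] eqn:ES; [|congruence].
      exists (FAtom (seg_st i s') true). split.
      * destruct (w k); try discriminate; now rewrite ES.
      * left. split; auto. right; right; right. exists k0, i, s'.
        repeat split; auto; try lia.
        -- intros j Hj. destruct (Nat.eq_dec j k) as [->|]; auto. apply NC; lia.
        -- rewrite seg_run_S, ER by lia. exact ES.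
Qed.

Theorem accepts_iff_word_spec : accepts A a t <-> word_spec.
Proof.
  destruct (prog_ata_class c) as (H1 & H2 & H3 & _).
  rewrite accepts_iff_wins2 by assumption.
  split; [apply word_spec_of_wins|apply wins_of_word_spec].
Qed.

End Word.

End Automaton.

(** * Block sequences and conservative machines *)

Inductive subseq {X : Type} : list X -> list X -> Prop :=
| sub_nil : forall l, subseq [] l
| sub_cons : forall x l l', subseq l l' -> subseq (x :: l) (x :: l')
| sub_skip : forall x l l', subseq l l' -> subseq l (x :: l').

Lemma subseq_length X (l l' : list X) : subseq l l' -> length l <= length l'.
Proof. induction 1; simpl; lia. Qed.

Lemma subseq_eq X (l l' : list X) : subseq l l' -> length l' <= length l -> l = l'.
Proof.
  induction 1 as [l|x l l' H IH|x l l' H IH]; simpl; intros E.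
  - destruct l; simpl in E; [auto|lia].
  - f_equal. apply IH. lia.
  - apply subseq_length in H. lia.
Qed.

Lemma subseq_filter X (f : X -> bool) l l' : subseq l l' -> subseq (filter f l) (filter f l').
Proof.
  induction 1 as [l|x l l' H IH|x l l' H IH]; simpl.
  - constructor.
  - destruct (f x); [now constructor|auto].
  - destruct (f x); [now constructor|auto].
Qed.

Lemma filter_all X (f : X -> bool) l : Forall (fun x => f x = true) l -> filter f l = l.
Proof. induction 1; simpl; auto. rewrite H. now f_equal. Qed.

Lemma Forall_eq_repeat X (x : X) l : Forall (fun y => y = x) l -> l = repeat x (length l).
Proof. induction 1; simpl; congruence. Qed.

Definition tok_letters (B : list (nat * nat)) : list letter :=
  map (fun ab => Tok (fst ab) (snd ab)) B.

Section Blocks.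
Variables (K : nat) (opf : nat -> op) (prev : nat -> nat -> option nat) (start goal : nat).

Definition seg_ok (o : op) (B : list (nat * nat)) : Prop :=
  fold_left (seg_step K o) (tok_letters B) (Some (seg_start o)) = Some true.

Definition plain (o : op) (ab : nat * nat) : Prop :=
  tok_special K o (fst ab) (snd ab) = false /\ tok_plain K o (fst ab) (snd ab) = true.

Lemma seg_fold_none o l : fold_left (seg_step K o) l None = None.
Proof. induction l; auto. Qed.

Lemma seg_fold_seen o B :
  fold_left (seg_step K o) (tok_letters B) (Some true) = Some true <-> Forall (plain o) B.
Proof.
  induction B as [|[a b] B IH]; simpl; [split; auto|].
  destruct (tok_special K o a b) eqn:E1; [|destruct (tok_plain K o a b) eqn:E2].
  - rewrite seg_fold_none. split; [discriminate|]. intros H. inversion H as [|? ? [H1 _] _]; subst.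
    simpl in H1. congruence.
  - rewrite IH. split; intros H; [constructor; auto; split; auto|now inversion H].
  - rewrite seg_fold_none. split; [discriminate|]. intros H. inversion H as [|? ? [_ H1] _]; subst.
    simpl in H1. congruence.
Qed.

Lemma seg_fold_unseen o B :
  fold_left (seg_step K o) (tok_letters B) (Some false) = Some true <->
  exists B1 a b B2, B = B1 ++ (a, b) :: B2 /\ tok_special K o a b = true /\
    Forall (plain o) B1 /\ Forall (plain o) B2.
Proof.
  induction B as [|[a b] B IH]; simpl.
  - split; [discriminate|]. intros (B1 & ? & ? & B2 & H & _). destruct B1; discriminate.
  - split.
    + destruct (tok_special K o a b) eqn:E1; [|destruct (tok_plain K o a b) eqn:E2].
      * intros H. apply seg_fold_seen in H. exists [], a, b, B. repeat split; auto.
      * intros H. apply IH in H as (B1 & x & y & B2 & -> & H1 & H2 & H3).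
        exists ((a, b) :: B1), x, y, B2. repeat split; auto. constructor; auto; split; auto.
      * now rewrite seg_fold_none.
    + intros ([|ab B1] & x & y & B2 & E & H1 & H2 & H3); simpl in E; injection E as E1 E2.
      * subst. rewrite H1. now apply seg_fold_seen.
      * subst ab B. inversion H2 as [|? ? [P1 P2] H2']; subst. simpl in P1, P2. rewrite P1, P2.
        apply IH. exists B1, x, y, B2. auto.
Qed.

Lemma seg_ok_iff o B :
  seg_ok o B <->
  if seg_start o then Forall (plain o) B
  else exists B1 a b B2, B = B1 ++ (a, b) :: B2 /\ tok_special K o a b = true /\
    Forall (plain o) B1 /\ Forall (plain o) B2.
Proof.
  unfold seg_ok. destruct (seg_start o); [apply seg_fold_seen|apply seg_fold_unseen].
Qed.

Definition mstep (x y : nat * list nat) : Prop :=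
  let '(p, w) := x in let '(q, w') := y in
  exists i, prev q i = Some p /\
    match opf i with
    | OMove a b => exists u v, w = u ++ a :: v /\ w' = u ++ b :: v
    | OZero a => ~ In a w /\ w' = w
    | _ => False
    end.

(** Steps are added in front: reading on in the word means going back in machine time. *)
Inductive msteps : nat * list nat -> nat * list nat -> Prop :=
| ms_refl : forall x, msteps x x
| ms_step : forall x y z, mstep x y -> msteps y z -> msteps x z.

Definition good (N : nat) : Prop := exists w, msteps (start, repeat 0 N) (goal, w).

Hypothesis Hop : forall i, match opf i with
  | ORestart => i = 0
  | OEnd => i = 1
  | OMove x y => x <= K /\ y <= K /\ x <> y
  | OZero x => x <= K
  end.
Hypothesis Hop0 : opf 0 = ORestart.
Hypothesis Hop1 : opf 1 = OEnd.
Hypothesis Hprev0 : forall q p, prev q 0 = Some p <-> q = start /\ p = goal.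
Hypothesis Hprev1 : forall q p, prev q 1 = Some p <-> q = goal /\ p = goal.

Notation al := (filter (alive K)).
Notation ins := (map (@fst nat nat)).
Notation outs := (map (@snd nat nat)).

Ltac bools := repeat match goal with
  | H : _ && _ = true |- _ => apply andb_prop in H as [? ?]
  | H : _ || _ = true |- _ => apply orb_prop in H as [?|?]
  | H : (_ =? _) = true |- _ => apply Nat.eqb_eq in H
  | H : (_ <=? _) = true |- _ => apply Nat.leb_le in H
  | H : negb _ = true |- _ => apply negb_true_iff in H
  | H : (_ =? _) = false |- _ => apply Nat.eqb_neq in H
  | H : alive K _ = true |- _ => apply Nat.leb_le in H
  end.

Lemma alive_true a : a <= K -> alive K a = true.
Proof. intros H. now apply Nat.leb_le. Qed.

Lemma alive_false a : K < a -> alive K a = false.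
Proof. intros H. now apply Nat.leb_gt. Qed.

Lemma plain_eq o B : match o with OMove _ _ | OZero _ => True | _ => False end ->
  Forall (plain o) B -> ins B = outs B.
Proof.
  intros Ho. induction 1 as [|[a b] B [_ H] _ IH]; simpl; auto. rewrite IH. f_equal.
  destruct o; try easy; simpl in H; bools; auto.
Qed.

(** Colour [K + 2] is never an output, hence the fresh token of an [OEnd] block cannot be the copy
    of a token of the block before. *)
Lemma seg_out_le i B : seg_ok (opf i) B -> Forall (fun b => b <= K + 1) (outs B).
Proof.
  intros H. assert (PL : forall B, Forall (plain (opf i)) B -> Forall (fun b => b <= K + 1) (outs B)).
  { clear B H. induction 1 as [|[a b] B [_ H] _ IH]; simpl; constructor; auto.
    destruct (opf i); simpl in H; bools; lia. }
  apply seg_ok_iff in H. destruct (seg_start (opf i)); auto.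
  destruct H as (B1 & a & b & B2 & -> & S & H1 & H2). rewrite map_app. simpl.
  apply Forall_app; split; auto. constructor; auto.
  specialize (Hop i). destruct (opf i); simpl in S; bools; try lia; discriminate.
Qed.

Lemma seg_move x y B : x <= K -> y <= K -> seg_ok (OMove x y) B ->
  exists u v, al (ins B) = u ++ y :: v /\ al (outs B) = u ++ x :: v.
Proof.
  intros Hx Hy H. apply seg_ok_iff in H as (B1 & a & b & B2 & -> & S & H1 & H2).
  simpl in S. bools. subst a b. apply plain_eq in H1, H2; auto.
  exists (al (outs B1)), (al (outs B2)).
  rewrite !map_app, !filter_app. simpl. rewrite H1, H2, !alive_true by auto. auto.
Qed.

Lemma seg_zero x B : seg_ok (OZero x) B -> al (ins B) = al (outs B) /\ ~ In x (al (outs B)).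
Proof.
  intros H. apply seg_ok_iff in H. simpl in H. pose proof (plain_eq (OZero x) B I H) as E.
  rewrite E. split; auto. rewrite <- E. intros X. apply filter_In in X as [X _].
  apply in_map_iff in X as ([a b] & <- & X). rewrite Forall_forall in H. apply H in X as [_ X].
  simpl in X. bools. auto.
Qed.

Lemma seg_restart B : seg_ok ORestart B ->
  al (ins B) = repeat 0 (length (al (ins B))) /\ length (al (ins B)) = S (length (al (outs B))).
Proof.
  intros H. assert (PL : forall B, Forall (plain ORestart) B ->
     Forall (fun y => y = 0) (al (ins B)) /\ length (al (ins B)) = length (al (outs B))).
  { clear B H. induction 1 as [|[a b] B [_ H] _ [IH1 IH2]]; simpl; auto.
    simpl in H. bools; subst.
    - rewrite !alive_true by lia. simpl. auto.
    - rewrite !alive_false by lia. auto. }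
  apply seg_ok_iff in H as (B1 & a & b & B2 & -> & S & H1 & H2).
  apply PL in H1 as [H1 E1], H2 as [H2 E2]. simpl in S. bools. subst.
  rewrite !map_app, !filter_app, !length_app. simpl. rewrite alive_false by lia. simpl. split; [|lia].
  rewrite Forall_eq_repeat with (x := 0) at 1; [now rewrite length_app|].
  apply Forall_app; split; auto.
Qed.

Lemma seg_end B : seg_ok OEnd B ->
  al (ins B) = [] /\ length (al (outs B)) = length B /\
  S (length (filter (fun a => negb (a =? K + 2)) (ins B))) = length B.
Proof.
  intros H. assert (PL : forall B, Forall (plain OEnd) B ->
     al (ins B) = [] /\ al (outs B) = outs B /\ filter (fun a => negb (a =? K + 2)) (ins B) = ins B).
  { clear B H. induction 1 as [|[a b] B [_ H] _ (IH1 & IH2 & IH3)]; simpl; auto.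
    simpl in H. bools; subst. rewrite alive_false, alive_true by lia. simpl.
    destruct (Nat.eqb_spec (K + 1) (K + 2)); [lia|]. simpl. rewrite IH1, IH2, IH3. auto. }
  apply seg_ok_iff in H as (B1 & a & b & B2 & -> & S & H1 & H2).
  apply PL in H1 as (E1 & E2 & E3), H2 as (E4 & E5 & E6). simpl in S. bools. subst.
  rewrite !map_app, !filter_app, !length_app. simpl. rewrite alive_false, alive_true, Nat.eqb_refl by lia. simpl.
  rewrite E1, E2, E3, E4, E5, E6, !length_map. repeat split; lia.
Qed.

(* Inserted tokens can only slow the countdown of alive tokens: a round that starts with
   exactly [N] alive tokens and ends with fewer must be an exact run of the machine. *)
Theorem good_of_blocks (c q : nat -> nat) (B : nat -> list (nat * nat)) :
  (forall j, prev (q j) (c j) = Some (q (S j))) ->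
  (forall j, seg_ok (opf (c j)) (B j)) ->
  (forall j, subseq (outs (B j)) (ins (B (S j)))) ->
  c 0 = 1 -> (forall j, exists j', j < j' /\ c j' = 1) ->
  forall N, 1 <= N -> good N.
Proof.
  intros Hq Hs Hsub H0 Hinf N HN. apply NNPP. intros NG.
  assert (T1 : forall j, length (B j) <= length (B (S j))).
  { intros j. specialize (Hsub j). apply subseq_length in Hsub. now rewrite !length_map in Hsub. }
  (* The old tokens embed into the inputs other than the fresh one, so an [OEnd] block is strictly
     longer than its predecessor. *)
  assert (T2 : forall j, c (S j) = 1 -> length (B j) < length (B (S j))).
  { intros j E. pose proof (Hs (S j)) as H. rewrite E, Hop1 in H. apply seg_end in H as (_ & _ & H).
    specialize (Hsub j). apply (subseq_filter _ (fun a => negb (a =? K + 2))) in Hsub.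
    apply subseq_length in Hsub. rewrite filter_all in Hsub; [rewrite length_map in Hsub; lia|].
    eapply Forall_impl; [|exact (seg_out_le _ _ (Hs j))]. intros b Hb. cbv beta in *.
    apply negb_true_iff, Nat.eqb_neq. lia. }
  assert (T3 : forall i j, i <= j -> length (B i) <= length (B j)).
  { intros i j H. induction H as [|m H IH]; auto. specialize (T1 m). lia. }
  assert (TN : forall n, exists j, c j = 1 /\ n <= length (B j)).
  { induction n as [|n (j & E & L)]; [exists 0; split; auto; lia|].
    destruct (Hinf j) as (j' & Hj & E'). exists j'. split; auto.
    destruct j' as [|j']; [lia|]. specialize (T2 j' E'). specialize (T3 j j'). lia. }
  (* After an [OEnd] block with at least [N] tokens there is no further [OEnd] block, which
     contradicts [Hinf]. *)
  destruct (TN N) as (j0 & E0 & L0).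
  assert (INV : forall d, N <= length (al (outs (B (j0 + d)))) /\
     (length (al (outs (B (j0 + d)))) = N -> exists w, msteps (q (S (j0 + d)), al (outs (B (j0 + d)))) (goal, w)) /\
     (0 < d -> c (j0 + d) <> 1)).
  { induction d as [|d (I1 & I2 & _)].
    - rewrite Nat.add_0_r. pose proof (Hs j0) as H. rewrite E0, Hop1 in H. apply seg_end in H as (_ & H & _).
      repeat split; [lia| |lia]. intros _. specialize (Hq j0). rewrite E0 in Hq. apply Hprev1 in Hq as [_ ->].
      eexists. constructor.
    - rewrite Nat.add_succ_r. set (j := j0 + d) in *. clearbody j.
      pose proof (Hs (S j)) as HS. pose proof (Hq (S j)) as HQ. pose proof (Hsub j) as HB.
      apply (subseq_filter _ (alive K)) in HB. pose proof (subseq_length _ _ _ HB) as HL.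
      (* With only [N] alive inputs no alive token was inserted: the embedding is an equality, and
         the run collected so far continues. *)
      assert (EX : length (al (ins (B (S j)))) = N -> al (outs (B j)) = al (ins (B (S j))) /\
         exists w, msteps (q (S j), al (ins (B (S j)))) (goal, w)).
      { intros E. assert (EQ : al (outs (B j)) = al (ins (B (S j)))) by (apply subseq_eq; auto; lia).
        split; auto. rewrite <- EQ. apply I2. rewrite EQ. exact E. }
      pose proof (Hop (c (S j))) as HO. destruct (opf (c (S j))) as [| |x y|x] eqn:EO.
      + apply seg_restart in HS as [S1 S2]. rewrite HO in HQ. apply Hprev0 in HQ as [Q1 Q2].
        (* Exactly [N] alive inputs would all be free at the start label, so the collected run would
           witness [good N]. Hence more than [N] enter and at least [N] survive. *)
        assert (length (al (ins (B (S j)))) <> N).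
        { intros E. destruct (EX E) as [_ (w & M)]. apply NG. exists w. rewrite <- E, <- S1, <- Q1. exact M. }
        rewrite HO, Q2. repeat split; [lia| |lia]. intros _. eexists; constructor.
      (* An [OEnd] block has no alive input, but at least [N >= 1] alive tokens must be copied into
         it. *)
      + apply seg_end in HS as [S1 _]. rewrite S1 in HL. simpl in HL. lia.
      + destruct HO as (Hx & Hy & Hxy). apply seg_move in HS as (u & v & S1 & S2); auto.
        rewrite S1, S2, !length_app in *. simpl in *. repeat split; [lia| |].
        * intros E. destruct EX as [_ (w & M)]; [lia|]. exists w.
          eapply ms_step; [|exact M]. exists (c (S j)). split; auto. rewrite EO. eauto.
        * intros _ E. rewrite E, Hop1 in EO. discriminate.
      + apply seg_zero in HS as [S1 S2]. rewrite <- S1 in *. repeat split; [lia| |].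
        * intros E. destruct EX as [_ (w & M)]; [lia|]. exists w.
          eapply ms_step; [|exact M]. exists (c (S j)). split; auto. rewrite EO. auto.
        * intros _ E. rewrite E, Hop1 in EO. discriminate. }
  destruct (Hinf j0) as (j' & Hj & E'). destruct (INV (j' - j0)) as (_ & _ & X).
  apply X; [lia|]. now replace (j0 + (j' - j0)) with j' by lia.
Qed.

(** * From runs of the machine to block sequences *)

Definition bstep (x : nat * list nat) (b : nat * list (nat * nat)) (y : nat * list nat) : Prop :=
  prev (fst x) (fst b) = Some (fst y) /\ seg_ok (opf (fst b)) (snd b) /\
  (exists ext, ins (snd b) = snd x ++ ext) /\ outs (snd b) = snd y.

Inductive bpath : nat -> nat * list nat -> nat * list nat -> Prop :=
| bp_nil : forall x, bpath 0 x x
| bp_cons : forall n x b y z, bstep x b y -> bpath n y z -> bpath (S n) x z.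

Lemma bpath_app n m x y z : bpath n x y -> bpath m y z -> bpath (n + m) x z.
Proof. induction 1; simpl; auto. intros. econstructor; eauto. Qed.

Lemma bpath_snoc n x y b z : bpath n x y -> bstep y b z -> bpath (n + 1) x z.
Proof. intros H1 H2. eapply bpath_app; eauto. econstructor; eauto. constructor. Qed.

Definition same (l : list nat) : list (nat * nat) := map (fun a => (a, a)) l.

Lemma ins_same l : ins (same l) = l.
Proof. unfold same. rewrite map_map. apply map_id. Qed.
Lemma outs_same l : outs (same l) = l.
Proof. unfold same. rewrite map_map. apply map_id. Qed.

Lemma plain_same o l : match o with
   | OMove x y => x <> y /\ Forall (fun a => a <= K + 1) l
   | OZero x => ~ In x l /\ Forall (fun a => a <= K + 1) l
   | _ => False end -> Forall (plain o) (same l).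
Proof.
  intros H. apply Forall_forall. intros [a b] HI. apply in_map_iff in HI as (a' & [= -> ->] & HI).
  destruct o as [| |x y|x]; try easy; destruct H as [H1 H2]; rewrite Forall_forall in H2;
    specialize (H2 _ HI); apply Nat.leb_le in H2; split; simpl.
  - apply andb_false_iff. destruct (Nat.eq_dec b y) as [->|]; [right|left]; apply Nat.eqb_neq; auto.
  - now rewrite Nat.eqb_refl, H2.
  - reflexivity.
  - rewrite Nat.eqb_refl, H2. simpl. apply negb_true_iff, Nat.eqb_neq. intros ->. auto.
Qed.

Definition alive_list (w : list nat) : Prop := Forall (fun a => a <= K) w.

Lemma mstep_alive x y : mstep x y -> alive_list (snd x) -> alive_list (snd y) /\ length (snd y) = length (snd x).
Proof.
  destruct x as [p w], y as [q w']. intros (i & _ & H). simpl. unfold alive_list.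
  specialize (Hop i). destruct (opf i) as [| |a b|a]; try easy.
  - destruct H as (u & v & -> & ->). rewrite !Forall_app, !length_app. simpl.
    intros [F1 F2]. inversion F2; subst. split; [split; auto; constructor; auto; lia|lia].
  - destruct H as [_ ->]. auto.
Qed.

Lemma msteps_alive x y : msteps x y -> alive_list (snd x) -> alive_list (snd y) /\ length (snd y) = length (snd x).
Proof.
  induction 1 as [|x y z H1 _ IH]; intros H; auto.
  apply mstep_alive in H1 as [H1 E]; auto. destruct (IH H1) as [H2 E2]. split; auto; lia.
Qed.

(** Blocks read the run backwards, whence the exchange of [x] and [y]. The [j] tokens in front died
    in earlier rounds and are merely copied. *)
Lemma msteps_bpath j x y : msteps x y -> alive_list (snd x) ->
  exists n, bpath n (fst y, repeat (K + 1) j ++ snd y) (fst x, repeat (K + 1) j ++ snd x).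
Proof.
  assert (DL : Forall (fun a => a <= K + 1) (repeat (K + 1) j)).
  { apply Forall_forall. intros a Ha. apply repeat_spec in Ha. lia. }
  assert (AL : forall w, alive_list w -> Forall (fun a => a <= K + 1) w).
  { intros w. apply Forall_impl. intros; lia. }
  induction 1 as [x|x y z H1 H2 IH]; intros H.
  - exists 0. constructor.
  - pose proof (mstep_alive _ _ H1 H) as [Hy _]. destruct (IH Hy) as (n & Hn).
    destruct x as [p w], y as [q w']. simpl in *. destruct H1 as (i & Hp & H1).
    exists (n + 1). specialize (Hop i). destruct (opf i) as [| |a b|a] eqn:EO; try easy.
    + destruct H1 as (u & v & -> & ->).
      apply Forall_app in H as [F1 F2]. inversion F2; subst.
      eapply bpath_snoc with (b := (i, same (repeat (K + 1) j ++ u) ++ (b, a) :: same v)); [exact Hn|].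
      split; [exact Hp|]. split; [|split].
      * simpl. apply seg_ok_iff. rewrite EO. simpl.
        exists (same (repeat (K + 1) j ++ u)), b, a, (same v).
        rewrite !Nat.eqb_refl. repeat split; apply plain_same; (split; [tauto|]); auto.
        apply Forall_app; auto.
      * exists []. simpl. rewrite app_nil_r, map_app. simpl. rewrite !ins_same, <- app_assoc. reflexivity.
      * simpl. rewrite map_app. simpl. rewrite !outs_same, <- app_assoc. reflexivity.
    + destruct H1 as [NI ->].
      eapply bpath_snoc with (b := (i, same (repeat (K + 1) j ++ w))); [exact Hn|].
      split; [exact Hp|]. split; [|split].
      * simpl. apply seg_ok_iff. rewrite EO. apply plain_same. split; [|apply Forall_app; auto].
        intros X. apply in_app_or in X as [X|X]; [|auto]. apply repeat_spec in X. lia.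
      * exists []. simpl. now rewrite app_nil_r, ins_same.
      * simpl. now rewrite outs_same.
Qed.

Lemma Forall_plain_combine o l l' : (forall a b, In a l -> In b l' -> plain o (a, b)) ->
  Forall (plain o) (combine l l').
Proof.
  intros H. apply Forall_forall. intros [a b] HI. apply H.
  - eapply in_combine_l; eauto.
  - eapply in_combine_r; eauto.
Qed.

Lemma ins_combine l l' : length l = length l' -> ins (combine l l') = l.
Proof. revert l'. induction l; intros [|b l']; simpl; intros; try easy. f_equal. auto. Qed.
Lemma outs_combine l l' : length l = length l' -> outs (combine l l') = l'.
Proof. revert l'. induction l; intros [|b l']; simpl; intros; try easy. f_equal. auto. Qed.

Hypothesis all_good : forall N, 1 <= N -> good N.

(** [N = 0] is included for the restart at which the last alive token dies: no run follows it. *)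
Lemma good_alive N : exists w, alive_list w /\ length w = N /\
  (1 <= N -> msteps (start, repeat 0 N) (goal, w)).
Proof.
  destruct N as [|N]; [exists []; repeat split; [constructor|lia]|].
  destruct (all_good (S N)) as (w & H); [lia|]. exists w.
  apply msteps_alive in H as X; [|apply Forall_forall; intros a Ha; apply repeat_spec in Ha; simpl in *; lia].
  destruct X as [X1 X2]. cbn [snd] in X1, X2. rewrite repeat_length in X2. auto.
Qed.

(** Induction on the alive tokens. After the reversed run all of them are free; the restart kills
    the first one, which joins the dead prefix, and gives the others the colours of the final
    configuration [w'] of the run with one token less. *)
Lemma rounds_bpath N : forall j w, alive_list w -> length w = N ->
  (1 <= N -> msteps (start, repeat 0 N) (goal, w)) ->
  exists n, bpath n (goal, repeat (K + 1) j ++ w) (goal, repeat (K + 1) (j + N)).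
Proof.
  induction N as [|N IH]; intros j w Hw HL HM.
  - destruct w; [|discriminate]. exists 0. rewrite app_nil_r, Nat.add_0_r. constructor.
  - apply msteps_bpath with (j := j) in HM; [|lia|];
      [|apply Forall_forall; intros a Ha; apply repeat_spec in Ha; simpl in *; lia].
    destruct HM as (n1 & H1). simpl fst in H1. simpl snd in H1.
    destruct (good_alive N) as (w' & A1 & A2 & A3).
    destruct (IH (S j) w' A1 A2 A3) as (n2 & H2).
    exists (n1 + 1 + n2). replace (j + S N) with (S j + N) by lia. apply bpath_app with (goal, repeat (K + 1) (S j) ++ w').
    2: { exact H2. }
    eapply bpath_snoc; [exact H1|].
    instantiate (1 := (0, same (repeat (K + 1) j) ++ (0, K + 1) :: combine (repeat 0 N) w')).
    split; [now apply Hprev0|]. split; [|split].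
    + simpl. rewrite Hop0. apply seg_ok_iff.
      exists (same (repeat (K + 1) j)), 0, (K + 1), (combine (repeat 0 N) w').
      simpl. rewrite Nat.eqb_refl. repeat split.
      * apply Forall_forall. intros [a b] HI. apply in_map_iff in HI as (a' & [= -> ->] & HI).
        apply repeat_spec in HI. subst. split; simpl; rewrite ?Nat.eqb_refl.
        -- destruct (Nat.eqb_spec (K + 1) 0); auto; lia.
        -- apply orb_true_r.
      * apply Forall_plain_combine. intros a b Ha Hb. apply repeat_spec in Ha. subst.
        unfold alive_list in A1. rewrite Forall_forall in A1. apply A1 in Hb. split; simpl.
        -- apply Nat.eqb_neq. lia.
        -- rewrite alive_true; auto.
    + exists []. simpl. rewrite app_nil_r, map_app. simpl. rewrite ins_same, ins_combine by (rewrite repeat_length; auto).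
      reflexivity.
    + simpl. rewrite map_app. simpl. rewrite outs_same, outs_combine by (rewrite repeat_length; auto).
      rewrite app_comm_cons, repeat_cons, <- app_assoc. reflexivity.
Qed.

Lemma phase_bpath n : exists b x m, fst b = 1 /\ bstep (goal, repeat (K + 1) n) b x /\
  bpath m x (goal, repeat (K + 1) (S n)).
Proof.
  destruct (good_alive (S n)) as (w & A1 & A2 & A3).
  destruct (rounds_bpath (S n) 0 w A1 A2 A3) as (m & H). simpl app in H.
  (* The fresh token stands last, so it receives the last colour of [w]; the [n] revived tokens
     receive the others. *)
  destruct (@exists_last _ w) as (w1 & y & Ew); [intros ->; discriminate|].
  exists (1, combine (repeat (K + 1) n) w1 ++ [(K + 2, y)]), (goal, w), m.
  unfold alive_list in A1. rewrite Forall_forall in A1. subst w. rewrite length_app in A2. simpl in A2.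
  repeat split; auto.
  - now apply Hprev1.
  - simpl. rewrite Hop1. apply seg_ok_iff.
    exists (combine (repeat (K + 1) n) w1), (K + 2), y, [].
    simpl. rewrite Nat.eqb_refl, alive_true by (apply A1, in_or_app; right; now left).
    repeat split; auto.
    apply Forall_plain_combine. intros a b Ha Hb. apply repeat_spec in Ha. subst.
    split; simpl.
    + destruct (Nat.eqb_spec (K + 1) (K + 2)); [lia|auto].
    + rewrite Nat.eqb_refl, alive_true; auto. apply A1, in_or_app. now left.
  - exists [K + 2]. simpl. rewrite map_app, ins_combine by (rewrite repeat_length; lia). reflexivity.
  - simpl. rewrite map_app, outs_combine by (rewrite repeat_length; lia). reflexivity.
Qed.

(** A live state carries the number of blocks left until all tokens are dead. This number decreases,
    and at 0 the next block is an [OEnd], so such blocks occur infinitely often. *)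
Theorem blocks_of_good : exists (c q : nat -> nat) (B : nat -> list (nat * nat)),
  (forall j, prev (q j) (c j) = Some (q (S j))) /\
  (forall j, seg_ok (opf (c j)) (B j)) /\
  (forall j, exists ext, ins (B (S j)) = outs (B j) ++ ext) /\
  c 0 = 1 /\ q 0 = goal /\ (forall j, exists j', j < j' /\ c j' = 1).
Proof.
  pose (live := fun s : (nat * list nat) * nat => exists n, bpath (snd s) (fst s) (goal, repeat (K + 1) n)).
  assert (NEXT : forall s : sig live, exists r : (nat * list (nat * nat)) * sig live,
     bstep (fst (proj1_sig s)) (fst r) (fst (proj1_sig (snd r))) /\
     (snd (proj1_sig s) = 0 -> fst (fst r) = 1) /\
     (snd (proj1_sig s) <> 0 -> snd (proj1_sig (snd r)) < snd (proj1_sig s))).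
  { intros [[x m] (n & Hn)]. simpl in Hn. inversion Hn as [|m' ? b y ? H1 H2]; subst.
    - destruct (phase_bpath n) as (b & y & m' & E & H1 & H2).
      exists (b, exist _ (y, m') (ex_intro _ _ H2)). simpl. repeat split; auto; tauto || apply H1.
    - exists (b, exist _ (y, m') (ex_intro _ _ H2)). simpl. repeat split; auto; try lia; apply H1. }
  pose (nx := fun s => proj1_sig (constructive_indefinite_description _ (NEXT s))).
  assert (NX : forall s, bstep (fst (proj1_sig s)) (fst (nx s)) (fst (proj1_sig (snd (nx s)))) /\
     (snd (proj1_sig s) = 0 -> fst (fst (nx s)) = 1) /\
     (snd (proj1_sig s) <> 0 -> snd (proj1_sig (snd (nx s))) < snd (proj1_sig s))).
  { intros s. unfold nx. destruct (constructive_indefinite_description _ _). auto. }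
  assert (L0 : live ((goal, []), 0)) by (exists 0; constructor).
  pose (sq := fix sq j : sig live := match j with O => exist _ _ L0 | S j => snd (nx (sq j)) end).
  exists (fun j => fst (fst (nx (sq j)))), (fun j => fst (fst (proj1_sig (sq j)))), (fun j => snd (fst (nx (sq j)))).
  split; [|split; [|split; [|split; [|split]]]].
  - intros j. destruct (NX (sq j)) as [[H _] _]. exact H.
  - intros j. destruct (NX (sq j)) as [(_ & H & _) _]. exact H.
  - intros j. destruct (NX (sq j)) as [(_ & _ & _ & H) _].
    destruct (NX (sq (S j))) as [(_ & _ & (ext & H') & _) _]. exists ext. rewrite H', H. reflexivity.
  - apply (NX (sq 0)). reflexivity.
  - reflexivity.
  - assert (X : forall m j, snd (proj1_sig (sq j)) <= m -> exists j', j <= j' /\ fst (fst (nx (sq j'))) = 1).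
    { induction m as [|m IH]; intros j Hj.
      - exists j. split; auto. apply NX. lia.
      - destruct (Nat.eq_dec (snd (proj1_sig (sq j))) 0) as [E|E].
        + exists j. split; auto. now apply NX.
        + destruct (IH (S j)) as (j' & H1 & H2).
          * destruct (NX (sq j)) as (_ & _ & H). specialize (H E). simpl. lia.
          * exists j'. split; auto; lia. }
    intros j. destruct (X _ (S j) (Nat.le_refl _)) as (j' & H1 & H2). exists j'. split; auto.
Qed.

End Blocks.

(** * Words and block sequences *)

Definition toks (l : list letter) : list (nat * nat) :=
  flat_map (fun x => match x with Tok a b => [(a, b)] | _ => [] end) l.

Lemma fold_toks K o l s : Forall (fun x => is_ctl x = false) l ->
  fold_left (seg_step K o) l s = fold_left (seg_step K o) (tok_letters (toks l)) s.
Proof.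
  intros H. revert s. induction H as [|x l Hx H IH]; intros s; auto.
  destruct x as [|a b|i]; simpl; try discriminate; auto.
  rewrite IH. destruct s; reflexivity.
Qed.

Lemma is_sep_class l : (class_in l =? 1) = is_sep l /\ (class_out l =? 1) = is_sep l.
Proof. destruct l; simpl; auto. split; apply Nat.eqb_neq; lia. Qed.

Lemma subseq_toks_from (w : nat -> letter) m e : forall s l,
  subseq l (map fst (toks (map w (seq (s + e) (m - (s + e)))))) ->
  s + e <= m -> subseq l (map fst (toks (map w (seq s (m - s))))).
Proof.
  induction e as [|e IH]; intros s l H Hs; [now rewrite Nat.add_0_r in H|].
  replace (m - s) with (S (m - S s)) by lia. cbn [seq map].
  assert (G : subseq l (map fst (toks (map w (seq (S s) (m - S s)))))).
  { apply IH; [|lia]. now replace (S s + e) with (s + S e) by lia. }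
  destruct (w s); simpl; auto. now constructor.
Qed.

Section Translation.
Variables (P : list instr) (K U c : nat).
Hypothesis Kpos : 1 <= K.
Hypothesis HU1 : 20 + 7 * length P <= U.
Hypothesis HU2 : (K + 5) * (K + 5) <= U.

Notation opf := (opof P).
Notation prev := (lab_prev P U c).
Notation ins := (map (@fst nat nat)).
Notation outs := (map (@snd nat nat)).

Lemma lab_prev1 q p : prev q 1 = Some p <-> q = goal U /\ p = goal U.
Proof.
  cbn. destruct (Nat.eqb_spec q (goal U)); split; try discriminate.
  - intros [= <-]. auto.
  - intros [_ ->]. auto.
  - tauto.
Qed.

(** * From a word satisfying the specification to blocks *)

Section FromWord.
Variables (a : nat -> nat) (t : nat -> R).
Hypothesis t_incr : forall k, (t k < t (S k))%R.
Hypothesis spec : word_spec P K U c a t.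
Let w (k : nat) : letter := dec_letter K U (a k).

Theorem blocks_of_word : exists (cc q : nat -> nat) (B : nat -> list (nat * nat)),
  (forall j, prev (q j) (cc j) = Some (q (S j))) /\
  (forall j, seg_ok K (opf (cc j)) (B j)) /\
  (forall j, subseq (outs (B j)) (ins (B (S j)))) /\
  cc 0 = 1 /\ (forall j, exists j', j < j' /\ cc j' = 1).
Proof.
  destruct spec as [S1 _ S3 _ S5 S6 S7 S8].
  pose (f := fun k => proj1_sig (constructive_indefinite_description _ (S5 k))).
  assert (F : forall k, k < f k /\ (t (f k) <= t k + 1 < t (S (f k)))%R /\
     class_in (w (f k)) = class_out (w k) /\ (is_ctl (w k) = true -> no_ctl_between K U a k (f k))).
  { intros k. unfold f. destruct (constructive_indefinite_description _ _). auto. }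
  assert (Todd : forall k, Nat.odd (f k) = Nat.odd k).
  { intros k. destruct (F k) as (_ & _ & E & _). rewrite <- !S3. fold (w k) (w (f k)).
    destruct (is_sep_class (w k)) as [_ <-]. destruct (is_sep_class (w (f k))) as [<- _]. now rewrite E. }
  assert (Tm : forall i j, i < j -> (t i < t j)%R).
  { intros i j H. induction H as [|j H IH]; [apply t_incr|].
    eapply Rlt_trans; [exact IH|apply t_incr]. }
  (* The separators alternate with the other letters, so consecutive letters have distinct copies. *)
  assert (Fm1 : forall k, f k < f (S k)).
  { intros k. destruct (Nat.lt_trichotomy (f k) (f (S k))) as [|[E|E]]; auto; exfalso.
    - pose proof (Todd (S k)) as O. rewrite <- E, Todd, Nat.odd_succ, <- Nat.negb_odd in O.
      destruct (Nat.odd k); discriminate.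
    - destruct (F k) as (_ & [F1 _] & _), (F (S k)) as (_ & [_ F2] & _). pose proof (t_incr k).
      destruct (Nat.eq_dec (f k) (S (f (S k)))) as [E'|]; [rewrite E' in F1; lra|].
      specialize (Tm (S (f (S k))) (f k)). assert (t (S (f (S k))) < t (f k))%R by (apply Tm; lia). lra. }
  assert (Fm : forall i j, i < j -> f i < f j).
  { intros i j H. induction H as [|j H IH]; auto. specialize (Fm1 j). lia. }
  (* The copy of a control letter is the next control letter, so the block starts are the iterates
     of the copying map [f] at 0. *)
  pose (kk := fix kk j := match j with O => 0 | S j => f (kk j) end).
  assert (KC : forall j, is_ctl (w (kk j)) = true).
  { induction j as [|j IH].
    - unfold w. simpl kk. rewrite S1. rewrite (dec_letter_not_ctl P K U Kpos HU1 HU2) by auto. apply Nat.leb_le. lia.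
    - simpl kk. destruct (F (kk j)) as (_ & _ & E & _). destruct (class_ctl (w (f (kk j)))) as [<- _].
      rewrite E. destruct (class_ctl (w (kk j))) as [_ ->]. exact IH. }
  assert (KN : forall j, no_ctl_between K U a (kk j) (kk (S j))).
  { intros j. destruct (F (kk j)) as (_ & _ & _ & X). apply X, KC. }
  assert (KS : forall j, kk j < kk (S j)) by (intros j; apply (F (kk j))).
  assert (KM : forall i j, i <= j -> kk i <= kk j).
  { intros i j H. induction H as [|j H IH]; auto. specialize (KS j). lia. }
  assert (KE : forall m, is_ctl (w m) = true -> exists j, m = kk j).
  { intros m Hm. assert (X : forall j, m < kk j -> exists j', m = kk j').
    { induction j as [|j IH]; simpl; [lia|]. intros H.
      destruct (Nat.lt_trichotomy m (kk j)) as [H'|[H'|H']]; eauto.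
      exfalso. assert (is_ctl (w m) = false) by (apply (KN j); simpl; lia). congruence. }
    apply X with (S m). assert (Y : forall j, j <= kk j).
    { induction j; [lia|]. specialize (KS j). lia. }
    specialize (Y (S m)). lia. }
  destruct S6 as (lb & L1 & L2).
  pose (lets := fun j => map w (seq (S (kk j)) (kk (S j) - S (kk j)))).
  assert (LN : forall j, Forall (fun x => is_ctl x = false) (lets j)).
  { intros j. apply Forall_forall. intros x Hx. apply in_map_iff in Hx as (m & <- & Hm).
    apply in_seq in Hm. apply (KN j). lia. }
  assert (KW : forall j, U <= a (kk j)).
  { intros j. specialize (KC j). unfold w in KC. rewrite (dec_letter_not_ctl P K U Kpos HU1 HU2) in KC by auto. now apply Nat.leb_le. }
  (* No label is attached to event 0; [goal] is the only value that the first [OEnd] admits. *)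
  exists (fun j => a (kk j) - U), (fun j => match j with O => goal U | _ => lb (kk j) end), (fun j => toks (lets j)).
  split; [|split; [|split; [|split]]].
  (* Only control letters change the label, so it is constant inside a block. *)
  - assert (LC : forall j m, kk j < m <= kk (S j) -> lb m = lb (S (kk j))).
    { intros j m [H1 H2]. induction H1 as [|m H1 IH]; auto.
      assert (E : is_ctl (w m) = false) by (apply (KN j); lia).
      unfold w in E. rewrite (dec_letter_not_ctl P K U Kpos HU1 HU2) in E by auto. apply Nat.leb_gt in E.
      specialize (L2 m ltac:(lia)). unfold lab_next in L2.
      destruct (Nat.ltb_spec (a m) U); [|lia]. injection L2 as <-. apply IH. lia. }
    intros j. rewrite (LC j (kk (S j))) by (specialize (KS j); lia). destruct j as [|j].
    + simpl kk. rewrite S1, L1. replace (U + 1 - U) with 1 by lia. now apply lab_prev1.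
    + specialize (L2 (kk (S j))). specialize (KS j) as X. specialize (L2 ltac:(lia)).
      unfold lab_next in L2. specialize (KW (S j)).
      destruct (Nat.ltb_spec (a (kk (S j))) U); [lia|]. exact L2.
  - intros j. unfold seg_ok. rewrite <- fold_toks by apply LN.
    assert (EW : dec_letter K U (a (kk j)) = Ctl (a (kk j) - U)).
    { apply (dec_letter_ctl P K U Kpos HU1 HU2); auto. specialize (KW j). lia. }
    exact (S7 (kk j) (kk (S j)) _ EW (KS j) (KN j) (KC (S j))).
  - intros j. unfold lets.
    pose (m := kk (S j)). pose (m2 := kk (S (S j))).
    (* Induction on the number [d] of letters left in the block: [f] is strictly increasing and
       respects classes, so their tokens embed into what follows from [f i] on. *)
    assert (X : forall d i, i + d = m -> kk j < i ->
       subseq (outs (toks (map w (seq i d)))) (ins (toks (map w (seq (f i) (m2 - f i)))))).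
    { induction d as [|d IH]; intros i Hd Hi; [constructor|].
      assert (H1 : f i < m2) by (apply (Fm i m); lia).
      assert (Hd' : S i + d = m) by (rewrite <- Hd; lia).
      specialize (IH (S i) Hd' (Nat.lt_lt_succ_r _ _ Hi)). specialize (Fm1 i).
      replace (m2 - f i) with (S (m2 - S (f i))) by lia. cbn [seq map].
      assert (Y : subseq (outs (toks (map w (seq (S i) d)))) (ins (toks (map w (seq (S (f i)) (m2 - S (f i))))))).
      { apply subseq_toks_from with (e := f (S i) - S (f i)); replace (S (f i) + (f (S i) - S (f i))) with (f (S i)) by lia; auto.
        destruct (Nat.eq_dec (S i) m) as [->|]; [apply Nat.le_refl|]. apply Nat.lt_le_incl, (Fm (S i) m). lia. }
      destruct (F i) as (_ & _ & E & _). destruct (w i) as [|x y|z], (w (f i)) as [|x' y'|z']; simpl in E; try lia; simpl; auto.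
      assert (x' = y) by lia. subst. now constructor. }
    specialize (X (kk (S j) - S (kk j)) (S (kk j))).
    assert (Y : subseq (outs (toks (map w (seq (S (kk j)) (kk (S j) - S (kk j))))))
       (ins (toks (map w (seq (f (S (kk j))) (m2 - f (S (kk j)))))))).
    { apply X; [unfold m; specialize (KS j); lia|lia]. }
    (* The copies of the letters inside block [j] come after the copy [m] of its control letter,
       hence inside block [S j]. *)
    assert (G1 : S m <= f (S (kk j))) by (unfold m; simpl; apply Fm; lia).
    assert (G2 : f (S (kk j)) <= m2).
    { unfold m2. simpl. specialize (KS j). simpl in KS.
      destruct (Nat.eq_dec (S (kk j)) (f (kk j))) as [<-|]; auto. apply Nat.lt_le_incl, Fm. lia. }
    apply (subseq_toks_from w m2 (f (S (kk j)) - S m) (S m)); replace (S m + (f (S (kk j)) - S m)) with (f (S (kk j))) by lia; auto.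
  - simpl kk. rewrite S1. lia.
  - intros j. destruct (S8 (kk j)) as (m & H1 & H2).
    destruct (KE m) as (j' & ->).
    { unfold w. rewrite (dec_letter_not_ctl P K U Kpos HU1 HU2), H2 by auto. apply Nat.leb_le. lia. }
    exists j'. split; [|lia]. destruct (Nat.lt_ge_cases j j') as [|H]; auto.
    apply KM in H. lia.
Qed.

End FromWord.

(** * From block sequences to a non-Zeno timed word *)

Section ToWord.
Variables (cc q : nat -> nat) (B : nat -> list (nat * nat)).
Hypothesis Hq : forall j, prev (q j) (cc j) = Some (q (S j)).
Hypothesis Hseg : forall j, seg_ok K (opf (cc j)) (B j).
Hypothesis Hext : forall j, exists ext, ins (B (S j)) = outs (B j) ++ ext.
Hypothesis Hc0 : cc 0 = 1.
Hypothesis Hinf : forall j, exists j', j < j' /\ cc j' = 1.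
Hypothesis Hop : forall i, match opf i with
  | ORestart => i = 0
  | OEnd => i = 1
  | OMove x y => x <= K /\ y <= K /\ x <> y
  | OZero x => x <= K
  end.

(** A block reads [Ctl], [Sep], and then [Tok], [Sep] for each token: separators stand at the odd
    offsets, and the even length continues the alternation across blocks. *)
Definition blen (j : nat) : nat := 2 * (length (B j) + 1).

Fixpoint boff (j : nat) : nat := match j with O => 0 | S j => boff j + blen j end.

Fixpoint bpos (k : nat) : nat * nat :=
  match k with
  | O => (0, 0)
  | S k => let '(j, i) := bpos k in if S i <? blen j then (j, S i) else (S j, 0)
  end.

Definition bletter (ji : nat * nat) : letter :=
  match snd ji with
  | 0 => Ctl (cc (fst ji))
  | _ => if Nat.odd (snd ji) then Sep
         else let ab := nth (snd ji / 2 - 1) (B (fst ji)) (0, 0) in Tok (fst ab) (snd ab)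
  end.

Definition bword (k : nat) : nat := enc_letter K U (bletter (bpos k)).

(* The [i]-th event of every block has the same fractional part [i / (i + 1)], whatever the block length. *)
Definition btime (k : nat) : R :=
  (INR (fst (bpos k)) + INR (snd (bpos k)) / (INR (snd (bpos k)) + 1))%R.

Lemma blen_pos j : 0 < blen j. Proof. unfold blen. lia. Qed.

Lemma bpos_off j : forall i, i < blen j -> bpos (boff j + i) = (j, i).
Proof.
  induction j as [|j IHj]; induction i as [|i IHi]; intros Hi.
  - reflexivity.
  - rewrite Nat.add_succ_r. simpl. simpl in IHi. rewrite IHi by lia. simpl in Hi.
    destruct (Nat.ltb_spec (S i) (blen 0)); [reflexivity|lia].
  - cbn [boff]. rewrite Nat.add_0_r. pose proof (blen_pos j).
    replace (boff j + blen j) with (S (boff j + (blen j - 1))) by lia.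
    simpl. rewrite IHj by lia. destruct (Nat.ltb_spec (S (blen j - 1)) (blen j)); [lia|reflexivity].
  - rewrite Nat.add_succ_r. simpl in *. rewrite IHi by lia.
    destruct (Nat.ltb_spec (S i) (blen (S j))); [reflexivity|lia].
Qed.

Lemma bpos_spec k : snd (bpos k) < blen (fst (bpos k)) /\ k = boff (fst (bpos k)) + snd (bpos k).
Proof.
  induction k as [|k [IH1 IH2]]; [split; [apply blen_pos|reflexivity]|].
  simpl. destruct (bpos k) as [j i]. simpl in *.
  destruct (Nat.ltb_spec (S i) (blen j)); simpl; [lia|]. split; [apply blen_pos|lia].
Qed.

Lemma boff_incr i j : i < j -> boff i < boff j.
Proof.
  intros H. induction H as [|j H IH]; simpl; [pose proof (blen_pos i)|pose proof (blen_pos j)]; lia.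
Qed.

Lemma blen_mono j : blen j <= blen (S j).
Proof.
  destruct (Hext j) as (ext & E). apply (f_equal (@length nat)) in E.
  rewrite length_app, !length_map in E. unfold blen. lia.
Qed.

Lemma cc_lt j : cc j < nctl P.
Proof.
  pose proof (Hq j) as H. destruct (Nat.lt_ge_cases (cc j) (nctl P)) as [|G]; auto. exfalso.
  unfold nctl in G. destruct (cc j) as [|[|[|[|i]]]]; try lia. cbn [lab_prev] in H. unfold lab_prog in H.
  assert (E : nth_error P (i / 3) = None).
  { apply nth_error_None. apply Nat.div_le_lower_bound; lia. }
  rewrite E in H. discriminate.
Qed.

Lemma tok_bounds j p : p < length (B j) ->
  fst (nth p (B j) (0, 0)) < ncol K /\ snd (nth p (B j) (0, 0)) < ncol K.
Proof.
  intros Hp. pose proof (Hseg j) as H. apply seg_ok_iff in H. specialize (Hop (cc j)).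
  assert (PL : forall ab, plain K (opf (cc j)) ab -> fst ab < ncol K /\ snd ab < ncol K).
  { intros [a b] [_ X]. unfold ncol. simpl in *. destruct (opf (cc j)); simpl in X;
    unfold alive in X; rewrite ?orb_true_iff, ?andb_true_iff, ?Nat.eqb_eq, ?Nat.leb_le in X; lia. }
  assert (FB : Forall (fun ab => fst ab < ncol K /\ snd ab < ncol K) (B j)).
  { destruct (seg_start _); [eapply Forall_impl; [|exact H]; auto|].
    destruct H as (B1 & a & b & B2 & -> & S & H1 & H2). apply Forall_app. split; [eapply Forall_impl; [|exact H1]; auto|].
    constructor; [|eapply Forall_impl; [|exact H2]; auto].
    unfold ncol. simpl. destruct (opf (cc j)); simpl in S; unfold alive in S;
    rewrite ?andb_true_iff, ?Nat.eqb_eq, ?Nat.leb_le in S; try lia; discriminate. }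
  rewrite Forall_forall in FB. apply FB. now apply nth_In.
Qed.

Lemma bletter_even j p : p < length (B j) ->
  bletter (j, 2 * p + 2) = Tok (fst (nth p (B j) (0, 0))) (snd (nth p (B j) (0, 0))).
Proof.
  intros Hp. unfold bletter. cbn [snd fst].
  replace (2 * p + 2) with (S (2 * p + 1)) at 1 by lia. cbv iota.
  replace (2 * p + 2) with (2 * (p + 1)) by lia. rewrite Nat.odd_even.
  rewrite (Nat.mul_comm 2), Nat.div_mul by lia. now rewrite Nat.add_sub.
Qed.

Lemma bletter_odd j p : bletter (j, 2 * p + 1) = Sep.
Proof.
  unfold bletter. cbn [snd]. replace (2 * p + 1) with (S (2 * p)) by lia.
  cbv iota. rewrite Nat.odd_succ, Nat.even_even. reflexivity.
Qed.

Lemma block_cases j i : i < blen j ->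
  i = 0 \/ (exists p, i = 2 * p + 1 /\ p <= length (B j)) \/ exists p, i = 2 * p + 2 /\ p < length (B j).
Proof.
  unfold blen. intros H. destruct i as [|i]; auto. right.
  destruct (Nat.Even_or_Odd i) as [[p E]|[p E]]; [left|right]; exists p; lia.
Qed.

Lemma bword_dec k : dec_letter K U (bword k) = bletter (bpos k) /\ bword k < 2 * U.
Proof.
  destruct (bpos_spec k) as [H _]. destruct (bpos k) as [j i] eqn:E. unfold bword. rewrite E. simpl fst in H. simpl snd in H.
  pose proof (cc_lt j) as HC. unfold nctl in HC.
  destruct (block_cases j i H) as [->|[(p & -> & Hp)|(p & -> & Hp)]].
  - split; [apply (dec_enc_letter P K U Kpos HU1 HU2); simpl; auto|apply (enc_letter_lt P K U Kpos HU1 HU2); simpl; auto; lia].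
  - rewrite bletter_odd. split; [apply (dec_enc_letter P K U Kpos HU1 HU2); simpl; auto|apply (enc_letter_lt P K U Kpos HU1 HU2); simpl; auto; lia].
  - rewrite bletter_even by auto. pose proof (tok_bounds j p Hp).
    split; [apply (dec_enc_letter P K U Kpos HU1 HU2); auto|apply (enc_letter_lt P K U Kpos HU1 HU2); auto].
Qed.

Lemma frac_bounds i : (0 <= INR i / (INR i + 1) < 1)%R.
Proof.
  pose proof (pos_INR i). split.
  - apply Rmult_le_pos; [lra|]. left. apply Rinv_0_lt_compat. lra.
  - apply Rmult_lt_reg_r with (INR i + 1)%R; [lra|]. field_simplify; lra.
Qed.

Lemma btime_incr k : (btime k < btime (S k))%R.
Proof.
  unfold btime. simpl. destruct (bpos k) as [j i]. simpl. destruct (S i <? blen j); cbn [fst snd].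
  - rewrite S_INR. pose proof (pos_INR i). apply Rplus_lt_compat_l.
    apply Rmult_lt_reg_r with ((INR i + 1) * (INR i + 1 + 1))%R; [nra|]. field_simplify; lra.
  - pose proof (frac_bounds i). rewrite S_INR. simpl INR. unfold Rdiv at 2. rewrite Rmult_0_l. lra.
Qed.

Lemma bletter_ctl ji : is_ctl (bletter ji) = (snd ji =? 0).
Proof.
  unfold bletter. destruct (snd ji); auto. destruct (Nat.odd _); auto.
Qed.

Lemma bletter_sep k : is_sep (bletter (bpos k)) = Nat.odd k.
Proof.
  destruct (bpos_spec k) as [H1 H2]. rewrite H2 at 2. rewrite Nat.odd_add.
  assert (E : forall j, Nat.odd (boff j) = false).
  { induction j; simpl boff; auto. rewrite Nat.odd_add, IHj. unfold blen. now rewrite Nat.odd_even. }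
  rewrite E, xorb_false_l. unfold bletter. destruct (snd (bpos k)); auto. now destruct (Nat.odd (S n)).
Qed.

Lemma toks_block j :
  toks (map (fun k => bletter (bpos k)) (seq (S (boff j)) (blen j - 1))) = B j.
Proof.
  assert (X : forall d p, p + d = length (B j) ->
    toks (map (fun k => bletter (bpos k)) (seq (boff j + (2 * p + 1)) (2 * d + 1))) = skipn p (B j)).
  { induction d as [|d IH]; intros p Hp.
    - change (2 * 0 + 1) with 1. cbn [seq map]. rewrite bpos_off by (unfold blen; lia). rewrite bletter_odd. simpl.
      rewrite skipn_all2; auto; lia.
    - replace (2 * S d + 1) with (S (S (2 * d + 1))) by lia. cbn [seq map].
      rewrite bpos_off by (unfold blen; lia). rewrite bletter_odd.
      replace (S (boff j + (2 * p + 1))) with (boff j + (2 * p + 2)) by lia.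
      rewrite bpos_off by (unfold blen; lia). rewrite bletter_even by lia.
      replace (S (boff j + (2 * p + 2))) with (boff j + (2 * S p + 1)) by lia.
      assert (TT : forall a b l, toks (Sep :: Tok a b :: l) = (a, b) :: toks l) by reflexivity.
      rewrite TT, IH by lia. rewrite <- surjective_pairing.
      assert (Y : forall (l : list (nat * nat)) p, p < length l -> nth p l (0, 0) :: skipn (S p) l = skipn p l).
      { clear. induction l as [|x l IH]; intros [|p] H; simpl in *; try lia; auto. apply IH. lia. }
      apply Y. lia. }
  specialize (X (length (B j)) 0 eq_refl). simpl skipn in X. etransitivity; [|exact X].
  f_equal. f_equal. f_equal; unfold blen; lia.
Qed.

Theorem word_of_blocks : word_spec P K U c bword btime.
Proof.
  assert (WD : forall k, dec_letter K U (bword k) = bletter (bpos k)) by (intros; apply bword_dec).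
  split.
  - unfold bword. simpl. unfold bletter. simpl. rewrite Hc0. reflexivity.
  - unfold btime. simpl. lra.
  - intros k. rewrite WD. apply bletter_sep.
  - intros k i. rewrite WD. pose proof (bletter_ctl (bpos k)) as C. intros E. rewrite E in C.
    unfold bletter in E. symmetry in C. simpl in C. apply Nat.eqb_eq in C. rewrite C in E.
    injection E as <-. apply cc_lt.
  - intros k. destruct (bpos_spec k) as [H1 H2]. destruct (bpos k) as [j i] eqn:E. simpl fst in *; simpl snd in *.
    assert (H3 : i < blen (S j)) by (pose proof (blen_mono j); lia).
    (* The copy is the event with the same offset in the next block, exactly one time unit later.
       Inserted tokens come last, so equal offsets carry corresponding tokens. *)
    pose proof (bpos_off (S j) i H3) as E2. exists (boff (S j) + i).
    assert (T : btime (boff (S j) + i) = (btime k + 1)%R).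
    { unfold btime. rewrite E, E2. simpl fst. simpl snd. rewrite S_INR. lra. }
    split; [simpl; pose proof (blen_pos j); lia|]. split; [|split].
    + pose proof (btime_incr (boff (S j) + i)). rewrite T in *. lra.
    + rewrite !WD, E, E2.
      destruct (block_cases j i H1) as [->|[(p & -> & Hp)|(p & -> & Hp)]].
      * reflexivity.
      * now rewrite !bletter_odd.
      * assert (length (B j) <= length (B (S j))) by (pose proof (blen_mono j); unfold blen in *; lia).
        rewrite !bletter_even by lia. simpl. f_equal. destruct (Hext j) as (ext & EX).
        rewrite <- (map_nth fst (B (S j)) (0, 0)), <- (map_nth snd (B j) (0, 0)).
        rewrite EX. apply app_nth1. rewrite length_map; lia.
    + intros C m Hm. rewrite WD in C |- *. rewrite E, bletter_ctl in C. simpl in C. apply Nat.eqb_eq in C. subst i.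
      rewrite bletter_ctl. apply Nat.eqb_neq. intros Z.
      destruct (bpos_spec m) as [_ M]. rewrite Z, Nat.add_0_r in M. rewrite Nat.add_0_r in *.
      rewrite M, H2 in Hm. destruct (Nat.lt_trichotomy (fst (bpos m)) j) as [X|[X|X]].
      * apply boff_incr in X. lia.
      * rewrite X in Hm. lia.
      * destruct (Nat.eq_dec (fst (bpos m)) (S j)) as [Y|Y]; [rewrite Y in Hm; lia|].
        assert (Z' : S j < fst (bpos m)) by lia. apply boff_incr in Z'. lia.
  (* Block [j] is entered with label [q j], and its control letter, at offset 0, switches to
     [q (S j)]. *)
  - exists (fun k => let '(j, i) := bpos k in match i with 0 => q j | _ => q (S j) end).
    assert (Q1 : q 0 = goal U /\ q 1 = goal U).
    { pose proof (Hq 0) as H. rewrite Hc0 in H. now apply lab_prev1 in H. }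
    split.
    + change 1 with (boff 0 + 1). rewrite bpos_off by (unfold blen; lia). apply Q1.
    + intros k _. unfold lab_next. pose proof (WD k) as W. pose proof ((dec_letter_not_ctl P K U Kpos HU1 HU2) (bword k)) as C.
      rewrite W, bletter_ctl in C. destruct (bpos_spec k) as [H1 _]. simpl bpos. unfold bword in *.
      destruct (bpos k) as [j i]. simpl in C, H1. destruct (Nat.eqb_spec i 0) as [->|N].
      * symmetry in C. apply Nat.leb_le in C. destruct (Nat.ltb_spec (enc_letter K U (bletter (j, 0))) U); [lia|].
        assert (S 0 < blen j) by (unfold blen; lia). apply Nat.ltb_lt in H0. rewrite H0.
        simpl. replace (U + cc j - U) with (cc j) by lia. apply Hq.
      * symmetry in C. apply Nat.leb_gt in C. apply Nat.ltb_lt in C. rewrite C.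
        destruct i as [|i]; [lia|]. destruct (S (S i) <? blen j); reflexivity.
  - intros k m i W Hm NC Cm. rewrite WD in W. rewrite WD in Cm.
    pose proof (bletter_ctl (bpos k)) as C1. rewrite W in C1. symmetry in C1. apply Nat.eqb_eq in C1.
    destruct (bpos_spec k) as [_ K1]. rewrite C1, Nat.add_0_r in K1.
    rewrite bletter_ctl in Cm. apply Nat.eqb_eq in Cm.
    destruct (bpos_spec m) as [_ M1]. rewrite Cm, Nat.add_0_r in M1.
    set (j := fst (bpos k)) in *. set (j' := fst (bpos m)) in *.
    assert (j' = S j).
    { destruct (Nat.lt_trichotomy j' (S j)) as [X|[X|X]]; auto; exfalso.
      - assert (boff j' <= boff j); [|lia]. destruct (Nat.eq_dec j' j) as [->|]; auto.
        apply Nat.lt_le_incl, boff_incr. lia.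
      - apply boff_incr in X. assert (Y : boff j < boff (S j)) by (apply boff_incr; lia).
        assert (N : is_ctl (dec_letter K U (bword (boff (S j)))) = false) by (apply NC; lia).
        rewrite WD, bletter_ctl in N.
        replace (boff (S j)) with (boff (S j) + 0) in N by lia.
        rewrite bpos_off in N by apply blen_pos. discriminate. }
    assert (Ei : cc j = i).
    { unfold bletter in W. rewrite C1 in W. now injection W. }
    unfold seg_run. rewrite map_ext with (g := fun k => bletter (bpos k)) by auto.
    assert (EL : seq (S k) (m - S k) = seq (S (boff j)) (blen j - 1)).
    { rewrite K1, M1, H. simpl boff. f_equal. lia. }
    rewrite EL, fold_toks, toks_block, <- Ei; [apply Hseg|].
    apply Forall_forall. intros x Hx. apply in_map_iff in Hx as (n & <- & Hn). apply in_seq in Hn.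
    rewrite <- WD. apply NC. rewrite M1, K1, H. simpl boff. pose proof (blen_pos j). lia.
  - intros k. destruct (bpos_spec k) as [H1 H2]. destruct (Hinf (fst (bpos k))) as (j' & Hj & E).
    exists (boff j'). split.
    + rewrite H2. destruct (Nat.eq_dec j' (S (fst (bpos k)))) as [->|]; [simpl; lia|].
      assert (X : S (fst (bpos k)) < j') by lia. apply boff_incr in X. simpl in X. lia.
    + unfold bword. replace (boff j') with (boff j' + 0) by lia. rewrite bpos_off by apply blen_pos.
      unfold bletter. simpl. now rewrite E.
Qed.

Lemma btime_unbounded : non_zeno btime.
Proof.
  intros M. destruct (INR_unbounded M) as [j Hj].
  exists (boff j). unfold btime. replace (boff j) with (boff j + 0) by lia.
  rewrite bpos_off by apply blen_pos. simpl. unfold Rdiv. rewrite Rmult_0_l. lra.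
Qed.

End ToWord.
End Translation.

(** * Counter programs *)

Definition upd (s : nat -> nat) (r v : nat) : nat -> nat := fun x => if x =? r then v else s x.

Inductive pstep (P : list instr) : nat * (nat -> nat) -> nat * (nat -> nat) -> Prop :=
| ps_inc : forall p r q s, nth_error P p = Some (INC r q) ->
    pstep P (p, s) (q, upd s r (S (s r)))
| ps_dec : forall p r q q' s m, nth_error P p = Some (DEC r q q') -> s r = S m ->
    pstep P (p, s) (q, upd s r m)
| ps_zero : forall p r q q' s, nth_error P p = Some (DEC r q q') -> s r = 0 ->
    pstep P (p, s) (q', s).

Inductive psteps (P : list instr) : nat -> nat * (nat -> nat) -> nat * (nat -> nat) -> Prop :=
| pss_refl : forall x, psteps P 0 x x
| pss_step : forall n x y z, pstep P x y -> psteps P n y z -> psteps P (S n) x z.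

Lemma psteps_trans P n m x y z : psteps P n x y -> psteps P m y z -> psteps P (n + m) x z.
Proof. induction 1; simpl; auto. intros. econstructor; eauto. Qed.

Definition holds (w : list nat) (s : nat -> nat) : Prop :=
  forall r, count_occ Nat.eq_dec w (S r) = s r.

Lemma count_move w u v x y z : w = u ++ x :: v ->
  count_occ Nat.eq_dec (u ++ y :: v) z + (if x =? z then 1 else 0) =
  count_occ Nat.eq_dec w z + (if y =? z then 1 else 0).
Proof.
  intros ->. rewrite !count_occ_app. simpl.
  destruct (Nat.eq_dec x z), (Nat.eq_dec y z), (Nat.eqb_spec x z), (Nat.eqb_spec y z); lia.
Qed.

Lemma holds_inc w u v s r : holds w s -> w = u ++ 0 :: v -> holds (u ++ S r :: v) (upd s r (S (s r))).
Proof.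
  intros H E x. pose proof (count_move w u v 0 (S r) (S x) E) as C. rewrite (H x) in C. simpl in C.
  unfold upd. rewrite (Nat.eqb_sym x r). destruct (Nat.eqb_spec r x); subst; lia.
Qed.

Lemma holds_dec w u v s r m : holds w s -> w = u ++ S r :: v -> s r = S m -> holds (u ++ 0 :: v) (upd s r m).
Proof.
  intros H E Er x. pose proof (count_move w u v (S r) 0 (S x) E) as C. rewrite (H x) in C. simpl in C.
  unfold upd. rewrite (Nat.eqb_sym x r). destruct (Nat.eqb_spec r x); subst; lia.
Qed.

(** A step uses up at most one free token; this bounds how soon a run may jump to the goal. *)
Lemma count_free w u v y : w = u ++ 0 :: v -> count_occ Nat.eq_dec w 0 <= S (count_occ Nat.eq_dec (u ++ y :: v) 0).
Proof. intros E. pose proof (count_move w u v 0 y 0 E) as C. simpl in C. lia. Qed.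

Section Machine.
Variables (P : list instr) (K U c : nat).
Hypothesis HU1 : 20 + 7 * length P <= U.
Hypothesis Kpos : 1 <= K.
Hypothesis HU2 : (K + 5) * (K + 5) <= U.
Hypothesis Hreg : forall I, In I P -> instr_reg I < K.

Notation opf := (opof P).
Notation prev := (lab_prev P U c).
Notation mstep := (mstep opf prev).
Notation msteps := (msteps opf prev).
Notation lab := (lab U).
Notation goal := (goal U).
Notation free w := (count_occ Nat.eq_dec w 0).

Lemma div3 p k : k < 3 -> (3 * p + k) / 3 = p /\ (3 * p + k) mod 3 = k.
Proof.
  intros H. rewrite Nat.add_comm, Nat.mul_comm. split.
  - rewrite Nat.div_add by lia. rewrite Nat.div_small; lia.
  - rewrite Nat.Div0.mod_add. now apply Nat.mod_small.
Qed.

Lemma prev_index q p k : k < 3 -> prev q (4 + (3 * p + k)) =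
  match nth_error P p, k with
  | Some (INC _ q1), 0 | Some (DEC _ q1 _), 0 | Some (DEC _ _ q1), 1 =>
      if q =? lab q1 then Some (lab p) else None
  | Some _, 2 => if q =? goal then Some (lab p) else None
  | _, _ => None
  end.
Proof.
  intros H. destruct (div3 p k H) as [E1 E2]. revert E1 E2.
  generalize (3 * p + k) as j. intros j <- <-. reflexivity.
Qed.

Lemma op_index p k : k < 3 -> opf (4 + (3 * p + k)) =
  match nth_error P p, k with
  | Some (INC r _), 0 => OMove 0 (S r)
  | Some (DEC r _ _), 0 => OMove (S r) 0
  | Some (DEC r _ _), 1 => OZero (S r)
  | _, _ => OZero 0
  end.
Proof.
  intros H. destruct (div3 p k H) as [E1 E2]. revert E1 E2.
  generalize (3 * p + k) as j. intros j <- <-. reflexivity.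
Qed.

Lemma lab_inj p p' : p <= length P -> p' <= length P -> lab p = lab p' -> p = p'.
Proof. unfold lab. lia. Qed.

Lemma nth_lt p I : nth_error P p = Some I -> p < length P.
Proof. intros H. apply nth_error_Some. congruence. Qed.

Lemma pstep_follow p s p' s' w : pstep P (p, s) (p', s') -> holds w s -> In 0 w ->
  exists w', mstep (lab p, w) (lab p', w') /\ holds w' s'.
Proof.
  intros H Hw H0. inversion H as [? r q ? E|? r q q' ? m E Er|? r q q' ? E Er]; subst.
  - apply in_split in H0 as (u & v & Ew). exists (u ++ S r :: v). split; [|now apply holds_inc with w].
    exists (4 + (3 * p + 0)). rewrite prev_index, op_index by lia. rewrite E, Nat.eqb_refl. eauto.
  - assert (I : In (S r) w).
    { apply (count_occ_In Nat.eq_dec). rewrite (Hw r), Er. lia. }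
    apply in_split in I as (u & v & Ew). exists (u ++ 0 :: v). split; [|now apply holds_dec with w].
    exists (4 + (3 * p + 0)). rewrite prev_index, op_index by lia. rewrite E, Nat.eqb_refl. eauto.
  - exists w. split; auto.
    exists (4 + (3 * p + 1)). rewrite prev_index, op_index by lia. rewrite E, Nat.eqb_refl. repeat split; auto.
    apply (count_occ_not_In Nat.eq_dec). now rewrite (Hw r).
Qed.

Lemma prog_abort p I w : nth_error P p = Some I -> ~ In 0 w -> mstep (lab p, w) (goal, w).
Proof.
  intros E H0. exists (4 + (3 * p + 2)). rewrite prev_index, op_index by lia. rewrite E, Nat.eqb_refl. destruct I; auto.
Qed.

(** Either there are tokens enough for the whole computation, or they run out on the way and the
    jump to the goal is enabled. *)
Lemma psteps_follow n x y w : psteps P n x y -> holds w (snd x) ->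
  (exists w', msteps (lab (fst x), w) (goal, w')) \/
  exists w', msteps (lab (fst x), w) (lab (fst y), w') /\ holds w' (snd y).
Proof.
  intros H. revert w. induction H as [x|n x y z H _ IH]; intros w Hw.
  - right. exists w. split; auto. constructor.
  - destruct (in_dec Nat.eq_dec 0 w) as [I|I].
    + destruct x as [p s], y as [p' s']. destruct (pstep_follow _ _ _ _ _ H Hw I) as (w1 & M & Hw1).
      destruct (IH w1 Hw1) as [(w2 & M2)|(w2 & M2 & H2)]; [left|right]; exists w2.
      * econstructor; eauto.
      * split; auto. econstructor; eauto.
    + left. exists w. eapply ms_step; [|constructor].
      inversion H as [? ? ? ? E|? ? ? ? ? ? E|? ? ? ? ? E]; subst; eapply prog_abort; eauto.
Qed.

(** Each turn of the loop consumes a free token; when none is left the machine jumps. *)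
Lemma grow_follow g r : nth_error P g = Some (INC r g) ->
  forall n w, free w <= n -> exists w', msteps (lab g, w) (goal, w').
Proof.
  intros E. induction n as [|n IH]; intros w Hn.
  - exists w. eapply ms_step; [|constructor]. eapply prog_abort; eauto.
    apply (count_occ_not_In Nat.eq_dec). lia.
  - destruct (in_dec Nat.eq_dec 0 w) as [I|I].
    + apply in_split in I as (u & v & Ew).
      destruct (IH (u ++ S r :: v)) as (w' & M).
      { pose proof (count_move w u v 0 (S r) 0 Ew) as C. simpl in C. lia. }
      exists w'. eapply ms_step; [|exact M].
      exists (4 + (3 * g + 0)). rewrite prev_index, op_index by lia. rewrite E, Nat.eqb_refl. eauto.
    + exists w. eapply ms_step; [|constructor]. eapply prog_abort; eauto.
Qed.

Lemma prev_chain i k : i < c -> k = 2 \/ k = 3 -> prev (Nat.pred (2 * U + i)) k = Some (2 * U + i).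
Proof.
  intros Hi Hk. assert (E : (2 * U - 1 <=? Nat.pred (2 * U + i)) && (Nat.pred (2 * U + i) <? start_lab U c) = true).
  { unfold start_lab. apply andb_true_intro. split; [apply Nat.leb_le|apply Nat.ltb_lt]; lia. }
  destruct Hk as [-> | ->]; cbn [lab_prev]; rewrite E; f_equal; lia.
Qed.

Lemma pred_chain i : Nat.pred (2 * U + S i) = 2 * U + i.
Proof. lia. Qed.

(** The chain has no jumps of its own: without free tokens letter 3 leads through it to label 0,
    whose instruction can jump. *)
Lemma chain_abort I w : nth_error P 0 = Some I -> ~ In 0 w ->
  forall i, i <= c -> msteps (Nat.pred (2 * U + i), w) (goal, w).
Proof.
  intros E H0. induction i as [|i IH]; intros Hi.
  - replace (Nat.pred (2 * U + 0)) with (lab 0) by (unfold lab; lia).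
    eapply ms_step; [eapply prog_abort; eauto|constructor].
  - rewrite pred_chain. eapply ms_step; [|apply IH; lia].
    exists 3. split; [apply prev_chain; auto|]. simpl. auto.
Qed.

Lemma chain_follow I : nth_error P 0 = Some I -> forall i w s, i <= c -> holds w s ->
  (exists w', msteps (Nat.pred (2 * U + i), w) (goal, w')) \/
  exists w', msteps (Nat.pred (2 * U + i), w) (lab 0, w') /\ holds w' (upd s 0 (i + s 0)).
Proof.
  intros E. induction i as [|i IH]; intros w s Hi Hw.
  - right. exists w. split.
    + replace (Nat.pred (2 * U + 0)) with (lab 0) by (unfold lab; lia). constructor.
    + intros r. rewrite Hw. unfold upd. destruct (Nat.eqb_spec r 0); subst; auto.
  - destruct (in_dec Nat.eq_dec 0 w) as [H0|H0]; [|left; exists w; eapply chain_abort; eauto].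
    apply in_split in H0 as (u & v & Ew). rewrite pred_chain.
    assert (M : mstep (2 * U + i, w) (Nat.pred (2 * U + i), u ++ 1 :: v)).
    { exists 2. split; [apply prev_chain; auto|]. simpl. eauto. }
    pose proof (holds_inc w u v s 0 Hw Ew) as Hw'.
    destruct (IH _ _ ltac:(lia) Hw') as [(w2 & M2)|(w2 & M2 & H2)]; [left|right]; exists w2.
    + eapply ms_step; eauto.
    + split; [eapply ms_step; eauto|]. intros r. rewrite H2. unfold upd.
      destruct (Nat.eqb_spec r 0); subst; simpl; lia.
Qed.

Definition zero_regs : nat -> nat := fun _ => 0.

Lemma holds_repeat N : holds (repeat 0 N) zero_regs.
Proof. intros r. apply count_occ_not_In. intros H. apply repeat_spec in H. discriminate. Qed.

Theorem good_of_grow n g r s :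
  psteps P n (0, upd zero_regs 0 c) (g, s) -> nth_error P g = Some (INC r g) ->
  forall N, good opf prev (start_lab U c) goal N.
Proof.
  intros H E N.
  assert (E0 : exists I, nth_error P 0 = Some I).
  { inversion H as [|? ? y ? X]; subst; [eauto|]. inversion X; subst; eauto. }
  destruct E0 as [I E0].
  destruct (chain_follow I E0 c (repeat 0 N) zero_regs (Nat.le_refl _) (holds_repeat N)) as [G|(w & M & Hw)]; auto.
  replace (c + zero_regs 0) with c in Hw by (unfold zero_regs; lia).
  assert (T : forall x y z, msteps x y -> msteps y z -> msteps x z).
  { clear. induction 1; auto. intros. econstructor; eauto. }
  destruct (psteps_follow _ _ _ w H Hw) as [(w' & M')|(w' & M' & _)]; simpl fst in M'.
  - exists w'. eapply T; eauto.
  - destruct (grow_follow g r E _ w' (Nat.le_refl _)) as (w2 & M2). exists w2. eapply T; eauto.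
Qed.

(** * Halting programs have no runs with many tokens *)

Lemma lab_range p : p <= length P -> goal < lab p < 2 * U.
Proof. unfold goal, lab. lia. Qed.

Lemma prev_prog_inv q i p : p <= length P -> prev q i = Some (lab p) ->
  exists k I, nth_error P p = Some I /\ i = 4 + (3 * p + k) /\ k < 3 /\
   match I, k with
   | INC r q1, 0 => q = lab q1 /\ opf i = OMove 0 (S r)
   | DEC r q1 _, 0 => q = lab q1 /\ opf i = OMove (S r) 0
   | DEC r _ q2, 1 => q = lab q2 /\ opf i = OZero (S r)
   | _, 2 => q = goal /\ opf i = OZero 0
   | _, _ => False
   end.
Proof.
  intros Hp H. pose proof (lab_range p Hp) as R. destruct i as [|[|[|[|j]]]]; cbn [lab_prev lab_prog] in H.
  - destruct (_ =? _); [injection H as H; rewrite <- H in R; lia|discriminate].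
  - destruct (_ =? _); [injection H as H; rewrite <- H in R; lia|discriminate].
  - destruct (Nat.leb_spec (2 * U - 1) q); [|discriminate]. destruct (_ <? _); [|discriminate].
    simpl in H. injection H as H. unfold lab in *. lia.
  - destruct (Nat.leb_spec (2 * U - 1) q); [|discriminate]. destruct (_ <? _); [|discriminate].
    simpl in H. injection H as H. unfold lab in *. lia.
  - cbn [opof]. destruct (nth_error P (j / 3)) as [I|] eqn:E; [|discriminate].
    pose proof (Nat.div_mod_eq j 3) as DM. pose proof (Nat.mod_upper_bound j 3 ltac:(lia)) as MB.
    assert (j / 3 = p) as Ep.
    { pose proof (nth_lt _ _ E). apply lab_inj; try lia. destruct I; destruct (j mod 3) as [|[|[|?]]];
      try discriminate; destruct (_ =? _); try discriminate; congruence. }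
    exists (j mod 3), I. rewrite Ep in *. repeat split; auto; [lia|].
    destruct I as [r q1|r q1 q2]; destruct (j mod 3) as [|[|[|?]]]; try discriminate;
    match goal with H : (if ?a =? ?b then _ else _) = _ |- _ =>
      destruct (Nat.eqb_spec a b); [auto|discriminate] end.
Qed.

(** While a token is free the test [OZero 0] of the jump fails, and the register decides between the
    two branches of a decrement, so the machine can only imitate the program. *)
Lemma pstep_inverse p s p' s' q w w' : pstep P (p, s) (p', s') -> holds w s -> In 0 w ->
  mstep (lab p, w) (q, w') -> q = lab p' /\ holds w' s' /\ free w <= S (free w').
Proof.
  intros H Hw H0 (i & Hi & M).
  assert (Hp : p <= length P).
  { inversion H as [? ? ? ? E|? ? ? ? ? ? E|? ? ? ? ? E]; subst; apply nth_lt in E; lia. }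
  destruct (prev_prog_inv q i p Hp Hi) as (k & I & E & _ & _ & X).
  assert (Z : forall m, opf i = OZero m -> m <> 0).
  { intros m Em ->. rewrite Em in M. tauto. }
  destruct I as [r q1|r q1 q2]; destruct k as [|[|[|k]]]; try contradiction; destruct X as [-> X];
    try (now apply Z in X); rewrite X in M.
  - destruct M as (u & v & Ew & ->).
    inversion H as [? ? ? ? E'|? ? ? ? ? ? E'|? ? ? ? ? E']; subst p' s'; rewrite E in E'; try discriminate.
    injection E' as <- <-. repeat split; [now apply holds_inc with w|now apply count_free].
  - destruct M as (u & v & Ew & ->). pose proof (Hw r) as C. rewrite Ew, count_occ_app in C. simpl in C.
    destruct (Nat.eq_dec r r); [|easy].
    pose proof (count_move w u v (S r) 0 0 Ew) as C'. simpl in C'.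
    inversion H as [? ? ? ? E'|? ? ? ? ? ? E' Er|? ? ? ? ? E' Er]; subst p' s'; rewrite E in E'; try discriminate;
    injection E' as <- <- <-; [|lia].
    repeat split; [now apply holds_dec with w|lia].
  - destruct M as [NI ->]. pose proof (Hw r) as C.
    apply (count_occ_not_In Nat.eq_dec) in NI.
    inversion H as [? ? ? ? E'|? ? ? ? ? ? E' Er|? ? ? ? ? E' Er]; subst p' s'; rewrite E in E'; try discriminate;
    injection E' as <- <- <-; [lia|]. repeat split; auto.
Qed.

(** The free tokens outlast the [n] steps, so the machine is forced to the label [length P], which
    no step leaves. *)
Lemma psteps_halt n x h s' w : psteps P n x (h, s') -> h = length P -> holds w (snd x) -> n < free w ->
  forall w', ~ msteps (lab (fst x), w) (goal, w').
Proof.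
  intros H Hh. remember (h, s') as y eqn:Ey. revert w. induction H as [x|n x y z H H' IH]; intros w Hw Hn w' M.
  - subst x. simpl fst in M. pose proof (lab_range h ltac:(lia)) as R.
    inversion M as [|? [q w1] ? M1 M2]; subst; [lia|]. destruct M1 as (i & Hi & _).
    apply prev_prog_inv in Hi as (k & I & E & _); [|lia]. apply nth_lt in E. lia.
  - destruct x as [p s], y as [p1 s1]. simpl fst in *. simpl snd in *.
    assert (Hp : p < length P).
    { inversion H as [? ? ? ? E|? ? ? ? ? ? E|? ? ? ? ? E]; subst; now apply nth_lt in E. }
    pose proof (lab_range p ltac:(lia)) as R.
    inversion M as [|? [q w1] ? M1 M2]; subst; [lia|].
    apply (pstep_inverse _ _ _ _ _ _ _ H Hw) in M1 as (-> & Hw1 & Hf).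
    + eapply (IH eq_refl w1 Hw1); [lia|exact M2].
    + apply (count_occ_In Nat.eq_dec). lia.
Qed.

Lemma chain_halt n h s' : h = length P -> forall i w s, i <= c -> holds w s ->
  psteps P n (0, upd s 0 (i + s 0)) (h, s') -> n + i < free w ->
  forall w', ~ msteps (Nat.pred (2 * U + i), w) (goal, w').
Proof.
  intros Hh. induction i as [|i IH]; intros w s Hi Hw H Hf w' M.
  - replace (Nat.pred (2 * U + 0)) with (lab 0) in M by (unfold lab; lia).
    eapply (psteps_halt _ _ _ _ w H Hh); [|lia|exact M].
    intros r. rewrite Hw. simpl. unfold upd. destruct (Nat.eqb_spec r 0); subst; auto.
  - rewrite pred_chain in M. inversion M as [|? [q w1] ? M1 M2]; subst; [unfold goal in *; lia|].
    destruct M1 as (j & Hj & M1).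
    assert (I0 : In 0 w) by (apply (count_occ_In Nat.eq_dec); lia).
    assert (X : j = 2 \/ j = 3 -> q = Nat.pred (2 * U + i)).
    { intros [-> | ->]; cbn [lab_prev] in Hj; destruct (_ && _); try discriminate; injection Hj; lia. }
    destruct j as [|[|[|[|j]]]].
    + destruct M1.
    + destruct M1.
    + rewrite X in M2 by auto. simpl in M1. destruct M1 as (u & v & Ew & ->).
      pose proof (holds_inc w u v s 0 Hw Ew) as Hw'. pose proof (count_free w u v 1 Ew).
      eapply (IH _ _ ltac:(lia) Hw'); [|lia|exact M2].
      replace (upd (upd s 0 (S (s 0))) 0 (i + upd s 0 (S (s 0)) 0)) with (upd s 0 (S i + s 0)); [exact H|].
      apply functional_extensionality. intros r. unfold upd. destruct (r =? 0); simpl; lia.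
    + simpl in M1. tauto.
    + cbn [lab_prev lab_prog] in Hj.
      assert (L : forall p, lab p <> 2 * U + i) by (intros; unfold lab; lia).
      destruct (nth_error P (j / 3)) as [[r q1|r q1 q2]|]; [| |discriminate];
      destruct (j mod 3) as [|[|[|?]]]; try discriminate;
      destruct (_ =? _); try discriminate; injection Hj as Hj; now apply L in Hj.
Qed.

(** The chain takes [c] steps and the program [n], and [n + c] steps cannot use up [S (n + c)] free
    tokens. *)
Theorem not_good_of_halt n s' : psteps P n (0, upd zero_regs 0 c) (length P, s') ->
  ~ good opf prev (start_lab U c) goal (S (n + c)).
Proof.
  intros H (w & M). eapply (chain_halt n _ s' eq_refl c _ zero_regs); [auto|apply holds_repeat| | |exact M].
  - replace (c + zero_regs 0) with c by (unfold zero_regs; lia). exact H.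
  - rewrite count_occ_repeat_eq; auto.
Qed.

Lemma op_bounds i : match opf i with
  | ORestart => i = 0
  | OEnd => i = 1
  | OMove x y => x <= K /\ y <= K /\ x <> y
  | OZero x => x <= K
  end.
Proof.
  destruct i as [|[|[|[|j]]]]; cbn [opof]; auto; try lia.
  destruct (nth_error P (j / 3)) as [I|] eqn:E; [|simpl; lia].
  apply nth_error_In, Hreg in E. destruct I; simpl in E; destruct (j mod 3) as [|[|?]]; lia.
Qed.

Lemma lab_prev0 q p : prev q 0 = Some p <-> q = start_lab U c /\ p = goal.
Proof.
  cbn. destruct (Nat.eqb_spec q (start_lab U c)); split; try discriminate.
  - intros [= <-]. auto.
  - intros [_ ->]. auto.
  - tauto.
Qed.

Theorem good_of_accepts : accepts_some (prog_ata P K U c) ->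
  forall N, 1 <= N -> good opf prev (start_lab U c) goal N.
Proof.
  intros (a & t & (H1 & H2 & H3) & H).
  apply accepts_iff_word_spec in H; auto.
  destruct (blocks_of_word P K U c Kpos HU1 HU2 a t H3 H) as (cc & q & B & G1 & G2 & G3 & G4 & G5).
  exact (good_of_blocks K opf prev _ _ op_bounds eq_refl lab_prev0 (lab_prev1 P U c)
    cc q B G1 G2 G3 G4 G5).
Qed.

Theorem accepts_of_good : (forall N, 1 <= N -> good opf prev (start_lab U c) goal N) ->
  accepts_some_nonzeno (prog_ata P K U c).
Proof.
  intros H.
  destruct (blocks_of_good K opf prev _ _ op_bounds eq_refl eq_refl lab_prev0 (lab_prev1 P U c) H)
    as (cc & q & B & G1 & G2 & G3 & G4 & _ & G5).
  assert (L : forall k, bword K U cc B k < 2 * U).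
  { intros k. eapply bword_dec; eauto. apply op_bounds. }
  exists (bword K U cc B), (btime B). split; [|split].
  - repeat split; auto; [|apply btime_incr]. unfold btime. simpl. lra.
  - eapply btime_unbounded; eauto.
  - apply accepts_iff_word_spec; auto; [apply btime_incr|].
    eapply word_of_blocks; eauto. apply op_bounds.
Qed.

End Machine.

(** * Compiling recursive functions to counter programs *)

(* [CLoop r c]: while [r] is nonzero, decrement it and run [c]; [CDec] is truncated at zero. *)
Inductive com : Type :=
| CInc : nat -> com
| CDec : nat -> com
| CSeq : com -> com -> com
| CLoop : nat -> com -> com.

Inductive exec : com -> (nat -> nat) -> (nat -> nat) -> Prop :=
| ex_inc : forall r s, exec (CInc r) s (upd s r (S (s r)))
| ex_dec : forall r s, exec (CDec r) s (upd s r (Nat.pred (s r)))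
| ex_seq : forall c1 c2 s1 s2 s3, exec c1 s1 s2 -> exec c2 s2 s3 -> exec (CSeq c1 c2) s1 s3
| ex_loop0 : forall r c s, s r = 0 -> exec (CLoop r c) s s
| ex_loopS : forall r c s m s1 s2, s r = S m -> exec c (upd s r m) s1 ->
    exec (CLoop r c) s1 s2 -> exec (CLoop r c) s s2.

Fixpoint csize (c : com) : nat :=
  match c with
  | CInc _ | CDec _ => 1
  | CSeq c1 c2 => csize c1 + csize c2
  | CLoop _ c => S (csize c)
  end.

(** [b] is the address of the first instruction and [e] the address to continue at. Since every
    instruction names its successors, no jump instruction is needed. *)
Fixpoint flat (c : com) (b e : nat) : list instr :=
  match c with
  | CInc r => [INC r e]
  | CDec r => [DEC r e e]
  | CSeq c1 c2 => flat c1 b (b + csize c1) ++ flat c2 (b + csize c1) e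
  | CLoop r c => DEC r (S b) e :: flat c (S b) b
  end.

Lemma flat_length c b e : length (flat c b e) = csize c.
Proof. revert b e. induction c; intros; simpl; auto. rewrite length_app. auto. Qed.

Definition code_at (P : list instr) (b : nat) (l : list instr) : Prop :=
  forall i x, nth_error l i = Some x -> nth_error P (b + i) = Some x.

Lemma code_at_cons P b x l : code_at P b (x :: l) -> nth_error P b = Some x /\ code_at P (S b) l.
Proof.
  intros H. split; [rewrite <- (Nat.add_0_r b); now apply H|].
  intros i y Hi. rewrite Nat.add_succ_comm. now apply H.
Qed.

Lemma code_at_app P b l l' : code_at P b (l ++ l') -> code_at P b l /\ code_at P (b + length l) l'.
Proof.
  intros H. split; intros i x Hi.
  - apply H. rewrite nth_error_app1; auto. apply nth_error_Some. congruence.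
  - rewrite <- Nat.add_assoc. apply H. rewrite nth_error_app2 by lia. now rewrite Nat.add_comm, Nat.add_sub.
Qed.

Lemma upd_self s r : upd s r (s r) = s.
Proof. apply functional_extensionality. intros x. unfold upd. destruct (Nat.eqb_spec x r); congruence. Qed.

Lemma flat_correct P c s s' : exec c s s' -> forall b e, code_at P b (flat c b e) ->
  exists n, psteps P n (b, s) (e, s').
Proof.
  induction 1 as [r s|r s|c1 c2 s1 s2 s3 _ IH1 _ IH2|r c s E|r c s m s1 s2 E _ IH1 _ IH2]; intros b e HC; simpl in HC.
  - apply code_at_cons in HC as [HC _]. exists 1. econstructor; [|constructor]. now constructor.
  - apply code_at_cons in HC as [HC _]. exists 1. econstructor; [|constructor].
    destruct (s r) as [|m] eqn:E; simpl.
    + rewrite <- E, upd_self. eapply ps_zero; eauto.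
    + eapply ps_dec; eauto.
  - apply code_at_app in HC as [H1 H2]. rewrite flat_length in H2.
    destruct (IH1 _ _ H1) as (n1 & P1), (IH2 _ _ H2) as (n2 & P2).
    exists (n1 + n2). eapply psteps_trans; eauto.
  - apply code_at_cons in HC as [HC _]. exists 1. econstructor; [|constructor]. eapply ps_zero; eauto.
  - apply code_at_cons in HC as X. destruct X as [H1 H2].
    destruct (IH1 _ _ H2) as (n1 & P1), (IH2 _ _ HC) as (n2 & P2).
    exists (S (n1 + n2)). econstructor; [eapply ps_dec; eauto|]. eapply psteps_trans; eauto.
Qed.

Ltac upd_ext := apply functional_extensionality; intros ?x; unfold upd in *;
  repeat match goal with
  | |- context [?a =? ?b] => destruct (Nat.eqb_spec a b); subst; try (exfalso; lia)
  | H : context [?a =? ?b] |- _ => destruct (Nat.eqb_spec a b); subst; try (exfalso; lia)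
  end; try lia; try congruence.

Definition cmove (a r : nat) : com := CLoop a (CInc r).
Definition cclear (a : nat) : com := CLoop a (CDec a).
Definition ccopy (a r tmp : nat) : com :=
  CSeq (CLoop a (CSeq (CInc r) (CInc tmp))) (cmove tmp a).

Lemma exec_cmove a r s : a <> r -> exec (cmove a r) s (upd (upd s a 0) r (s r + s a)).
Proof.
  intros N. remember (s a) as n eqn:E. revert s E. induction n as [|n IH]; intros s E.
  - replace (upd (upd s a 0) r (s r + 0)) with s by upd_ext. now constructor.
  - eapply ex_loopS; [eauto|constructor|].
    specialize (IH (upd (upd s a n) r (S (upd s a n r)))).
    replace (upd (upd s a 0) r (s r + S n)) with
      (upd (upd (upd (upd s a n) r (S (upd s a n r))) a 0) r
         (upd (upd s a n) r (S (upd s a n r)) r + n)) by upd_ext.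
    apply IH. unfold upd. rewrite Nat.eqb_refl. destruct (Nat.eqb_spec a r); congruence.
Qed.

Lemma exec_cclear a s : exec (cclear a) s (upd s a 0).
Proof.
  assert (X : forall n s, s a <= n -> exec (cclear a) s (upd s a 0)).
  { clear s. induction n as [|n IH]; intros s Hn.
    - replace (upd s a 0) with s by upd_ext. constructor. lia.
    - destruct (s a) as [|m] eqn:E.
      + replace (upd s a 0) with s by upd_ext. now constructor.
      + eapply ex_loopS; [eauto|constructor|].
        replace (upd s a 0) with (upd (upd (upd s a m) a (Nat.pred (upd s a m a))) a 0) by upd_ext.
        apply IH. unfold upd. rewrite !Nat.eqb_refl. lia. }
  exact (X _ s (Nat.le_refl _)).
Qed.

Lemma exec_ccopy a r tmp s : a <> r -> a <> tmp -> r <> tmp -> s r = 0 -> s tmp = 0 ->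
  exec (ccopy a r tmp) s (upd s r (s a)).
Proof.
  intros N1 N2 N3 Hr Ht.
  assert (X : forall n s, s a = n ->
    exec (CLoop a (CSeq (CInc r) (CInc tmp))) s (upd (upd (upd s a 0) r (s r + n)) tmp (s tmp + n))).
  { clear s Hr Ht. induction n as [|n IH]; intros s E.
    - replace (upd (upd (upd s a 0) r (s r + 0)) tmp (s tmp + 0)) with s by upd_ext. now constructor.
    - eapply ex_loopS; [eauto|eapply ex_seq; constructor|].
      match goal with |- exec _ ?s' _ => specialize (IH s') end.
      match type of IH with _ -> exec _ _ ?f => replace (upd (upd (upd s a 0) r (s r + S n)) tmp (s tmp + S n)) with f by upd_ext end.
      apply IH. unfold upd. rewrite Nat.eqb_refl.
      destruct (Nat.eqb_spec a tmp); [congruence|]. destruct (Nat.eqb_spec a r); congruence. }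
  eapply ex_seq; [apply X; reflexivity|].
  match goal with |- exec _ ?s' ?f => pose proof (exec_cmove tmp a s') as M;
    replace f with (upd (upd s' tmp 0) a (s' a + s' tmp)) by upd_ext end.
  apply M. auto.
Qed.

(** [cg] stays outside the inner fixpoint, so that the nested recursion of [comp] satisfies the
    guard condition. [nop] will be a decrement of a register holding zero. *)
Definition cseqs (cg : recf -> nat -> com) (nop : com) : list recf -> nat -> com :=
  fix go gs k := match gs with [] => nop | g :: gs' => CSeq (cg g k) (go gs' (S k)) end.

Fixpoint cclears (l : list nat) (nop : com) : com :=
  match l with [] => nop | r :: l' => CSeq (cclear r) (cclears l' nop) end.

(* The result register and all registers from [free] on are zero at the start;
   the latter are zero again at the end. *)
Fixpoint comp (f : recf) (args : list nat) (res free : nat) {struct f} : com :=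
  match f with
  | RZero => CDec res
  | RSucc => CSeq (ccopy (nth 0 args 0) res free) (CInc res)
  | RProj i => ccopy (nth i args 0) res free
  | RComp f gs =>
      let fr := free + length gs in
      CSeq (cseqs (fun g k => comp g args k fr) (CDec fr) gs free)
        (CSeq (comp f (seq free (length gs)) res fr)
           (cclears (seq free (length gs)) (CDec fr)))
  | RPrim f g =>
      let acc := free in let i := free + 1 in let m := free + 2 in let tmp := free + 3 in
      let fr := free + 4 in
      CSeq (comp f (tl args) acc fr)
        (CSeq (ccopy (nth 0 args 0) m fr)
          (CSeq (CLoop m (CSeq (comp g (i :: acc :: tl args) tmp fr)
                   (CSeq (cclear acc) (CSeq (cmove tmp acc) (CInc i)))))
            (CSeq (cmove acc res) (cclear i))))
  | RMu f =>
      let i := free in let tmp := free + 1 in let fr := free + 2 in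
      CSeq (comp f (i :: args) tmp fr)
        (CSeq (CLoop tmp (CSeq (cclear tmp) (CSeq (CInc i) (comp f (i :: args) tmp fr))))
          (cmove i res))
  end.

Section RecfInd.
Variable Q : recf -> Prop.
Hypothesis H1 : Q RZero.
Hypothesis H2 : Q RSucc.
Hypothesis H3 : forall i, Q (RProj i).
Hypothesis H4 : forall f gs, Q f -> Forall Q gs -> Q (RComp f gs).
Hypothesis H5 : forall f g, Q f -> Q g -> Q (RPrim f g).
Hypothesis H6 : forall f, Q f -> Q (RMu f).

Fixpoint recf_nested_ind (f : recf) : Q f :=
  match f with
  | RZero => H1
  | RSucc => H2
  | RProj i => H3 i
  | RComp f gs => H4 f gs (recf_nested_ind f)
      ((fix go gs : Forall Q gs := match gs with
        | [] => Forall_nil Q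
        | g :: gs' => Forall_cons g (recf_nested_ind g) (go gs') end) gs)
  | RPrim f g => H5 f g (recf_nested_ind f) (recf_nested_ind g)
  | RMu f => H6 f (recf_nested_ind f)
  end.
End RecfInd.

Definition comp_spec (f : recf) : Prop := forall v y, reval f v y ->
  forall args res free s, map s args = v -> Forall (fun x => x < free) args -> res < free ->
  ~ In res args -> s res = 0 -> (forall x, free <= x -> s x = 0) ->
  exec (comp f args res free) s (upd s res y).

Fixpoint upds (s : nat -> nat) (k : nat) (ys : list nat) : nat -> nat :=
  match ys with [] => s | y :: ys' => upds (upd s k y) (S k) ys' end.

Lemma upd_eq s r v : upd s r v r = v.
Proof. unfold upd. now rewrite Nat.eqb_refl. Qed.

Lemma upd_neq s r v x : x <> r -> upd s r v x = s x.
Proof. intros H. unfold upd. destruct (Nat.eqb_spec x r); congruence. Qed.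

Lemma map_upd s r v l : ~ In r l -> map (upd s r v) l = map s l.
Proof. intros H. apply map_ext_in. intros x Hx. apply upd_neq. congruence. Qed.

Lemma upds_out ys : forall s k x, x < k \/ k + length ys <= x -> upds s k ys x = s x.
Proof.
  induction ys as [|y ys IH]; intros s k x H; simpl in *; auto.
  rewrite IH by lia. apply upd_neq. lia.
Qed.

Lemma map_upds ys : forall s k, map (upds s k ys) (seq k (length ys)) = ys.
Proof.
  induction ys as [|y ys IH]; intros s k; simpl; auto. rewrite IH. f_equal.
  rewrite upds_out by lia. apply upd_eq.
Qed.

Lemma exec_seq_eq c1 c2 s1 s2 s3 s3' : exec c1 s1 s2 -> exec c2 s2 s3 -> s3 = s3' -> exec (CSeq c1 c2) s1 s3'.
Proof. intros H1 H2 <-. econstructor; eauto. Qed.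

Lemma exec_nop r s : s r = 0 -> exec (CDec r) s s.
Proof. intros H. pose proof (ex_dec r s) as X. rewrite H in X. simpl in X. rewrite <- H, upd_self in X. exact X. Qed.

Lemma exec_cclears l nop s : (forall s', (forall x, ~ In x l -> s' x = s x) -> exec nop s' s') ->
  exists s', exec (cclears l nop) s s' /\ (forall x, In x l -> s' x = 0) /\ (forall x, ~ In x l -> s' x = s x).
Proof.
  revert s. induction l as [|r l IH]; intros s H; simpl.
  - exists s. split; [apply H; auto|]. split; [tauto|auto].
  - destruct (IH (upd s r 0)) as (s' & E & Z & O).
    { intros s' Hs. apply H. intros x Hx. simpl in Hx. rewrite Hs by tauto. apply upd_neq. intros ->; tauto. }
    exists s'. split; [econstructor; [apply exec_cclear|exact E]|]. split.
    + intros x [<-|Hx]; auto. destruct (in_dec Nat.eq_dec r l) as [I|I]; auto. rewrite O by auto. apply upd_eq.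
    + intros x Hx. rewrite O by tauto. apply upd_neq. intros ->; tauto.
Qed.

Lemma exec_cseqs args fr v gs ys : Forall comp_spec gs -> revals gs v ys ->
  forall k s, map s args = v -> Forall (fun x => x < k) args -> k + length gs = fr ->
  (forall x, k <= x -> s x = 0) ->
  exec (cseqs (fun g k => comp g args k fr) (CDec fr) gs k) s (upds s k ys).
Proof.
  intros HF HR. induction HR as [v|g gs v y ys Hg HR IH]; intros k s Ha Hlt Hk Hz; simpl.
  - apply exec_nop. apply Hz. lia.
  - inversion HF as [|? ? Sg Sgs]; subst. simpl in *.
    assert (NI : ~ In k args).
    { intros I. rewrite Forall_forall in Hlt. apply Hlt in I. lia. }
    assert (Hlt' : forall n, k <= n -> Forall (fun x => x < n) args).
    { intros n Hn. eapply Forall_impl; [|exact Hlt]. simpl. lia. }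
    econstructor.
    + apply (Sg _ _ Hg); auto; [apply Hlt'; lia|lia|]. intros; apply Hz; lia.
    + apply IH; [auto|now apply map_upd|apply Hlt'; lia|lia|].
      intros x Hx. rewrite upd_neq by lia. apply Hz. lia.
Qed.

(** Collects the intermediate values in a sequence that the loop invariant can refer to. *)
Lemma prim_values f g n : forall v y, reval (RPrim f g) (n :: v) y ->
  exists zs : nat -> nat, reval f v (zs 0) /\ (forall m, m < n -> reval g (m :: zs m :: v) (zs (S m))) /\ zs n = y.
Proof.
  induction n as [|n IH]; intros v y H; inversion H; subst.
  - exists (fun _ => y). repeat split; auto. lia.
  - destruct (IH _ _ H5) as (zs & Z1 & Z2 & Z3). subst z.
    exists (fun m => if m <=? n then zs m else y). repeat split; auto.
    + intros m Hm. destruct (Nat.leb_spec m n); [|lia]. destruct (Nat.leb_spec (S m) n).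
      * apply Z2; lia.
      * assert (m = n) by lia. subst. auto.
    + destruct (Nat.leb_spec (S n) n); [lia|auto].
Qed.

Theorem comp_correct f : comp_spec f.
Proof.
  induction f as [| |i|f gs IHf IHgs|f g IHf IHg|f IHf] using recf_nested_ind;
    intros v y H args res free s Ha Hlt Hres Hni Hr Hz; simpl;
    assert (Hlt' : forall n, free <= n -> Forall (fun x => x < n) args)
      by (intros n Hn; eapply Forall_impl; [|exact Hlt]; simpl; lia);
    rewrite Forall_forall in Hlt.
  - inversion H; subst. rewrite <- Hr, upd_self. now apply exec_nop.
  - assert (Hv : exists x v', v = x :: v' /\ y = S x) by (inversion H; eauto).
    destruct Hv as (x & v' & -> & ->).
    destruct args as [|a args]; [discriminate|]. simpl in *. injection Ha as E1 E2.
    assert (a < free) by auto. assert (a <> res) by tauto.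
    eapply exec_seq_eq; [apply exec_ccopy; auto; lia|constructor|]. subst. upd_ext.
  - inversion H as [| |? ? Hi| | | |]; subst. rewrite length_map in Hi.
    assert (I : In (nth i args 0) args) by now apply nth_In.
    replace (nth i (map s args) 0) with (s (nth i args 0)).
    + apply Hlt in I as L. apply exec_ccopy; auto; try lia. intros E. rewrite E in I. auto.
    + rewrite (nth_indep (map s args) 0 (s 0)) by now rewrite length_map. now rewrite map_nth.
  - inversion H as [| | |? ? ? ys ? HR HF| | |]; subst.
    assert (EL : length ys = length gs).
    { clear - HR. induction HR; simpl; auto. }
    set (n := length gs) in *.
    econstructor; [apply exec_cseqs with (v := map s args) (ys := ys); auto|].
    set (s1 := upds s free ys).
    econstructor.
    + apply (IHf _ _ HF); auto.
      * rewrite <- EL. apply map_upds.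
      * apply Forall_forall. intros x Hx. apply in_seq in Hx. lia.
      * lia.
      * intros Hx. apply in_seq in Hx. lia.
      * unfold s1. rewrite upds_out; auto; lia.
      * intros x Hx. unfold s1. rewrite upds_out by lia. apply Hz. lia.
    + destruct (exec_cclears (seq free n) (CDec (free + n)) (upd s1 res y)) as (s2 & E & Z & O).
      { intros s' Hs. apply exec_nop. rewrite Hs, upd_neq by (rewrite ?in_seq; lia).
        unfold s1. rewrite upds_out by lia. apply Hz. lia. }
      replace (upd s res y) with s2; [exact E|].
      apply functional_extensionality. intros x. destruct (in_dec Nat.eq_dec x (seq free n)) as [I|I].
      * rewrite Z by auto. apply in_seq in I. rewrite upd_neq by lia. symmetry. apply Hz. lia.
      * rewrite O by auto. rewrite in_seq in I. unfold upd. destruct (x =? res); auto.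
        unfold s1. apply upds_out. lia.
  - assert (Hv : exists n v', v = n :: v') by (inversion H; eauto).
    destruct Hv as (n & v' & ->). destruct (prim_values _ _ _ _ _ H) as (zs & Z1 & Z2 & <-).
    destruct args as [|a args]; [discriminate|]. simpl in Ha. injection Ha as Ea Ea'. simpl tl. simpl nth.
    (* The state after [m] rounds: accumulator [zs m], index [m], and [d] rounds to go. *)
    set (St := fun m d => upd (upd (upd s free (zs m)) (free + 1) m) (free + 2) d).
    assert (La : a < free) by (apply Hlt; now left).
    assert (Lt : forall x, In x args -> x < free) by (intros; apply Hlt; now right).
    assert (NA : forall x, free <= x -> ~ In x args) by (intros x Hx I; apply Lt in I; lia).
    assert (Na : a <> res) by (intros ->; apply Hni; now left).
    pose proof (Hz free ltac:(lia)) as Z_0. pose proof (Hz (free + 1) ltac:(lia)) as Z_1.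
    pose proof (Hz (free + 2) ltac:(lia)) as Z_2. pose proof (Hz (free + 3) ltac:(lia)) as Z_3.
    econstructor.
    { apply (IHf _ _ Z1); auto; try lia.
      - specialize (Hlt' (free + 4) ltac:(lia)). now inversion Hlt'.
      - intros; apply Hz; lia. }
    econstructor.
    { apply exec_ccopy; try lia; rewrite ?upd_neq by lia; auto. apply Hz. lia. }
    rewrite upd_neq, Ea by lia.
    assert (LOOP : forall d m, m + d = n ->
      exec (CLoop (free + 2) (CSeq (comp g (free + 1 :: free :: args) (free + 3) (free + 4))
         (CSeq (cclear free) (CSeq (cmove (free + 3) free) (CInc (free + 1)))))) (St m d) (St n 0)).
    { induction d as [|d IHd]; intros m Hm.
      - replace m with n by lia. constructor. apply upd_eq.
      - eapply ex_loopS; [apply upd_eq| |apply (IHd (S m)); lia].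
        replace (upd (St m (S d)) (free + 2) d) with (St m d) by (unfold St; upd_ext).
        econstructor.
        { apply (IHg _ _ (Z2 m ltac:(lia))); try lia.
          - unfold St. cbn [map]. repeat rewrite map_upd by (apply NA; lia). rewrite Ea'.
            rewrite !(upd_neq _ (free + 2)) by lia. rewrite upd_eq.
            rewrite upd_neq, upd_eq by lia. reflexivity.
          - constructor; [lia|]. constructor; [lia|].
            specialize (Hlt' (free + 4) ltac:(lia)). now inversion Hlt'.
          - simpl. intros [X|[X|X]]; try lia. revert X. apply NA. lia.
          - unfold St. rewrite !upd_neq by lia. auto.
          - intros x Hx. unfold St. rewrite !upd_neq by lia. apply Hz. lia. }
        econstructor; [apply exec_cclear|].
        eapply exec_seq_eq; [apply exec_cmove; lia|constructor|].
        unfold St. upd_ext. }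
    econstructor.
    { replace (upd (upd s free (zs 0)) (free + 2) n) with (St 0 n) by (unfold St; upd_ext).
      apply LOOP. lia. }
    eapply exec_seq_eq; [apply exec_cmove; lia|apply exec_cclear|].
    unfold St. upd_ext.
  - inversion H as [| | | | | |? ? ? Hn Hlow]; subst.
    assert (NA : forall x, free <= x -> ~ In x args) by (intros x Hx I; apply Hlt in I; lia).
    pose proof (Hz free ltac:(lia)) as Z_0. pose proof (Hz (free + 1) ltac:(lia)) as Z_1.
    set (St := fun m k => upd (upd s free m) (free + 1) k).
    assert (CF : forall m k, reval f (m :: map s args) k ->
      exec (comp f (free :: args) (free + 1) (free + 2)) (St m 0) (St m k)).
    { intros m k Hk. replace (St m k) with (upd (St m 0) (free + 1) k) by (unfold St; upd_ext).
      apply (IHf _ _ Hk); auto; try lia.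
      - unfold St. cbn [map]. repeat rewrite map_upd by (apply NA; lia).
        rewrite upd_neq, upd_eq by lia. reflexivity.
      - constructor; [lia|]. apply Hlt'. lia.
      - simpl. intros [X|X]; [lia|]. revert X. apply NA. lia.
      - apply upd_eq.
      - intros x Hx. unfold St. rewrite !upd_neq by lia. apply Hz. lia. }
    (* A nonzero value [S k] keeps the loop going; what its decrement leaves is cleared before [f]
       is evaluated at the next argument. *)
    assert (LOOP : forall d m, m + d = y -> exists k, reval f (m :: map s args) k /\
      exec (CLoop (free + 1) (CSeq (cclear (free + 1)) (CSeq (CInc free)
         (comp f (free :: args) (free + 1) (free + 2))))) (St m k) (St y 0)).
    { induction d as [|d IHd]; intros m Hm.
      - replace m with y by lia. exists 0. split; auto. constructor. apply upd_eq.
      - destruct (Hlow m ltac:(lia)) as (k & Hk). destruct (IHd (S m) ltac:(lia)) as (k' & Hk' & E).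
        exists (S k). split; auto. eapply ex_loopS; [apply upd_eq| |exact E].
        econstructor; [apply exec_cclear|]. econstructor; [constructor|].
        replace (upd _ free _) with (St (S m) 0); [now apply CF|].
        unfold St. upd_ext. }
    destruct (LOOP y 0 eq_refl) as (k & Hk & E).
    econstructor.
    { replace s with (St 0 0) at 1 by (unfold St; upd_ext). apply CF. exact Hk. }
    eapply exec_seq_eq; [exact E|apply exec_cmove; lia|].
    unfold St. upd_ext.
Qed.

(** * The code of the automaton is recursive in the code of its fixed part *)

Fixpoint r_const (n : nat) : recf := match n with O => RZero | S n => RComp RSucc [r_const n] end.
Definition r_add : recf := RPrim (RProj 0) (RComp RSucc [RProj 1]).
Definition r_pred : recf := RPrim RZero (RProj 0).
Definition r_sub : recf := RPrim (RProj 0) (RComp r_pred [RProj 1]).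
Definition r_tri : recf := RPrim RZero (RComp RSucc [RComp r_add [RProj 0; RProj 1]]).

Definition c_succ g := RComp RSucc [g].
Definition c_add g h := RComp r_add [g; h].
Definition c_pred g := RComp r_pred [g].
(* [r_sub] recurses on the subtrahend, which is therefore its first argument. *)
Definition c_sub g h := RComp r_sub [h; g].
Definition c_tri g := RComp r_tri [g].
Definition c_cpair g h := c_add (c_tri (c_add g h)) h.

Fixpoint tri (n : nat) : nat := match n with O => 0 | S n => S (n + tri n) end.

Lemma ev_comp1 f g v x y : reval g v x -> reval f [x] y -> reval (RComp f [g]) v y.
Proof. intros. eapply ev_comp; [|eassumption]. repeat constructor; auto. Qed.

Lemma ev_comp2 f g h v x x' y : reval g v x -> reval h v x' -> reval f [x; x'] y ->
  reval (RComp f [g; h]) v y.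
Proof. intros. eapply ev_comp; [|eassumption]. repeat constructor; auto. Qed.

Lemma ev_comp3 f g h k v x x' x'' y : reval g v x -> reval h v x' -> reval k v x'' ->
  reval f [x; x'; x''] y -> reval (RComp f [g; h; k]) v y.
Proof. intros. eapply ev_comp; [|eassumption]. repeat constructor; auto. Qed.

Lemma ev_p0 x v : reval (RProj 0) (x :: v) x.
Proof. apply (ev_proj 0 (x :: v)). simpl; lia. Qed.
Lemma ev_p1 a x v : reval (RProj 1) (a :: x :: v) x.
Proof. apply (ev_proj 1 (a :: x :: v)). simpl; lia. Qed.
Lemma ev_p2 a b x v : reval (RProj 2) (a :: b :: x :: v) x.
Proof. apply (ev_proj 2 (a :: b :: x :: v)). simpl; lia. Qed.

Lemma ev_const n v : reval (r_const n) v n.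
Proof. induction n; simpl; [constructor|]. eapply ev_comp1; eauto. constructor. Qed.

Lemma ev_c_succ g v x : reval g v x -> reval (c_succ g) v (S x).
Proof. intros. eapply ev_comp1; eauto. constructor. Qed.

Lemma ev_add x y : reval r_add [x; y] (x + y).
Proof.
  induction x; [apply ev_prim0, ev_p0|]. eapply ev_primS; [exact IHx|].
  apply ev_c_succ, ev_p1.
Qed.

Lemma ev_c_add g h v x y : reval g v x -> reval h v y -> reval (c_add g h) v (x + y).
Proof. intros. eapply ev_comp2; eauto. apply ev_add. Qed.

Lemma ev_pred x : reval r_pred [x] (Nat.pred x).
Proof.
  induction x; [apply ev_prim0; constructor|]. eapply ev_primS; [exact IHx|]. apply ev_p0.
Qed.

Lemma ev_c_pred g v x : reval g v x -> reval (c_pred g) v (Nat.pred x).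
Proof. intros. eapply ev_comp1; eauto. apply ev_pred. Qed.

Lemma ev_sub y x : reval r_sub [y; x] (x - y).
Proof.
  induction y; [rewrite Nat.sub_0_r; apply ev_prim0, ev_p0|].
  rewrite Nat.sub_succ_r. eapply ev_primS; [exact IHy|]. apply ev_c_pred, ev_p1.
Qed.

Lemma ev_c_sub g h v x y : reval g v x -> reval h v y -> reval (c_sub g h) v (x - y).
Proof. intros. eapply ev_comp2; eauto. apply ev_sub. Qed.

Lemma ev_tri n : reval r_tri [n] (tri n).
Proof.
  induction n; [apply ev_prim0; constructor|]. eapply ev_primS; [exact IHn|].
  apply ev_c_succ, ev_c_add; [apply ev_p0|apply ev_p1].
Qed.

Lemma ev_c_tri g v x : reval g v x -> reval (c_tri g) v (tri x).
Proof. intros. eapply ev_comp1; eauto. apply ev_tri. Qed.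

(** The quotient in Cantor's pairing is a triangular number, so a recursion replaces the
    division. *)
Lemma cpair_tri x y : cpair x y = tri (x + y) + y.
Proof.
  unfold cpair. f_equal. generalize (x + y) as n. intros n.
  assert (E : 2 * tri n = n * (n + 1)) by (induction n; simpl; lia).
  rewrite <- E, Nat.mul_comm. now apply Nat.div_mul.
Qed.

Lemma ev_c_cpair g h v x y : reval g v x -> reval h v y -> reval (c_cpair g h) v (cpair x y).
Proof. intros. rewrite cpair_tri. apply ev_c_add; auto. apply ev_c_tri, ev_c_add; auto. Qed.

Lemma tri_mono m n : m <= n -> tri m <= tri n.
Proof. intros H. induction H; simpl; lia. Qed.

(** Inverts Cantor's pairing: [x + y] is the least [s] such that the triangular number of [s + 1]
    exceeds the code, that is, such that the truncated difference vanishes. *)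
Definition r_diag : recf := RMu (c_sub (c_succ (RProj 1)) (c_tri (c_succ (RProj 0)))).
Definition r_snd : recf := c_sub (RProj 0) (c_tri r_diag).
Definition r_fst : recf := c_sub r_diag r_snd.

Lemma ev_diag x y : reval r_diag [cpair x y] (x + y).
Proof.
  assert (E : forall s, reval (c_sub (c_succ (RProj 1)) (c_tri (c_succ (RProj 0)))) [s; cpair x y]
     (S (cpair x y) - tri (S s))).
  { intros s. apply ev_c_sub; [apply ev_c_succ, ev_p1|apply ev_c_tri, ev_c_succ, ev_p0]. }
  constructor.
  - assert (Z : S (cpair x y) - tri (S (x + y)) = 0) by (rewrite cpair_tri; simpl; lia).
    rewrite <- Z at 3. apply E.
  - intros m Hm. specialize (E m). pose proof (tri_mono (S m) (x + y) Hm).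
    exists (cpair x y - tri (S m)). replace (S (cpair x y - tri (S m))) with (S (cpair x y) - tri (S m)); [exact E|].
    rewrite cpair_tri. lia.
Qed.

Lemma ev_snd x y : reval r_snd [cpair x y] y.
Proof.
  replace y with (cpair x y - tri (x + y)) at 2 by (rewrite cpair_tri; lia).
  apply ev_c_sub; [apply ev_p0|apply ev_c_tri, ev_diag].
Qed.

Lemma ev_fst x y : reval r_fst [cpair x y] x.
Proof.
  replace x with (x + y - y) at 2 by lia. apply ev_c_sub; [apply ev_diag|apply ev_snd].
Qed.

Definition le_code : nat := enc_guard (GCmp CLe 1).

Definition c_entry (gq gl gq' : recf) : recf :=
  c_cpair gq (c_cpair gl (c_cpair (r_const le_code) (c_cpair (r_const 2) (c_cpair gq' (r_const 1))))).

Lemma ev_c_entry gq gl gq' v q l q' : reval gq v q -> reval gl v l -> reval gq' v q' ->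
  reval (c_entry gq gl gq') v (enc_trans (lentry q l q')).
Proof. intros. repeat apply ev_c_cpair; auto; apply ev_const. Qed.

Definition r_self : recf :=
  RPrim (RProj 1) (c_succ (c_cpair (c_entry (RProj 2) (RProj 0) (RProj 2)) (RProj 1))).

Lemma ev_self n s acc : reval r_self [n; s; enc_list enc_trans acc] (enc_list enc_trans (self_trans s n acc)).
Proof.
  induction n; [apply ev_prim0, ev_p1|]. eapply ev_primS; [exact IHn|].
  apply ev_c_succ, ev_c_cpair; [apply ev_c_entry|]; auto using ev_p0, ev_p1, ev_p2.
Qed.

(** Follows the unfolding of [2 * x] into [x + (x + 0)], so that values agree by conversion. *)
Definition c_double (g : recf) : recf := c_add g (c_add g (r_const 0)).

Lemma ev_c_double g v x : reval g v x -> reval (c_double g) v (2 * x).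
Proof. intros. apply ev_c_add; auto. apply ev_c_add; auto. apply ev_const. Qed.

Definition r_chain : recf :=
  let st := c_add (c_double (RProj 2)) (RProj 0) in
  RPrim (RProj 1)
    (c_succ (c_cpair (c_entry (c_pred st) (c_add (RProj 2) (r_const 2)) st)
      (c_succ (c_cpair (c_entry (c_pred st) (c_add (RProj 2) (r_const 3)) st)
        (RComp r_self [RProj 2; st; RProj 1]))))).

Lemma ev_chain P K U c : reval r_chain [c; U; enc_list enc_trans (fixed_trans P K U)]
  (enc_list enc_trans (chain_trans P K U c)).
Proof.
  induction c as [|i IH]; [apply ev_prim0, ev_p1|]. eapply ev_primS; [exact IH|].
  match goal with |- reval _ ?v _ => assert (S0 : reval (c_add (c_double (RProj 2)) (RProj 0)) v (2 * U + i)) end.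
  { apply ev_c_add; [apply ev_c_double, ev_p2|apply ev_p0]. }
  assert (SU : forall k, reval (c_add (RProj 2) (r_const k)) [i; enc_list enc_trans (chain_trans P K U i); U; enc_list enc_trans (fixed_trans P K U)] (U + k)).
  { intros k. apply ev_c_add; [apply ev_p2|apply ev_const]. }
  apply ev_c_succ, ev_c_cpair; [apply ev_c_entry; auto; now apply ev_c_pred|].
  apply ev_c_succ, ev_c_cpair; [apply ev_c_entry; auto; now apply ev_c_pred|].
  eapply ev_comp3; [apply ev_p2|exact S0|apply ev_p1|apply ev_self].
Qed.

Definition r_repeat (k : nat) : recf := RPrim (RProj 0) (c_succ (c_cpair (r_const k) (RProj 1))).

Lemma ev_repeat k n l : reval (r_repeat k) [n; enc_list (fun r => r) l] (enc_list (fun r => r) (repeat k n ++ l)).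
Proof.
  induction n; [apply ev_prim0, ev_p0|]. eapply ev_primS; [exact IHn|].
  apply ev_c_succ, ev_c_cpair; [apply ev_const|apply ev_p1].
Qed.

Definition r_ata : recf :=
  let c := RProj 0 in let U := RProj 1 in let st := c_add (c_double U) c in
  c_cpair st (c_cpair (c_double U) (c_cpair U (c_cpair
    (c_succ (c_cpair (c_entry (c_pred st) U (c_add U (r_const 3))) r_chain))
    (RComp (r_repeat 1) [U; RComp (r_repeat 2) [c_add U c; RZero]])))).

Lemma ev_ata P K U c : reval r_ata [c; U; enc_list enc_trans (fixed_trans P K U)] (enc_ATA (prog_ata P K U c)).
Proof.
  match goal with |- reval _ ?v _ => assert (S0 : reval (c_add (c_double (RProj 1)) (RProj 0)) v (2 * U + c)) end.
  { apply ev_c_add; [apply ev_c_double, ev_p1|apply ev_p0]. }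
  apply ev_c_cpair; [exact S0|]. apply ev_c_cpair; [apply ev_c_double, ev_p1|].
  apply ev_c_cpair; [apply ev_p1|]. apply ev_c_cpair.
  - apply ev_c_succ, ev_c_cpair; [apply ev_c_entry|apply ev_chain].
    + now apply ev_c_pred.
    + apply ev_p1.
    + apply ev_c_add; [apply ev_p1|apply ev_const].
  - cbn [rank prog_ata]. rewrite <- (app_nil_r (repeat 2 (U + c))).
    eapply ev_comp2; [apply ev_p1| |apply ev_repeat].
    eapply ev_comp2; [apply ev_c_add; [apply ev_p1|apply ev_p0]|constructor|apply (ev_repeat 2 _ [])].
Qed.

Definition r_code : recf := RComp r_ata [RProj 0; r_fst; r_snd].

(** The fixed point: [c] is used twice, as the length of the chain and, decoded, as the description
    of the fixed part. *)
Lemma ev_code P K U : let c := cpair U (enc_list enc_trans (fixed_trans P K U)) in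
  reval r_code [c] (enc_ATA (prog_ata P K U c)).
Proof.
  intros c. eapply ev_comp3; [apply ev_p0|apply ev_fst|apply ev_snd|apply ev_ata].
Qed.

(** * Diagonalisation *)

Lemma unary_program f : exists body, forall x y, reval f [x] y ->
  exec body (upd zero_regs 0 x) (upd (upd zero_regs 0 x) 1 y).
Proof.
  exists (comp f [0] 1 2). intros x y H. apply (comp_correct f [x] y H); auto.
  - simpl. intros [E|[]]. discriminate.
  - intros z Hz. apply upd_neq. lia.
Qed.

Lemma not_decidable (Q : ATA -> Prop) :
  (forall A, accepts_some_nonzeno A -> Q A) -> (forall A, Q A -> accepts_some A) ->
  ~ decidable_on thm_class Q.
Proof.
  intros Q1 Q2 [f Hf].
  destruct (unary_program (RComp f [r_code])) as [body Hbody].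
  set (n := csize body).
  (* Register 1 holds the answer. The answer 1 leads to address [n + 2], the length of [P], where
     the program halts; the answer 0 leads to the loop at [n + 1], which increases register 2 for
     ever. *)
  set (P := flat body 0 n ++ [DEC 1 (n + 2) (n + 1); INC 2 (n + 1)]).
  (* Register [r] is represented by colour [S r], so [K] must exceed all registers. *)
  set (K := S (list_max (map instr_reg P))).
  set (U := 20 + 7 * length P + (K + 5) * (K + 5)).
  (* [P], [K] and [U] are fixed before [c], so the definition is not circular. *)
  set (c := cpair U (enc_list enc_trans (fixed_trans P K U))).
  set (A := prog_ata P K U c).
  assert (Kpos : 1 <= K) by (unfold K; lia).
  assert (HU1 : 20 + 7 * length P <= U) by (unfold U; lia).
  assert (HU2 : (K + 5) * (K + 5) <= U) by (unfold U; lia).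
  assert (Hreg : forall I, In I P -> instr_reg I < K).
  { intros I HI. unfold K. apply Nat.lt_succ_r.
    pose proof (proj1 (list_max_le (map instr_reg P) _) (Nat.le_refl _)) as X.
    rewrite Forall_forall in X. apply X. now apply in_map. }
  assert (LP : length P = n + 2).
  { unfold P. rewrite length_app, flat_length. reflexivity. }
  assert (N0 : nth_error P n = Some (DEC 1 (n + 2) (n + 1))).
  { unfold P. rewrite nth_error_app2; rewrite flat_length; auto. now rewrite Nat.sub_diag. }
  assert (N1 : nth_error P (n + 1) = Some (INC 2 (n + 1))).
  { unfold P. rewrite nth_error_app2; rewrite flat_length; fold n; [|lia].
    now replace (n + 1 - n) with 1 by lia. }
  assert (CA : code_at P 0 (flat body 0 n)).
  { intros i x Hi. unfold P. rewrite nth_error_app1; auto. apply nth_error_Some. simpl. congruence. }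
  assert (EC : reval r_code [c] (enc_ATA A)) by apply ev_code.
  subst A. clearbody c U K P n.
  set (A := prog_ata P K U c) in *.
  assert (RUN : forall y, reval f [enc_ATA A] y ->
     exists m, psteps P m (0, upd zero_regs 0 c) (n, upd (upd zero_regs 0 c) 1 y)).
  { intros y Hy. apply flat_correct with (c := body); [|exact CA].
    apply Hbody. eapply ev_comp1; eauto. }
  destruct (Hf A (prog_ata_class P K U Kpos HU1 HU2 c)) as [F1 F0].
  destruct (classic (Q A)) as [HQ|HQ].
  - destruct (RUN 1 (F1 HQ)) as (m & R).
    assert (R' : psteps P (m + 1) (0, upd zero_regs 0 c) (length P, upd (upd (upd zero_regs 0 c) 1 1) 1 0)).
    { eapply psteps_trans; [exact R|]. rewrite LP. econstructor; [|constructor].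
      eapply ps_dec; eauto. }
    eapply (not_good_of_halt P K U c); eauto.
    apply (good_of_accepts P K U c); auto. lia.
  - apply HQ, Q1. destruct (RUN 0 (F0 HQ)) as (m & R).
    assert (R' : psteps P (m + 1) (0, upd zero_regs 0 c) (n + 1, upd (upd zero_regs 0 c) 1 0)).
    { eapply psteps_trans; [exact R|]. econstructor; [|constructor]. eapply ps_zero; eauto. }
    apply accepts_of_good; auto. intros N _. eapply good_of_grow; eauto.
Qed.

Theorem theorem5p2 :
  ~ decidable_on thm_class accepts_some_nonzeno /\
  ~ decidable_on thm_class accepts_some.
Proof.
  split; apply not_decidable; auto; intros A (a & t & H); exists a, t; tauto.
Qed.
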